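(* Let $\sigma:\mathbb R\to(0,+\infty)$ be a differentiable function whose first derivative $\sigma'$ is locally Lipschitz, and suppose that $\sigma$ is bounded above by a constant $\sigma_0$. Then the solution $(X_t)_{t\ge0}$ of the stochastic differential equation $$dX_t=\sigma(X_t)\,dB_t+\sigma(X_t)\sigma'(X_t)\,dt,\qquad X_0=0,$$ satisfies $E(X_t^2)\le\sigma_0^2\,t$ for every $t>0$.
   Context: $B=(B_t)_{t\ge0}$ is a standard one-dimensional Brownian motion and $E$ denotes expectation. The environment (the function $\sigma$) is deterministic. *)

(* Defs.v *)
From HB Require Import structures.
From mathcomp Require Import all_boot all_order all_algebra.
From mathcomp Require Import all_classical all_reals all_analysis.

Set Implicit Arguments.
Unset Strict Implicit.
Unset Printing Implicit Defensive.
Import Order.TTheory GRing.Theory Num.Theory.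
Import numFieldNormedType.Exports.
Local Open Scope classical_set_scope.
Local Open Scope ring_scope.

Definition locally_lipschitz (R : realType) (f : R -> R) : Prop :=
  forall x : R, exists2 U : set R, nbhs x U & [lipschitz f y | y in U].

(* Processes are functions R -> T -> R (time first); only times in [0, +oo[
   are ever constrained or used. *)

Section stochastic_calculus.
Context (d : measure_display) (T : measurableType d) (R : realType).
Variable P : probability T R.
Implicit Types (F : R -> set (set T)) (B H X : R -> T -> R).

Definition measurable_wrt (G : set (set T)) (f : T -> R) : Prop :=
  measurable_fun [set: g_sigma_algebraType G] f.

Definition filtration F : Prop :=
  [/\ forall t : R, 0 <= t -> sigma_algebra setT (F t),
      forall t : R, 0 <= t -> F t `<=` measurable
    & forall s t : R, 0 <= s -> s <= t -> F s `<=` F t].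

Definition adapted F X : Prop := forall t : R, 0 <= t -> measurable_wrt (F t) (X t).

Definition continuous_paths X : Prop :=
  forall w, {within `[0, +oo[, continuous (fun t => X t w)}.

(* normal_prob takes the standard deviation, so the increment over [s, t] has
   law N(0, t - s). *)
Definition brownian_motion F B : Prop :=
  [/\ adapted F B,
      continuous_paths B,
      {ae P, forall w, B 0 w = 0},
      (forall (s t : R) (A : set T) (U : set R), 0 <= s -> s < t ->
         F s A -> measurable U ->
         P (A `&` (B t \- B s)%R @^-1` U) = (P A * P ((B t \- B s)%R @^-1` U))%E)
    & (forall (s t : R) (U : set R), 0 <= s -> s < t -> measurable U ->
         P ((B t \- B s) @^-1` U) = normal_prob 0 (Num.sqrt (t - s)) U)].

Record simple_process := SimpleProcess {
  sp_size : nat ;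
  sp_time : nat -> R ;
  sp_coef : nat -> T -> R }.

Definition simple_process_wf F (h : simple_process) : Prop :=
  [/\ 0 <= sp_time h 0,
      forall i, sp_time h i <= sp_time h i.+1
    & forall i, (i < sp_size h)%N ->
        measurable_wrt (F (sp_time h i)) (sp_coef h i) /\
        exists M : R, forall w, `|sp_coef h i w| <= M].

Definition sp_eval (h : simple_process) : R -> T -> R := fun s w =>
  \sum_(i < sp_size h)
    sp_coef h i w * \1_(`]sp_time h i, sp_time h i.+1]) s.

Definition sp_integral B (h : simple_process) (t : R) : T -> R := fun w =>
  \sum_(i < sp_size h)
    sp_coef h i w *
      (B (Num.min (sp_time h i.+1) t) w - B (Num.min (sp_time h i) t) w).

Definition cvg0_in_probability (Y : nat -> T -> \bar R) : Prop :=
  forall e : R, 0 < e ->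
    P [set w | (e%:E <= Y n w)%E] @[n --> \oo] --> 0%E.

Definition ito_integrand F H (t : R) : Prop :=
  [/\ measurable_fun (`[0, t] `*` [set: T]) (fun p => H p.1 p.2),
      forall s : R, 0 <= s <= t -> measurable_wrt (F s) (H s)
    & {ae P, forall w,
        (\int[lebesgue_measure]_(s in `[0%R, t]) ((H s w) ^+ 2)%:E < +oo)%E}].

(* I is (a version of) the integral of H dB over [0, t]: the limit in
   probability of integrals of simple processes h n for which
   int_0^t |h n - H|^2 ds tends to 0 in probability. This determines I up to
   almost sure equality. *)
Definition ito_integral F B H (t : R) (I : T -> R) : Prop :=
  [/\ ito_integrand F H t,
      measurable_fun [set: T] I
    & exists h : nat -> simple_process,
      [/\ forall n, simple_process_wf F (h n),
          cvg0_in_probability (fun n w =>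
            \int[lebesgue_measure]_(s in `[0%R, t])
              ((sp_eval (h n) s w - H s w) ^+ 2)%:E)%E
        & cvg0_in_probability (fun n w => `|sp_integral B (h n) t w - I w|%:E)]].

(* dX = a(X) dB + b(X) dt, X_0 = x0, on the whole half-line of times *)
Definition sde_solution F B (a b : R -> R) (x0 : R) X : Prop :=
  [/\ adapted F X,
      continuous_paths X,
      {ae P, forall w, X 0 w = x0}
    & forall t : R, 0 <= t ->
        {ae P, forall w, lebesgue_measure.-integrable `[0, t]
                           (fun s => (b (X s w))%:E)} /\
        exists2 I : T -> R,
          ito_integral F B (fun s w => a (X s w)) t I
        & {ae P, forall w,
            X t w = X 0 w + I w
                    + \int[lebesgue_measure]_(s in `[0, t]) b (X s w)}].

End stochastic_calculus.

(* Main.v *)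
(* The function G(x) = \int_0^x 2 y / sigma(y)^2 dy satisfies
   sigma^2 G'' / 2 + sigma sigma' G' = 1, so E G(X_t) <= t by Ito's formula up to
   localization, and G(x) >= x^2 / sigma0^2 because sigma <= sigma0.

   Ito's formula is replaced by a second-order expansion of a truncation of G
   along a mesh k t / N, on the event that X has stayed in [- K, K] so far. It
   needs two facts about the increment of the Ito integral over [s, s']: it has
   mean zero against bounded functions of the past, and it is close in L^2 to
   sigma(X_s) (B_s' - B_s). Both hold for Riemann sums by the isometry for
   discrete integrals, and pass to the limit: the stopping argument of
   discrete_integral_tail shows that the Riemann sums converge in probability to
   the Ito integral, whatever simple processes were used to define it. Letting
   N and then K go to infinity gives the bound. *)

Require Import Defs.
From HB Require Import structures.
From mathcomp Require Import all_boot all_order all_algebra.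
From mathcomp Require Import all_classical all_reals all_analysis.
From mathcomp Require Import measurable_realfun.
From mathcomp Require Import ring lra.

Import Order.TTheory GRing.Theory Num.Theory.
Import numFieldNormedType.Exports.
Local Open Scope classical_set_scope.
Local Open Scope ring_scope.

Local Set Implicit Arguments.
Local Unset Strict Implicit.

(** The generator has divergence form, sigma^2 f'' / 2 + sigma sigma' f' = (sigma^2 f')' / 2, so f'
    = 2 x / sigma^2 solves the equation with right-hand side 1. Applied to x^2 itself, Ito's formula
    would leave the drift 2 X sigma(X) sigma'(X), which has neither a sign nor a bound.

    The errors of N steps must sum to o(1), while an increment of X is of order N^(-1/2). The
    increment is therefore split as y + r, where y = sigma(X_s) (B_s' - B_s) has a fourth moment of
    order N^(-2) and the rest r has a second moment o(1/N): errors y^4 and r^2 are affordable. Only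
    y enters the quadratic term, and its square is averaged exactly by independence.

    No stopping time is used: confinement up to a grid time is an event of the past of that time, so
    multiplying the next increment by its indicator keeps the martingale part centred. In the step
    where X leaves [- K, K] the drift increment is clipped, and nonnegativity of the truncated G
    makes the overshoot harmless. *)

Local Notation L1 P f := (P.-integrable [set: _] (EFin \o f)).
(** * Expectations of real random variables *)

Section expectation.
Context d (T : measurableType d) (R : realType) (P : probability T R).
Implicit Types f g : T -> R.

Lemma L1_measurable f : L1 P f -> measurable_fun setT f.
Proof. by move=> /measurable_int /measurable_EFinP. Qed.

Lemma le_L1 f g : measurable_fun setT f -> L1 P g ->
  (forall w, `|f w| <= g w) -> L1 P f.
Proof.
move=> mf ig fg; apply: (@le_integrable _ _ _ _ _ _ _ (EFin \o g)) => //.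
  exact/measurable_EFinP.
by move=> w _ /=; rewrite lee_fin (le_trans (fg w))// ler_norm.
Qed.

Lemma L1_bounded f (M : R) : measurable_fun setT f ->
  (forall w, `|f w| <= M) -> L1 P f.
Proof.
move=> mf fM; apply: (le_L1 (g := cst M)) => //.
exact: finite_measure_integrable_cst.
Qed.

Lemma L1_cst (c : R) : L1 P (cst c).
Proof. exact: finite_measure_integrable_cst. Qed.

Lemma L1D f g : L1 P f -> L1 P g -> L1 P (fun w => f w + g w).
Proof.
move=> fi gi; rewrite /comp; under eq_fun do rewrite EFinD.
exact: integrableD fi gi.
Qed.

Lemma L1N f : L1 P f -> L1 P (fun w => - f w).
Proof.
move=> fi; rewrite /comp; under eq_fun do rewrite EFinN.
exact: integrableN fi.
Qed.

Lemma L1B f g : L1 P f -> L1 P g -> L1 P (fun w => f w - g w).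
Proof. by move=> *; apply: L1D => //; exact: L1N. Qed.

Lemma L1Z (k : R) f : L1 P f -> L1 P (fun w => k * f w).
Proof.
move=> fi; rewrite /comp; under eq_fun do rewrite EFinM.
exact: integrableZl.
Qed.

Lemma L1_sum n (f : nat -> T -> R) : (forall i, (i < n)%N -> L1 P (f i)) ->
  L1 P (fun w => \sum_(i < n) f i w).
Proof.
elim: n => [|n IH] fi.
  by under eq_fun do rewrite big_ord0; exact: L1_cst.
under eq_fun do rewrite big_ord_recr.
by apply: L1D; [apply: IH => i ni; apply: fi; exact: ltnW|exact: fi].
Qed.

Lemma L1Ml f g (M : R) : measurable_fun setT f -> (forall w, `|f w| <= M) ->
  L1 P g -> L1 P (fun w => f w * g w).
Proof.
move=> mf fM ig; apply: (le_L1 (g := fun w => M * `|g w|)).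
- by apply: measurable_funM => //; exact: L1_measurable.
- by apply: L1Z; exact: integrable_norm.
- by move=> w; rewrite normrM ler_wpM2r.
Qed.

Lemma ExpD f g : L1 P f -> L1 P g ->
  \int[P]_w (f w + g w) = \int[P]_w f w + \int[P]_w g w.
Proof. exact: RintegralD. Qed.

Lemma ExpB f g : L1 P f -> L1 P g ->
  \int[P]_w (f w - g w) = \int[P]_w f w - \int[P]_w g w.
Proof. exact: RintegralB. Qed.

Lemma ExpZ (k : R) f : L1 P f -> \int[P]_w (k * f w) = k * \int[P]_w f w.
Proof. exact: RintegralZl. Qed.

Lemma Exp_cst (k : R) : \int[P]_w k = k.
Proof.
rewrite Rintegral_cst//; have /= -> := @probability_setT _ _ _ P.
by rewrite mulr1.
Qed.

Lemma Exp_sum n (f : nat -> T -> R) : (forall i, (i < n)%N -> L1 P (f i)) ->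
  \int[P]_w (\sum_(i < n) f i w) = \sum_(i < n) \int[P]_w f i w.
Proof.
elim: n => [|n IH] fi.
  by rewrite big_ord0; under eq_Rintegral do rewrite big_ord0; rewrite Exp_cst.
have fi' i : (i < n)%N -> L1 P (f i) by move=> ni; apply: fi; exact: ltnW.
under eq_Rintegral do rewrite big_ord_recr/=.
by rewrite ExpD ?IH ?big_ord_recr//; [exact: L1_sum|exact: fi].
Qed.

Lemma le_Exp f g : L1 P f -> L1 P g -> (forall w, f w <= g w) ->
  \int[P]_w f w <= \int[P]_w g w.
Proof. by move=> *; apply: le_Rintegral. Qed.

(** The pointwise maximum of [f] and [g] dominates [f] everywhere and equals [g] almost everywhere,
    which reduces the claim to [le_Exp]. *)
Lemma ae_le_Exp f g : L1 P f -> L1 P g -> {ae P, forall w, f w <= g w} ->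
  \int[P]_w f w <= \int[P]_w g w.
Proof.
move=> fi gi fg.
have mi : L1 P (fun w => Num.max (f w) (g w)).
  apply: (le_L1 (g := fun w => `|f w| + `|g w|)).
  - by apply: measurable_maxr; exact: L1_measurable.
  - by apply: L1D; exact: integrable_norm.
  - by move=> w; case: (leP (f w) (g w)) => _; rewrite ?lerDl ?lerDr.
apply: (@le_trans _ _ (\int[P]_w Num.max (f w) (g w))).
  by apply: le_Exp => // w; rewrite le_max lexx.
rewrite le_eqVlt; apply/orP; left; apply/eqP; congr fine.
apply: ae_eq_integral => //.
- exact: measurable_int mi.
- exact: measurable_int gi.
- by apply: filterS fg => w fgw _ /=; rewrite max_r.
Qed.

Lemma Exp_indic A : measurable A -> \int[P]_w \1_A w = fine (P A).
Proof. by move=> mA; rewrite /Rintegral integral_indic ?setIT. Qed.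

Lemma L1_indic A : measurable A -> L1 P (\1_A).
Proof.
move=> mA; apply: (L1_bounded (M := 1)); first exact: measurable_indic.
by move=> w; rewrite indicE; case: (_ \in _); rewrite ?normr1 ?normr0.
Qed.

Lemma EFin_Exp f : L1 P f -> (\int[P]_w (f w)%:E = (\int[P]_w f w)%R%:E)%E.
Proof. by move=> fi; rewrite fineK//; exact: integrable_fin_num. Qed.

Lemma ge0_L1 f : measurable_fun setT f -> (forall w, 0 <= f w) ->
  (\int[P]_w (f w)%:E < +oo)%E -> L1 P f.
Proof.
move=> mf f0 fi; apply/integrableP; split; first exact/measurable_EFinP.
by under eq_integral do rewrite /= ger0_norm//.
Qed.

Lemma markov_Exp f (e : R) : 0 < e -> L1 P f -> (forall w, 0 <= f w) ->
  fine (P [set w | e <= f w]) <= (\int[P]_w f w) / e.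
Proof.
move=> e0 fi f0; have mA : measurable [set w | e <= f w].
  rewrite -[X in measurable X]setTI.
  by apply: measurable_fun_le => //; exact: L1_measurable fi.
rewrite -Exp_indic// ler_pdivlMr// mulrC -ExpZ; last exact: L1_indic.
apply: le_Exp => //; first by apply: L1Z; exact: L1_indic.
move=> w; rewrite indicE; have [/set_mem/= h|_] := boolP (w \in _).
  by rewrite mulr1.
by rewrite mulr0.
Qed.

End expectation.

(** * Independence *)

Section sub_sigma_algebra.
Context d (T : measurableType d) (R : realType).
Variable G : set (set T).
Hypothesis GT : G `<=` measurable.
Implicit Types f : T -> R.

(** Turns the inclusion of [G] in the ambient sigma-algebra into a measurable map, so that
    measurability and laws are transported by composition. *)
Lemma measurable_fun_sub_id :
  measurable_fun [set: T] (id : T -> g_sigma_algebraType G).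
Proof.
move=> _ A mA; rewrite setTI preimage_id.
have sGT : <<s G>> `<=` @measurable d T.
  by apply: smallest_sub => //; exact: sigma_algebra_measurable.
exact: sGT.
Qed.

Lemma measurable_wrt_measurable f : measurable_wrt G f -> measurable_fun setT f.
Proof. by move=> mf; apply: (measurableT_comp mf measurable_fun_sub_id). Qed.

End sub_sigma_algebra.

Lemma measurable_wrtS d (T : measurableType d) (R : realType)
  (G G' : set (set T)) (f : T -> R) : G `<=` G' -> measurable_wrt G f -> measurable_wrt G' f.
Proof.
move=> GG' mf _ A mA; apply: (sub_sigma_algebra2 GG').
exact: mf.
Qed.

Section independence.
Context d (T : measurableType d) (R : realType) (P : probability T R).
Variables (G : set (set T)) (Z : T -> R).
Hypotheses (sG : sigma_algebra setT G) (GT : G `<=` measurable).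
Hypothesis mZ : measurable_fun setT Z.
Hypothesis GZ : forall A U, G A -> measurable U ->
  P (A `&` Z @^-1` U) = (P A * P (Z @^-1` U))%E.

Let T' := g_sigma_algebraType G.
Let idT : T -> T' := id.
Let midT : measurable_fun setT idT := measurable_fun_sub_id GT.
Let p : T -> T' * R := fun w => (w, Z w).
Let mp : measurable_fun setT p.
Proof. by apply/measurable_fun_pairP; split. Qed.

HB.instance Definition _ := isMeasurableFun.Build _ _ _ _ idT midT.
HB.instance Definition _ := isMeasurableFun.Build _ _ _ _ Z mZ.
HB.instance Definition _ := isMeasurableFun.Build _ _ _ _ p mp.

Let PG := distribution P idT.
Let PZ := distribution P Z.

(** The pair of the identity, valued in the space carrying [G], and of [Z] has a product law: [GZ]
    is the factorization on rectangles, which determine the product measure. All [G]-measurable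
    factors [Y] are thereby handled at once. *)
Let joint_law X : measurable X -> (PG \x PZ)%E X = distribution P p X.
Proof.
apply: product_measure_unique => A U mA mU.
apply: GZ => //.
have : <<s G>> A by [].
by rewrite (sigma_algebra_id sG).
Qed.

Section product.
Variables (Y : T -> R) (g : R -> R).
Hypotheses (mY : measurable_wrt G Y) (mg : measurable_fun setT g).
Hypotheses (iY : L1 P Y) (ig : L1 P (g \o Z)).

Let h (x : T' * R) : \bar R := (Y x.1 * g x.2)%:E.

Let mh : measurable_fun setT h.
Proof.
apply/measurable_EFinP; apply: measurable_funM.
  exact: (measurableT_comp mY measurable_fst).
exact: (measurableT_comp mg measurable_snd).
Qed.

Let iY' : PG.-integrable setT (EFin \o (Y : T' -> R)).
Proof. by apply: integrable_pushforward => //; exact/measurable_EFinP. Qed.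

Let ig' : PZ.-integrable setT (EFin \o g).
Proof. by apply: integrable_pushforward => //; exact/measurable_EFinP. Qed.

Let ih : (PG \x PZ)%E.-integrable setT h.
Proof.
apply/integrable12ltyP => //.
have cg : (\int[PZ]_y `|(g y)%:E| < +oo)%E by case/integrableP : ig'.
have cY : (\int[PG]_x `|(Y x)%:E| < +oo)%E by case/integrableP : iY'.
under eq_integral => x _.
  rewrite (_ : (\int[PZ]_y _)%E = (`|(Y x)%:E| * \int[PZ]_y `|(g y)%:E|)%E).
    over.
  rewrite -ge0_integralZl//; last first.
    by apply: measurableT_comp => //; exact/measurable_EFinP.
  by apply: eq_integral => y _; rewrite /h/= normrM EFinM.
rewrite ge0_integralZr//; last 2 first.
- by apply: measurableT_comp => //; exact/measurable_EFinP.
- exact: integral_ge0.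
by rewrite lte_mul_pinfty// ?ge0_fin_numE// integral_ge0.
Qed.

Lemma L1M_indep : L1 P (fun w => Y w * g (Z w)).
Proof.
have -> : EFin \o (fun w => Y w * g (Z w)) = h \o p by [].
apply/integrableP; split; first exact: measurableT_comp.
have /integrableP[_] := ih.
rewrite (eq_measure_integral (distribution P p)); last first.
  by move=> A mA _; exact: joint_law.
by rewrite ge0_integral_distribution//; exact: measurableT_comp.
Qed.

(** Fubini under the product law of [joint_law], once both sides are written as integrals against
    image measures. *)
Lemma ExpM_indep :
  \int[P]_w (Y w * g (Z w)) = \int[P]_w Y w * \int[P]_w g (Z w).
Proof.
rewrite [LHS]/Rintegral.
have -> : (\int[P]_w (Y w * g (Z w))%:E = \int[P]_w (h \o p) w)%E by [].
rewrite -(@integral_distribution _ _ _ _ _ P p h)//; last exact: L1M_indep.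
transitivity (fine (\int[PG \x PZ]_x h x)%E).
  by congr fine; apply: eq_measure_integral => A mA _; exact/esym/joint_law.
rewrite -integral12_prod_meas1//.
have -> : (\int[P]_w g (Z w)) = \int[PZ]_y g y.
  by rewrite /Rintegral (@integral_distribution _ _ _ _ _ P Z)//;
    exact/measurable_EFinP.
have -> : (\int[P]_w Y w) = \int[PG]_y Y y.
  by rewrite /Rintegral (@integral_distribution _ _ _ _ _ P idT)//;
    exact/measurable_EFinP.
rewrite -RintegralZr// /Rintegral; congr fine; apply: eq_integral => x _.
rewrite /fubini_F /h/= -RintegralZl// /Rintegral fineK//.
apply: integrable_fin_num => //; rewrite /comp.
by under eq_fun do rewrite EFinM; exact: integrableZl.
Qed.

End product.
End independence.

(** * Gaussian moments *)

Section gaussian.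
Context d (T : measurableType d) (R : realType) (P : probability T R).
Variables (Z : T -> R) (s : R).
Hypotheses (s0 : 0 < s) (mZ : measurable_fun setT Z).
Hypothesis lawZ :
  forall U, measurable U -> P (Z @^-1` U) = normal_prob 0 s U.

Let Z' : T -> measurableTypeR R := Z.
Let mZ' : measurable_fun setT Z' := mZ.
HB.instance Definition _ := isMeasurableFun.Build _ _ _ _ Z' mZ'.

Let mu := @lebesgue_measure R.
Let nu := normal_prob 0 s.

Lemma ge0_integral_gaussian (f : R -> R) : measurable_fun setT f ->
  (forall x, 0 <= f x) ->
  (\int[P]_w (f (Z w))%:E = \int[mu]_x (f x * normal_pdf 0 s x)%:E)%E.
Proof.
move=> mf f0.
have -> : (\int[P]_w (f (Z w))%:E = \int[distribution P Z']_x (f x)%:E)%E.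
  by rewrite ge0_integral_distribution//; exact/measurable_EFinP.
transitivity (\int[nu]_x (f x)%:E)%E.
by apply: eq_measure_integral => A mA _; exact: lawZ.
have numu : nu `<< mu by exact: normal_prob_dominates.
rewrite -(Radon_Nikodym_SigmaFinite.change_of_variables numu)//; last first.
  exact/measurable_EFinP.
apply: ae_eq_integral => //.
- apply: emeasurable_funM; first exact/measurable_EFinP.
  exact: measurable_int (Radon_Nikodym_SigmaFinite.f_integrable numu).
- apply/measurable_EFinP; apply: measurable_funM => //.
  exact: measurable_normal_pdf.
under [X in ae_eq _ _ _ X]eq_fun do rewrite EFinM.
(* The Radon-Nikodym derivative and [normal_pdf] have the same integral over every measurable set,
   hence agree almost everywhere. *)
apply: ae_eqe_mul2l; apply: integral_ae_eq => //.
- exact: Radon_Nikodym_SigmaFinite.f_integrable.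
- apply/measurable_EFinP; exact: measurable_normal_pdf.
- by move=> A _ mA; rewrite -Radon_Nikodym_SigmaFinite.f_integral.
Qed.

(* Completing the square turns the exponentially tilted density into a
   multiple of the density of mean [l * s ^+ 2]. *)
Lemma gaussian_mgf_ereal (l : R) :
  (\int[P]_w (expR (l * Z w))%:E = (expR (l ^+ 2 * s ^+ 2 / 2))%:E)%E.
Proof.
rewrite (ge0_integral_gaussian (f := fun x => expR (l * x))); last 2 first.
- by apply: measurableT_comp => //; exact: measurable_funM.
- by move=> x; exact: expR_ge0.
rewrite (_ : (fun x => _) = fun x =>
    ((expR (l ^+ 2 * s ^+ 2 / 2))%:E * (normal_pdf (l * s ^+ 2) s x)%:E)%E).
  rewrite integralZl//; last exact: integrable_normal_pdf.
  by rewrite integral_normal_pdf mule1.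
apply/funext => x; rewrite -EFinM; congr (_%:E).
have s_neq0 : s != 0 by rewrite gt_eqF.
rewrite !normal_pdfE// /normal_fun mulrCA [RHS]mulrCA -!expRD.
by congr (_ * expR _); field.
Qed.

Lemma gaussian_exp_L1 (l : R) : L1 P (fun w => expR (l * Z w)).
Proof.
apply: ge0_L1 => [|w|]; last by rewrite gaussian_mgf_ereal ltry.
  by apply: measurableT_comp => //; exact: measurable_funM.
exact: expR_ge0.
Qed.

Lemma gaussian_mgf (l : R) :
  \int[P]_w expR (l * Z w) = expR (l ^+ 2 * s ^+ 2 / 2).
Proof. by rewrite /Rintegral gaussian_mgf_ereal. Qed.

Let expR_norm_le (c x : R) : expR (c * `|x|) <= expR (c * x) + expR (- c * x).
Proof.
have [x0|x0] := leP 0 x; first by rewrite ger0_norm// lerDl expR_ge0.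
by rewrite ltr0_norm// mulrN mulNr lerDr expR_ge0.
Qed.

(** A single term of the exponential series at c |x| is at most exp(c |x|), itself at most exp(c x)
    + exp(- c x). *)
Let expr_le_expR n (c x : R) : 0 < c ->
  `|x| ^+ n.+1 <= (n.+1)`!%:R / c ^+ n.+1 * (expR (c * x) + expR (- c * x)).
Proof.
move=> c0; rewrite mulrAC ler_pdivlMr ?exprn_gt0// mulrC -exprMn.
rewrite -ler_pdivrMl ?ltr0n ?fact_gt0// mulrC.
apply: le_trans (expR_norm_le c x).
apply: (le_trans _ (expR_ge1Dxn n _)); last by rewrite mulr_ge0// ltW.
by rewrite lerDr.
Qed.

Let dom_L1 (C c : R) : L1 P (fun w => C * (expR (c * Z w) + expR (- c * Z w))).
Proof. by apply: L1Z; apply: L1D; exact: gaussian_exp_L1. Qed.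

(** Uniform over |l| <= c, as domination in [gaussian_derive] requires. The power costs one factor
    exp(c x) + exp(- c x), the exponential another, and (u + v)^2 <= 2 (u^2 + v^2) merges them. *)
Let expr_expR_bound n (c l x : R) : 0 < c -> `|l| <= c ->
  `|x ^+ n.+1 * expR (l * x)| <=
  (n.+1)`!%:R / c ^+ n.+1 * 2 * (expR (2 * c * x) + expR (- (2 * c) * x)).
Proof.
move=> c0 lc; rewrite normrM normrX (ger0_norm (expR_ge0 _)).
have h1 : expR (l * x) <= expR (c * `|x|).
  rewrite ler_expR (le_trans (ler_norm _))// normrM.
  exact: ler_wpM2r.
have h2 := expr_le_expR n x c0.
have h3 := expR_norm_le c x.
apply: (le_trans (ler_pM _ _ h2 (le_trans h1 h3))); rewrite ?exprn_ge0 ?expR_ge0//.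
rewrite -!mulrA ler_wpM2l ?ler0n//.
rewrite ler_wpM2l ?invr_ge0 ?exprn_ge0 ?(ltW c0)//.
rewrite !mulNr -mulrA.
have -> : - (2 * (c * x)) = - (c * x) + - (c * x) by ring.
have -> : 2 * (c * x) = (c * x) + (c * x) by ring.
rewrite !expRD; move: (expR _) (expR _) => u v.
by rewrite -subr_ge0 (_ : _ - _ = (u - v) ^+ 2) ?sqr_ge0//; ring.
Qed.

Lemma gaussian_expr_expR_L1 n (l : R) :
  L1 P (fun w => Z w ^+ n * expR (l * Z w)).
Proof.
case: n => [|n]; first by under eq_fun do rewrite expr0 mul1r;
  exact: gaussian_exp_L1.
have c0 : 0 < `|l| + 1 by rewrite ltr_wpDl.
have lc : `|l| <= `|l| + 1 by rewrite lerDl.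
apply: (le_L1 _ (dom_L1 _ _) (fun w => expr_expR_bound n (Z w) c0 lc)).
apply: measurable_funM; first exact: measurable_funX.
by apply: measurableT_comp => //; exact: measurable_funM.
Qed.

(** Differentiation under the integral sign on ]- c, c[ with c = |l| + 1. At l = 0 it extracts
    moments of [Z] from the moment generating function. *)
Let gaussian_derive n (l : R) :
  (fun x => \int[P]_w (Z w ^+ n * expR (x * Z w)))^`()%classic l =
  \int[P]_w (Z w ^+ n.+1 * expR (l * Z w)).
Proof.
pose f x w := Z w ^+ n * expR (x * Z w).
have f' x w : is_derive x (1 : R) (f ^~ w) (Z w ^+ n.+1 * expR (x * Z w)).
  have -> : f ^~ w = Z w ^+ n \*: (expR \o (Z w \*: (id : R -> R))).
    by apply/funext => y; rewrite /f/= /GRing.scale/= (mulrC y).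
  apply: is_derive_eq; rewrite /GRing.scale/= mulr1 exprS (mulrC x).
  ring.
have d1f x w : partial1of2 f x w = Z w ^+ n.+1 * expR (x * Z w).
  by rewrite partial1of2E; exact: derive_val.
pose c := `|l| + 1.
have c0 : 0 < c by rewrite ltr_wpDl.
transitivity (\int[P]_w partial1of2 f l w); last first.
  by apply: eq_Rintegral => w _; rewrite d1f.
apply: (@differentiation_under_integral R d T P f setT measurableT l (- c) c
  _ _ _ _ _ (dom_L1 ((n.+1)`!%:R / c ^+ n.+1 * 2) (2 * c))).
- by rewrite /= in_itv/= -ltr_norml ltrDl.
- by move=> x _; exact: gaussian_expr_expR_L1.
- by move=> x w _ _; exact: ex_derive.
- by move=> w; rewrite mulr_ge0 ?addr_ge0 ?expR_ge0// !mulr_ge0 ?invr_ge0 ?exprn_ge0 ?(ltW c0).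
- move=> x w; rewrite /= in_itv/= -ltr_norml => xc _; rewrite d1f.
  by have := expr_expR_bound n (Z w) c0 (ltW xc).
Qed.

Let gaussian_Exp_expR (l : R) :
  \int[P]_w (Z w * expR (l * Z w)) = l * s ^+ 2 * expR (l ^+ 2 * s ^+ 2 / 2).
Proof.
have := gaussian_derive 0 l.
under [X in _ = X]eq_Rintegral do rewrite expr1.
move=> <-.
have -> : (fun x => \int[P]_w (Z w ^+ 0 * expR (x * Z w))) =
    expR \o ((s ^+ 2 / 2) \*: (fun x : R => x ^+ 2)).
  apply/funext => x /=; rewrite /GRing.scale/= mulrC mulrA -gaussian_mgf.
  by apply: eq_Rintegral => w _; rewrite expr0 mul1r.
rewrite derive1E; apply: derive_val.
apply: is_derive_eq; rewrite [X in expR X * _](_ : _ = l ^+ 2 * s ^+ 2 / 2).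
  by rewrite /GRing.scale/=; field.
by rewrite -[RHS]mulrA [RHS]mulrC.
Qed.

Lemma gaussian_L1 : L1 P Z.
Proof.
have := gaussian_expr_expR_L1 1 0.
by under eq_fun do rewrite mul0r expR0 mulr1 expr1.
Qed.

Lemma gaussian_sqr_L1 : L1 P (fun w => Z w ^+ 2).
Proof.
have := gaussian_expr_expR_L1 2 0.
by rewrite /comp; under eq_fun do rewrite mul0r expR0 mulr1.
Qed.

Lemma gaussian_expr4_L1 : L1 P (fun w => Z w ^+ 4).
Proof.
have := gaussian_expr_expR_L1 4 0.
by rewrite /comp; under eq_fun do rewrite mul0r expR0 mulr1.
Qed.

Lemma gaussian_Exp : \int[P]_w Z w = 0.
Proof.
have := gaussian_Exp_expR 0; rewrite !mul0r => <-.
by apply: eq_Rintegral => w _; rewrite mul0r expR0 mulr1.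
Qed.

Lemma gaussian_Exp_sqr : \int[P]_w (Z w ^+ 2) = s ^+ 2.
Proof.
have := gaussian_derive 1 0.
under [X in _ = X]eq_Rintegral do rewrite mul0r expR0 mulr1.
move=> <-.
have -> : (fun x => \int[P]_w (Z w ^+ 1 * expR (x * Z w))) =
    (s ^+ 2 \*: id) *
    (expR \o ((s ^+ 2 / 2) \*: (fun x : R => x ^+ 2))).
  apply/funext => x.
  transitivity (x * s ^+ 2 * expR (x ^+ 2 * s ^+ 2 / 2)).
    rewrite -gaussian_Exp_expR.
    by apply: eq_Rintegral => w _; rewrite expr1.
  by rewrite (mulrC x) -[X in expR X]mulrA [X in expR X]mulrC.
rewrite derive1E; apply: derive_val.
apply: is_derive_eq; rewrite /GRing.scale/= expr0n/= !scaler0 expR0.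
by rewrite mul0r add0r mul1r mulr1.
Qed.

(** Only the order in s matters, so the moment is not computed: [expr_le_expR] at c = 1 / s costs 4!
    s^4 times two exponential moments, each equal to exp(1 / 2). *)
Lemma gaussian_Exp_expr4 :
  \int[P]_w (Z w ^+ 4) <= 48 * expR (1 / 2) * s ^+ 4.
Proof.
have c0 : 0 < s^-1 by rewrite invr_gt0.
apply: (@le_trans _ _ (\int[P]_w (4`!%:R / s^-1 ^+ 4 *
    (expR (s^-1 * Z w) + expR (- s^-1 * Z w))))).
  apply: le_Exp; [exact: gaussian_expr4_L1|exact: dom_L1|move=> w].
  have := expr_le_expR 3 (Z w) c0.
  by rewrite -normrX ger0_norm// exprn_even_ge0.
rewrite ExpZ; last by apply: L1D; exact: gaussian_exp_L1.
rewrite ExpD; [|exact: gaussian_exp_L1|exact: gaussian_exp_L1].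
have e : s^-1 ^+ 2 * s ^+ 2 = 1 by rewrite -exprMn mulVf ?expr1n// gt_eqF.
rewrite !gaussian_mgf sqrrN e.
rewrite (_ : 4`!%:R = 24 :> R)// exprVn invrK le_eqVlt; apply/orP; left.
by apply/eqP; ring.
Qed.

End gaussian.

(** * Brownian increments and discrete integrals *)

Section brownian.
Context d (T : measurableType d) (R : realType) (P : probability T R).
Variables (F : R -> set (set T)) (B : R -> T -> R).
Hypotheses (hF : filtration F) (hB : brownian_motion P F B).

Lemma filtration_measurable t (f : T -> R) : 0 <= t ->
  measurable_wrt (F t) f -> measurable_fun setT f.
Proof.
case: hF => _ FT _ t0; apply: measurable_wrt_measurable; exact: FT.
Qed.

Lemma filtration_measurableW s t (f : T -> R) : 0 <= s -> s <= t ->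
  measurable_wrt (F s) f -> measurable_wrt (F t) f.
Proof. by case: hF => _ _ FS s0 st; apply: measurable_wrtS; exact: FS. Qed.

Lemma adapted_measurable (X : R -> T -> R) t : adapted F X -> 0 <= t ->
  measurable_fun setT (X t).
Proof. by move=> aX t0; apply: (filtration_measurable t0); exact: aX. Qed.

Lemma bm_measurable t : 0 <= t -> measurable_fun setT (B t).
Proof. by case: hB => aB _ _ _ _; exact: adapted_measurable. Qed.

Section increment.
Variables s t : R.
Hypotheses (s0 : 0 <= s) (st : s <= t).
Let D w := B t w - B s w.

Let mD : measurable_fun setT D.
Proof.
apply: measurable_funB; apply: bm_measurable => //.
exact: le_trans st.
Qed.

Lemma bm_increment_measurable_wrt : measurable_wrt (F t) D.
Proof.
case: hB => aB _ _ _ _; apply: measurable_funB.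
  by apply: aB; exact: le_trans st.
by apply: (filtration_measurableW s0 st); exact: aB.
Qed.

Let D_law : s < t -> forall U, measurable U ->
  P (D @^-1` U) = normal_prob 0 (Num.sqrt (t - s)) U.
Proof. by move=> lst U mU; case: hB => _ _ _ _; exact. Qed.

Let sqrt_gt0 : s < t -> 0 < Num.sqrt (t - s).
Proof. by rewrite sqrtr_gt0 subr_gt0. Qed.

(** [brownian_motion] describes increments over s < t only. The degenerate case is covered as well,
    since the grids built later may repeat a point. *)
Let D_eq0 : ~~ (s < t) -> D = cst 0.
Proof.
rewrite -leNgt => ts; have e : t = s by apply/eqP; rewrite eq_le st ts.
by apply/funext => w; rewrite /D e subrr.
Qed.

Lemma bm_increment_L1 : L1 P D.
Proof.
have [lst|/D_eq0 ->] := boolP (s < t); last exact: L1_cst.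
exact: gaussian_L1 (sqrt_gt0 lst) mD (D_law lst).
Qed.

Lemma bm_increment_sqr_L1 : L1 P (fun w => D w ^+ 2).
Proof.
have [lst|/D_eq0 ->] := boolP (s < t); last exact: (L1_cst P (0 ^+ 2)).
exact: gaussian_sqr_L1 (sqrt_gt0 lst) mD (D_law lst).
Qed.

Lemma bm_increment_expr4_L1 : L1 P (fun w => D w ^+ 4).
Proof.
have [lst|/D_eq0 ->] := boolP (s < t); last exact: (L1_cst P (0 ^+ 4)).
exact: gaussian_expr4_L1 (sqrt_gt0 lst) mD (D_law lst).
Qed.

Lemma bm_increment_Exp : \int[P]_w D w = 0.
Proof.
have [lst|/D_eq0 ->] := boolP (s < t); last exact: Exp_cst.
exact: gaussian_Exp (sqrt_gt0 lst) mD (D_law lst).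
Qed.

Lemma bm_increment_Exp_sqr : \int[P]_w (D w ^+ 2) = t - s.
Proof.
have [lst|nst] := boolP (s < t).
  rewrite (gaussian_Exp_sqr (sqrt_gt0 lst) mD (D_law lst)).
  by rewrite sqr_sqrtr// subr_ge0.
have ts : t = s by apply/eqP; rewrite eq_le st leNgt nst.
rewrite (D_eq0 nst); under eq_Rintegral do rewrite expr0n/=.
by rewrite Exp_cst ts subrr.
Qed.

Lemma bm_increment_Exp_expr4 :
  \int[P]_w (D w ^+ 4) <= 48 * expR (1 / 2) * (t - s) ^+ 2.
Proof.
have [lst|nst] := boolP (s < t).
  apply: (le_trans (gaussian_Exp_expr4 (sqrt_gt0 lst) mD (D_law lst))).
  by rewrite (exprM _ 2 2) sqr_sqrtr// subr_ge0.
have ts : t = s by apply/eqP; rewrite eq_le st leNgt nst.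
rewrite (D_eq0 nst); under eq_Rintegral do rewrite expr0n/=.
by rewrite Exp_cst ts subrr expr0n mulr0.
Qed.

Let indep_D A U : s < t -> F s A -> measurable U ->
  P (A `&` D @^-1` U) = (P A * P (D @^-1` U))%E.
Proof.
by move=> lst FA mU; case: hB => _ _ _ h _; exact: (h s t A U s0 lst FA mU).
Qed.

Let sF : sigma_algebra setT (F s). Proof. by case: hF => h _ _; exact: h. Qed.

Let FsT : F s `<=` measurable. Proof. by case: hF => _ h _; exact: h. Qed.

Variable Y : T -> R.
Hypotheses (mY : measurable_wrt (F s) Y) (iY : L1 P Y).

(** For s < t this is the product formula for independent variables; for s = t the second factor is
    the constant g(0). *)
Lemma bm_increment_indep (g : R -> R) : measurable_fun setT g ->
  L1 P (g \o D) ->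
  L1 P (fun w => Y w * g (D w)) /\
  \int[P]_w (Y w * g (D w)) = \int[P]_w Y w * \int[P]_w g (D w).
Proof.
move=> mg ig; have [lst|nst] := boolP (s < t).
  have ind A U := indep_D (A := A) (U := U) lst.
  by split; [exact: (L1M_indep sF FsT mD ind)|exact: (ExpM_indep sF FsT mD ind)].
rewrite (D_eq0 nst) (Exp_cst P (g 0)); split.
  by rewrite (_ : (fun _ => _) = fun w => g 0 * Y w);
    [exact: L1Z|apply/funext => w; rewrite mulrC].
transitivity (\int[P]_w (g 0 * Y w)); last by rewrite ExpZ// mulrC.
by apply: eq_Rintegral => w _; rewrite mulrC.
Qed.

Lemma L1M_increment : L1 P (fun w => Y w * D w).
Proof. by have [] := bm_increment_indep (@measurable_id _ _ _) bm_increment_L1. Qed.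

Lemma ExpM_increment : \int[P]_w (Y w * D w) = 0.
Proof.
have [_ ->] := bm_increment_indep (@measurable_id _ _ _) bm_increment_L1.
by rewrite bm_increment_Exp mulr0.
Qed.

Lemma L1M_increment_sqr : L1 P (fun w => Y w * D w ^+ 2).
Proof.
have m2 : measurable_fun setT (fun x : R => x ^+ 2) by exact: measurable_funX.
by have [] := bm_increment_indep m2 bm_increment_sqr_L1.
Qed.

Lemma ExpM_increment_sqr :
  \int[P]_w (Y w * D w ^+ 2) = \int[P]_w Y w * (t - s).
Proof.
have m2 : measurable_fun setT (fun x : R => x ^+ 2) by exact: measurable_funX.
have [_ ->] := bm_increment_indep m2 bm_increment_sqr_L1.
by rewrite bm_increment_Exp_sqr.
Qed.

End increment.

(** * Discrete stochastic integrals and their isometry *)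

Section discrete_integral.
Variables (u : nat -> R) (g : nat -> T -> R) (n : nat) (M : R).
Hypotheses (u0 : 0 <= u 0%N) (u_nd : forall i, u i <= u i.+1).
Hypothesis mg : forall i, (i < n)%N -> measurable_wrt (F (u i)) (g i).
Hypothesis gM : forall i w, (i < n)%N -> `|g i w| <= M.

(** Each coefficient is known at the left end of its cell, so the partial sums form a martingale
    along the grid. The number of terms is an argument because the isometry is proved by induction
    on it. *)
Definition discrete_integral k w :=
  \sum_(i < k) g i w * (B (u i.+1) w - B (u i) w).
Local Notation S := discrete_integral.

Let u_ge0 i : 0 <= u i.
Proof. by elim: i => // i /le_trans; apply. Qed.

Lemma discrete_integral_measurable_wrt k : (k <= n)%N ->
  measurable_wrt (F (u k)) (S k).
Proof.
elim: k => [|k IH] kn.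
  rewrite (_ : S 0 = cst 0); first exact: measurable_cst.
  by apply/funext => w; rewrite /S big_ord0.
rewrite (_ : S k.+1 = fun w => S k w + g k w * (B (u k.+1) w - B (u k) w));
  last by apply/funext => w; rewrite /S big_ord_recr.
apply: measurable_funD.
  by apply: (filtration_measurableW (u_ge0 k)) => //; apply: IH; exact: ltnW.
apply: measurable_funM; last exact: bm_increment_measurable_wrt.
by apply: (filtration_measurableW (u_ge0 k)) => //; exact: mg.
Qed.

(** In the square of [S k.+1] the cross term is the last increment times [g k w * S k w], known at
    time [u k], so its mean is zero; the square of the last increment is independent of [g k] and
    contributes its variance. Integrability is part of the induction because the cross term needs
    [S k] integrable. *)
Lemma discrete_integral_isometry k : (k <= n)%N ->
  L1 P (fun w => S k w ^+ 2) /\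
  \int[P]_w (S k w ^+ 2) =
    \sum_(i < k) \int[P]_w (g i w ^+ 2) * (u i.+1 - u i).
Proof.
elim: k => [|k IH] kn.
  rewrite big_ord0 (_ : (fun w => S 0 w ^+ 2) = cst 0).
    by split; [exact: L1_cst|exact: Exp_cst].
  by apply/funext => w; rewrite /S big_ord0 expr0n.
have [iS ES] := IH (ltnW kn).
have mS := discrete_integral_measurable_wrt (ltnW kn).
have mS' := filtration_measurable (u_ge0 k) mS.
have mgk := mg kn.
have mgk' := filtration_measurable (u_ge0 k) mgk.
have iS1 : L1 P (S k).
  apply: (@le_L1 _ _ _ _ _ (fun w => 1 + S k w ^+ 2)) => //.
    by apply: L1D => //; exact: L1_cst.
  by move=> w; rewrite ler_norml; apply/andP; split; nra.
pose D w := B (u k.+1) w - B (u k) w.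
have iSg : L1 P (fun w => g k w * S k w).
  by apply: (L1Ml (M := M)) => // w; exact: gM.
have mSg : measurable_wrt (F (u k)) (fun w => g k w * S k w).
  exact: measurable_funM.
have igg : L1 P (fun w => g k w ^+ 2).
  apply: (@L1_bounded _ _ _ _ _ (M ^+ 2)) => [|w]; first exact: measurable_funX.
  by rewrite normrX lerXn2r// ?nnegrE// ?(le_trans _ (gM w kn))// gM.
have mgg : measurable_wrt (F (u k)) (fun w => g k w ^+ 2).
  exact: measurable_funX.
have i1 := L1M_increment (u_ge0 k) (u_nd k) mSg iSg.
have i2 := L1M_increment_sqr (u_ge0 k) (u_nd k) mgg igg.
have E1 := ExpM_increment (u_ge0 k) (u_nd k) mSg iSg.
have E2 := ExpM_increment_sqr (u_ge0 k) (u_nd k) mgg igg.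
have e : (fun w => S k.+1 w ^+ 2) = fun w => S k w ^+ 2 +
    (2 * ((g k w * S k w) * D w) + g k w ^+ 2 * D w ^+ 2).
  by apply/funext => w; rewrite /S big_ord_recr/= -/(S k w) -/(D w); ring.
have i12 : L1 P (fun w => 2 * ((g k w * S k w) * D w) + g k w ^+ 2 * D w ^+ 2).
  by apply: L1D => //; exact: L1Z.
rewrite e; split; first exact: L1D.
by rewrite ExpD// ExpD ?ExpZ ?E1 ?E2 ?mulr0 ?add0r ?big_ord_recr/= ?ES//; exact: L1Z.
Qed.

End discrete_integral.
End brownian.

(** * Convergence in probability *)

(** Sends a small parameter to zero whatever the sign of C: if a > b, the case l = 1 forces C > 0,
    and l = (a - b) / (2 C), capped at 1, gives a contradiction. *)
Lemma le_of_le_addM (R : realFieldType) (a b C : R) :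
  (forall l, 0 < l -> l <= 1 -> a <= b + C * l) -> a <= b.
Proof.
move=> h; rewrite leNgt; apply/negP => ba.
have C0 : 0 < C.
  by have := h 1 ltr01 (lexx _); rewrite mulr1 -lerBlDl; apply: lt_le_trans; rewrite subr_gt0.
have l0 : 0 < Num.min 1 ((a - b) / (2 * C)).
  by rewrite lt_min ltr01 divr_gt0 ?subr_gt0// mulr_gt0.
have := h _ l0; rewrite ge_min lexx => /(_ isT).
apply/negP; rewrite -ltNge -ltrBrDl.
apply: (@le_lt_trans _ _ (C * ((a - b) / (2 * C)))).
  by rewrite ler_pM2l// ge_min lexx orbT.
rewrite (_ : C * _ = (a - b) / 2); last by field; rewrite gt_eqF.
by rewrite ltr_pdivrMr// mulr_natr mulr2n ltrDl subr_gt0.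
Qed.

Section probability_of_events.
Context d (T : measurableType d) (R : realType) (P : probability T R).
Implicit Types A B : set T.

Lemma le_Pr A B : measurable A -> measurable B -> A `<=` B ->
  fine (P A) <= fine (P B).
Proof.
move=> mA mB AB; rewrite fine_le ?fin_num_measure//.
by apply: le_measure => //; rewrite inE.
Qed.

Lemma PrU A B : measurable A -> measurable B ->
  fine (P (A `|` B)) <= fine (P A) + fine (P B).
Proof.
move=> mA mB; rewrite -fineD ?fin_num_measure// fine_le ?fin_num_measure//.
- exact: measurableU.
- by rewrite fin_numD !fin_num_measure.
- exact: measureU2.
Qed.

Lemma Pr_ge0 A : 0 <= fine (P A).
Proof. exact: fine_ge0. Qed.

Lemma measurable_le_level (f : T -> R) (e : R) : measurable_fun setT f ->
  measurable [set w | e <= f w].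
Proof.
by move=> mf; rewrite -[X in measurable X]setTI; exact: measurable_fun_le.
Qed.

Lemma measurable_ge_level (f : T -> R) (e : R) : measurable_fun setT f ->
  measurable [set w | f w <= e].
Proof.
by move=> mf; rewrite -[X in measurable X]setTI; exact: measurable_fun_le.
Qed.

End probability_of_events.

(** Monotone convergence for sequences eventually equal to their limit at each point, as happens for
    truncations and localizations at growing levels. *)
Lemma monotone_integral_le d (T : measurableType d) (R : realType)
    (P : probability T R) (f : nat -> T -> R) (g : T -> R) (c : R) :
  (forall n, measurable_fun setT (f n)) -> (forall n w, 0 <= f n w) ->
  (forall w, {homo f ^~ w : n m / (n <= m)%N >-> n <= m}) ->
  (forall w, \forall n \near \oo, f n w = g w) ->
  (forall n, \int[P]_w (f n w)%:E <= c%:E)%E ->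
  (\int[P]_w (g w)%:E <= c%:E)%E.
Proof.
move=> mf f0 ndf fg fc.
have -> : (\int[P]_w (g w)%:E = \int[P]_w limn (fun n => (f n w)%:E))%E.
  apply: eq_integral => w _; apply/esym/cvg_lim => //.
  by apply: cvg_near_cst; apply: filterS (fg w) => n ->.
rewrite monotone_convergence//; last 3 first.
- by move=> n; exact/measurable_EFinP.
- by move=> n w _; rewrite lee_fin.
- by move=> w _ n m nm; rewrite lee_fin ndf.
apply: lime_le; last exact: nearW.
apply: ereal_nondecreasing_is_cvgn => n m nm; apply: ge0_le_integral => //.
- by move=> w _; rewrite lee_fin.
- exact/measurable_EFinP.
- exact/measurable_EFinP.
- by move=> w _; rewrite lee_fin ndf.
Qed.

(** * Limits in probability of sequences bounded in L^2 *)

Section limits_in_probability.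
Context d (T : measurableType d) (R : realType) (P : probability T R).
Implicit Types (Y : nat -> T -> R).

Definition vanishes_in_probability Y := forall e l, 0 < e -> 0 < l ->
  exists n0, forall n, (n0 <= n)%N -> fine (P [set w | e <= `|Y n w|]) <= l.

Variables (Y : nat -> T -> R) (Z : T -> R) (c : R).
Hypotheses (mY : forall n, measurable_fun setT (Y n)).
Hypothesis mZ : measurable_fun setT Z.
Hypothesis YZ : vanishes_in_probability (fun n w => Y n w - Z w).
Hypothesis iY : forall n, L1 P (fun w => Y n w ^+ 2).
Hypothesis Yc : forall n, \int[P]_w (Y n w ^+ 2) <= c.

Let mYZ n (e : R) : measurable [set w | e <= `|Y n w - Z w|].
Proof.
by apply: measurable_le_level; apply: measurableT_comp => //; exact: measurable_funB.
Qed.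

Let trunc_L1 (L : R) : 0 <= L -> L1 P (fun w => Num.min (Z w ^+ 2) L).
Proof.
move=> L0; apply: (@L1_bounded _ _ _ _ _ L) => [|w].
  by apply: measurable_minr => //; exact: measurable_funX.
by rewrite ger0_norm ?le_min ?sqr_ge0// ge_min lexx orbT.
Qed.

(** Outside [A] the distance |Y - Z| is below l and Z^2 <= 2 Y^2 + 2 l^2; on [A], of probability at
    most l, the truncation bounds the integrand by L. The total is 2 c + 2 l^2 + L l, with l <=
    1. *)
Let le_Exp_trunc (L : R) : 0 <= L ->
  \int[P]_w Num.min (Z w ^+ 2) L <= 2 * c.
Proof.
move=> L0; apply: (@le_of_le_addM _ _ _ (2 + L)) => l l0 l1.
have [n /(_ _ (leqnn n)) Pn] := YZ l0 l0.
set A := [set w | l <= `|Y n w - Z w|] in Pn.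
have mA : measurable A by exact: mYZ.
have i1 : L1 P (fun w => 2 * Y n w ^+ 2) by exact: L1Z.
have i2 : L1 P (fun w => L * \1_A w) by apply: L1Z; exact: L1_indic.
have i3 : L1 P (fun w => 2 * l ^+ 2 + L * \1_A w) by apply: L1D => //; exact: L1_cst.
apply: (@le_trans _ _ (\int[P]_w (2 * Y n w ^+ 2 + (2 * l ^+ 2 + L * \1_A w)))).
  apply: le_Exp; [exact: trunc_L1|exact: L1D|move=> w].
  rewrite indicE; have [_|/negP] := boolP (w \in A).
    rewrite ge_min; apply/orP; right.
    by rewrite mulr1 addrA lerDr addr_ge0// mulr_ge0// sqr_ge0.
  rewrite inE /A/= => /negP; rewrite -ltNge => h.
  rewrite mulr0 addr0 ge_min; apply/orP; left.
  move: h; rewrite ltr_norml => /andP[h1 h2].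
  have : (Y n w - Z w) ^+ 2 <= l ^+ 2 by nra.
  by have := sqr_ge0 (Z w - 2 * Y n w); nra.
rewrite ExpD// ExpD//; last exact: L1_cst.
rewrite ExpZ// Exp_cst ExpZ; last exact: L1_indic.
rewrite Exp_indic//.
have := Yc n; have := Pr_ge0 P A; nra.
Qed.

(** Fatou's lemma for convergence in probability, up to the factor 2 of [le_Exp_trunc]. The factor
    does no harm: either the constant is made small later, or only its finiteness matters. *)
Lemma sqr_L1_limit : L1 P (fun w => Z w ^+ 2) /\ \int[P]_w (Z w ^+ 2) <= 2 * c.
Proof.
have le2c : (\int[P]_w (Z w ^+ 2)%:E <= (2 * c)%:E)%E.
  apply: (@monotone_integral_le _ _ _ _ (fun n w => Num.min (Z w ^+ 2) n%:R)).
  - by move=> n; apply: measurable_minr => //; exact: measurable_funX.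
  - by move=> n w; rewrite le_min sqr_ge0/=.
  - move=> w n m nm; rewrite le_min ge_min lexx/=.
    by rewrite ge_min ler_nat nm orbT.
  - move=> w; near=> n; apply/min_idPl.
    by near: n; exact: nbhs_infty_ger.
  - by move=> n; rewrite EFin_Exp ?lee_fin ?le_Exp_trunc//; exact: trunc_L1.
have iZ : L1 P (fun w => Z w ^+ 2).
  apply: ge0_L1; first exact: measurable_funX.
    by move=> w; exact: sqr_ge0.
  by apply: le_lt_trans le2c _; rewrite ltry.
by split => //; rewrite -lee_fin -EFin_Exp.
Unshelve. all: by end_near. Qed.

(** The L^2 bound makes the sequence uniformly integrable, so convergence in probability becomes
    convergence in L^1, which bounded factors preserve. *)
Lemma Exp_mul_limit (xi : T -> R) (M : R) : measurable_fun setT xi ->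
  (forall w, `|xi w| <= M) -> (forall n, \int[P]_w (xi w * Y n w) = 0) ->
  \int[P]_w (xi w * Z w) = 0.
Proof.
move=> mxi xiM Exi0; have [iZ Zc] := sqr_L1_limit.
have sqr_L1 (f : T -> R) : measurable_fun setT f -> L1 P (fun w => f w ^+ 2) ->
    L1 P f.
  move=> mf if2; apply: (@le_L1 _ _ _ _ _ (fun w => 1 + f w ^+ 2)) => //.
    by apply: L1D => //; exact: L1_cst.
  by move=> w; rewrite ler_norml; apply/andP; split; nra.
have iZ1 := sqr_L1 _ mZ iZ; have iY1 n := sqr_L1 _ (mY n) (iY n).
have M0 : 0 <= M by apply: le_trans (xiM point); exact: normr_ge0.
apply/eqP; rewrite -normr_eq0 eq_le normr_ge0 andbT.
(* 6 c = 2 c + 2 (2 c), as the second moment of Z is only known to be at most 2 c. The other 2 comes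
   from the term l and from P(A) / l <= l. *)
apply: (@le_of_le_addM _ _ _ (M * (2 + 6 * c))) => l l0 l1; rewrite add0r.
have [n /(_ _ (leqnn n)) Pn] := YZ l0 (exprn_gt0 2 l0).
set A := [set w | l <= `|Y n w - Z w|] in Pn.
have mA : measurable A by exact: mYZ.
have iD1 : L1 P (fun w => `|Y n w - Z w|).
  by apply: (@integrable_norm); exact: L1B.
pose h w := M * (l + (l * (2 * Y n w ^+ 2 + 2 * Z w ^+ 2) + l^-1 * \1_A w)).
have i1 : L1 P (fun w => 2 * Y n w ^+ 2 + 2 * Z w ^+ 2).
  by apply: L1D; exact: L1Z.
have iA : L1 P (fun w => l^-1 * \1_A w) by apply: L1Z; exact: L1_indic.
have i2 : L1 P (fun w => l * (2 * Y n w ^+ 2 + 2 * Z w ^+ 2) + l^-1 * \1_A w).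
  by apply: L1D => //; exact: L1Z.
have i3 : L1 P (fun w => l + (l * (2 * Y n w ^+ 2 + 2 * Z w ^+ 2) + l^-1 * \1_A w)).
  by apply: L1D => //; exact: L1_cst.
have ih : L1 P h by exact: L1Z.
have ixZ : L1 P (fun w => xi w * Z w) by exact: L1Ml xiM _.
have ixY : L1 P (fun w => xi w * Y n w) by exact: L1Ml xiM _.
have -> : \int[P]_w (xi w * Z w) = \int[P]_w (xi w * Z w - xi w * Y n w).
  by rewrite ExpB// Exi0 subr0.
apply: (le_trans (le_normr_Rintegral _ _)) => //; first exact: L1B.
apply: (@le_trans _ _ (\int[P]_w h w)).
  apply: le_Exp => //; first by apply: integrable_norm => //; exact: L1B.
  move=> w; rewrite -mulrBr normrM; apply: ler_pM => //.
  rewrite distrC indicE; have [_|/negP] := boolP (w \in A).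
    rewrite mulr1; set D := `|_|.
    have D2 : D ^+ 2 <= 2 * Y n w ^+ 2 + 2 * Z w ^+ 2.
      rewrite /D real_normK ?num_real//.
      by have := sqr_ge0 (Y n w + Z w); nra.
    (* Young's inequality, weighted so that the large factor 1 / l meets P(A) <= l^2. *)
    have : D <= l * D ^+ 2 + l^-1.
      have := sqr_ge0 (l * D - 1); have l2 : l * l^-1 = 1 by rewrite mulfV// gt_eqF.
      have := normr_ge0 (Y n w - Z w); rewrite -/D => D0 h0.
      rewrite -(ler_pM2l l0) mulrDr l2; nra.
    have : l * D ^+ 2 <= l * (2 * Y n w ^+ 2 + 2 * Z w ^+ 2) by rewrite ler_pM2l.
    lra.
  rewrite inE /A/= => /negP; rewrite -ltNge => h0.
  rewrite mulr0 addr0 (le_trans (ltW h0))// lerDl mulr_ge0 ?(ltW l0)//.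
  by rewrite addr_ge0// mulr_ge0// sqr_ge0.
rewrite ExpZ// ExpD//; last exact: L1_cst.
rewrite Exp_cst ExpD//; last exact: L1Z.
rewrite ExpZ// ExpD; [|exact: L1Z|exact: L1Z].
rewrite !ExpZ//; last exact: L1_indic.
rewrite Exp_indic// -mulrA ler_wpM2l//.
have P1 : l^-1 * fine (P A) <= l by rewrite ler_pdivrMl.
have := Yc n => Ycn.
have : l * (2 * \int[P]_w (Y n w ^+ 2) + 2 * \int[P]_w (Z w ^+ 2)) <= l * (6 * c).
  by rewrite ler_pM2l//; lra.
lra.
Qed.

End limits_in_probability.

(** * Centring and tail bound for discrete integrals *)

Section discrete_integral_bounds.
Context d (T : measurableType d) (R : realType) (P : probability T R).
Variables (F : R -> set (set T)) (B : R -> T -> R).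
Hypotheses (hF : filtration F) (hB : brownian_motion P F B).
Variables (u : nat -> R) (g : nat -> T -> R) (n : nat) (M : R).
Hypotheses (u0 : 0 <= u 0%N) (u_nd : forall i, u i <= u i.+1).
Hypothesis mg : forall i, (i < n)%N -> measurable_wrt (F (u i)) (g i).
Hypothesis gM : forall i w, (i < n)%N -> `|g i w| <= M.

Let u_ge0 i : 0 <= u i.
Proof. by elim: i => // i /le_trans; apply. Qed.

Let u_homo i j : (i <= j)%N -> u i <= u j.
Proof.
by apply: (homo_leq (r := fun x y : R => x <= y)) => // x y z; exact: le_trans.
Qed.

(** Being known at the first grid time, [xi] can be absorbed into every coefficient. *)
Lemma Exp_mul_discrete_integral (xi : T -> R) (K : R) :
  measurable_wrt (F (u 0)) xi -> (forall w, `|xi w| <= K) ->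
  \int[P]_w (xi w * discrete_integral B u g n w) = 0.
Proof.
move=> mxi xiK.
have mxg i : (i < n)%N -> measurable_wrt (F (u i)) (fun w => xi w * g i w).
  move=> ni; apply: measurable_funM; last exact: mg.
  by apply: (filtration_measurableW hF u0) mxi; exact: u_homo.
have ixg i : (i < n)%N -> L1 P (fun w => xi w * g i w).
  move=> ni; apply: (@L1_bounded _ _ _ _ _ (K * M)) => [|w].
    exact: (filtration_measurable hF (u_ge0 i) (mxg _ ni)).
  by rewrite normrM; apply: ler_pM => //; exact: gM.
transitivity (\int[P]_w \sum_(i < n) (xi w * g i w * (B (u i.+1) w - B (u i) w))).
  apply: eq_Rintegral => w _; rewrite /discrete_integral mulr_sumr.
  by apply: eq_bigr => i _; rewrite mulrA.
have iD i : (i < n)%N ->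
    L1 P (fun w => xi w * g i w * (B (u i.+1) w - B (u i) w)).
  by move=> ni; exact: (L1M_increment hF hB (u_ge0 i) (u_nd i) (mxg _ ni) (ixg _ ni)).
rewrite (Exp_sum (f := fun i w => xi w * g i w * (B (u i.+1) w - B (u i) w)))//.
rewrite big1// => i _.
have ni := ltn_ord i.
exact: (ExpM_increment hF hB (u_ge0 i) (u_nd i) (mxg _ ni) (ixg _ ni)).
Qed.

Let Q k w := \sum_(i < k) g i w ^+ 2 * (u i.+1 - u i).

Let Q_measurable_wrt i : (i < n)%N -> measurable_wrt (F (u i)) (Q i.+1).
Proof.
move=> ni; apply: (@measurable_sum _ (g_sigma_algebraType (F (u i))) _ _ _ _
  (fun (j : 'I_i.+1) w => g j w ^+ 2 * (u j.+1 - u j))) => j.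
apply: measurable_funM; last exact: measurable_cst.
apply: measurable_funX; apply: (filtration_measurableW hF (u_ge0 j)).
  by apply: u_homo; rewrite -ltnS.
by apply: mg; apply: leq_ltn_trans ni; rewrite -ltnS.
Qed.

Let Q_homo i j w : (i <= j)%N -> Q i w <= Q j w.
Proof.
apply: (homo_leq (r := fun x y : R => x <= y) (f := Q ^~ w)) => //.
  by move=> x y z; exact: le_trans.
by move=> k; rewrite /Q big_ord_recr/= lerDl mulr_ge0 ?sqr_ge0// subr_ge0.
Qed.

(* The integrand is set to zero from the first time its quadratic sum exceeds
   [dl]; this stopping rule is predictable because the sum up to the interval
   [u i, u i.+1] is known at time [u i]. *)
Lemma discrete_integral_tail (dl e : R) : 0 < dl -> 0 < e ->
  fine (P [set w | e <= `|discrete_integral B u g n w|]) <=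
  fine (P [set w | dl <= \sum_(i < n) g i w ^+ 2 * (u i.+1 - u i)])
  + dl / e ^+ 2.
Proof.
move=> dl0 e0.
pose g' i w := g i w * \1_[set v | Q i.+1 v <= dl] w.
have g'E i w : g' i w = if Q i.+1 w <= dl then g i w else 0.
  rewrite /g' indicE; case: ifPn => h; first by rewrite mem_set ?mulr1.
  by rewrite memNset ?mulr0//=; exact/negP.
have mg' i : (i < n)%N -> measurable_wrt (F (u i)) (g' i).
  move=> ni; apply: measurable_funM; first exact: mg.
  apply: measurable_indic.
  exact: (@measurable_ge_level _ (g_sigma_algebraType (F (u i)))
    _ _ _ (Q_measurable_wrt ni)).
have g'M i w : (i < n)%N -> `|g' i w| <= M.
  move=> ni; rewrite g'E; case: ifP => _; first exact: gM.
  by rewrite normr0 (le_trans _ (gM w ni)).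
(* The bound by [Q k w] serves the induction: when a coefficient is kept, the new sum is compared
   with [Q k.+1 w], which is then at most [dl]. *)
have Q'dl w k : \sum_(i < k) g' i w ^+ 2 * (u i.+1 - u i) <= Num.min (Q k w) dl.
  elim: k => [|k IH].
    by rewrite big_ord0 le_min (ltW dl0) /Q big_ord0 lexx.
  rewrite big_ord_recr/= g'E; case: ifPn => [h|h].
    have -> : Num.min (Q k.+1 w) dl = Q k.+1 w by apply/min_idPl.
    rewrite /Q big_ord_recr/= lerD2r (le_trans IH)// ge_min.
    by rewrite /Q lexx.
  rewrite expr0n/= mul0r addr0 (le_trans IH)// le_min !ge_min lexx orbT andbT.
  by rewrite Q_homo.
have [iS ES] := discrete_integral_isometry hF hB u0 u_nd mg' g'M (leqnn n).
have mS : measurable_fun setT (discrete_integral B u g n).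
  apply: (filtration_measurable hF (u_ge0 n)).
  exact: (discrete_integral_measurable_wrt hF hB u0 u_nd mg).
have mS' : measurable_fun setT (discrete_integral B u g' n).
  apply: (filtration_measurable hF (u_ge0 n)).
  exact: (discrete_integral_measurable_wrt hF hB u0 u_nd mg').
have mQ : measurable_fun setT (Q n).
  apply: measurable_sum => j; apply: measurable_funM; last exact: measurable_cst.
  by apply: measurable_funX; apply: (filtration_measurable hF (u_ge0 j)); exact: mg.
have m1 : measurable [set w | dl <= Q n w] by exact: measurable_le_level.
have m2 : measurable [set w | e ^+ 2 <= discrete_integral B u g' n w ^+ 2].
  by apply: measurable_le_level; exact: measurable_funX.
apply: (@le_trans _ _ (fine (P ([set w | dl <= Q n w] `|`
    [set w | e ^+ 2 <= discrete_integral B u g' n w ^+ 2])))).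
  apply: le_Pr.
  - by apply: measurable_le_level; exact: measurableT_comp.
  - exact: measurableU.
  - move=> w /= eS; have [h|h] := leP dl (Q n w); [by left|right].
    (* While the full quadratic sum is below [dl], the stopping never acts. *)
    have -> : discrete_integral B u g' n w = discrete_integral B u g n w.
      apply: eq_bigr => i _; rewrite g'E ifT//.
      by rewrite (le_trans _ (ltW h))// Q_homo.
    by rewrite -[leRHS]real_normK ?num_real// lerXn2r// nnegrE// ltW.
apply: (le_trans (PrU P m1 m2)); rewrite lerD2l.
apply: (le_trans (markov_Exp (exprn_gt0 2 e0) iS _)) => [w|]; first exact: sqr_ge0.
rewrite ler_pM2r ?invr_gt0 ?exprn_gt0// ES.
apply: (@le_trans _ _ (\int[P]_w dl)); last by rewrite Exp_cst.
have ig2 i : (i < n)%N -> L1 P (fun w => g' i w ^+ 2).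
  move=> ni; apply: (@L1_bounded _ _ _ _ _ (M ^+ 2)) => [|w].
    by apply: measurable_funX; exact: (filtration_measurable hF (u_ge0 i) (mg' _ ni)).
  rewrite normrX lerXn2r// ?nnegrE// ?g'M//.
  exact: le_trans (g'M i w ni).
have ig' i : (i < n)%N -> L1 P (fun w => g' i w ^+ 2 * (u i.+1 - u i)).
  move=> ni; rewrite (_ : (fun _ => _) = fun w => (u i.+1 - u i) * g' i w ^+ 2).
    by apply: L1Z; exact: ig2.
  by apply/funext => w; rewrite mulrC.
rewrite (_ : \sum_(i < n) _ =
    \int[P]_w \sum_(i < n) g' i w ^+ 2 * (u i.+1 - u i)).
  apply: le_Exp; [exact: (L1_sum ig')|exact: L1_cst|move=> w].
  by rewrite (le_trans (Q'dl w n))// ge_min lexx orbT.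
rewrite (Exp_sum ig'); apply: eq_bigr => i _.
by rewrite RintegralZr//; exact: ig2.
Qed.

End discrete_integral_bounds.

(** * Simple processes on a grid *)

Lemma indic_oc_itv (R : realType) (a b x : R) :
  \1_(`]a, b]) x = ((a < x) && (x <= b))%:R :> R.
Proof.
rewrite indicE; congr ((nat_of_bool _)%:R); apply/idP/idP => [/set_mem/=|h].
  by rewrite in_itv.
by apply/mem_set; rewrite /= in_itv.
Qed.

Section grid.
Context (R : realType).
Variable u : nat -> R.
Hypothesis u_nd : forall i, u i <= u i.+1.

Lemma grid_homo i j : (i <= j)%N -> u i <= u j.
Proof.
by apply: (homo_leq (r := fun x y : R => x <= y)) => // x y z; exact: le_trans.
Qed.

Lemma grid_adjacent a j : range u a -> a <= u j \/ u j.+1 <= a.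
Proof.
move=> [i _ <-]; have [ij|ji] := leqP i j; first by left; exact: grid_homo.
by right; exact: grid_homo.
Qed.

Lemma grid_lt a j s : range u a -> u j < s -> s <= u j.+1 ->
  (a < s) = (a < u j.+1).
Proof.
move=> ua us su; apply/idP/idP => [h|au]; first exact: lt_le_trans su.
by have [/le_lt_trans->//|] := grid_adjacent j ua; rewrite leNgt au.
Qed.

(** Freezing [phi] outside [a, b] turns the sum over the cells of ]a, b] into a full telescoping
    sum. *)
Lemma grid_telescope (phi : R -> R) a b n : a <= b -> range u a -> range u b ->
  b <= u n -> \sum_(j < n) \1_(`]a, b]) (u j.+1) * (phi (u j.+1) - phi (u j)) =
  phi b - phi a.
Proof.
move=> ab ua ub bn.
pose psi x := phi (Num.min (Num.max x a) b).
transitivity (\sum_(j < n) (psi (u j.+1) - psi (u j))).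
  apply: eq_bigr => j _.
  have uu := u_nd j; rewrite /psi indic_oc_itv.
  have [h|h] := grid_adjacent j ua; last first.
    rewrite ltNge h/= mul0r !(max_idPr _) ?subrr//.
    exact: le_trans h.
  have h' : a <= u j.+1 by exact: le_trans uu.
  rewrite !(max_idPl _)//.
  have [k|k] := grid_adjacent j ub.
    have k' : b <= u j.+1 by exact: le_trans uu.
    rewrite !(min_idPr _)// subrr.
    have [k2|] := leP (u j.+1) b; last by rewrite andbF mul0r.
    have -> : u j.+1 = u j by apply/eqP; rewrite eq_le uu (le_trans k2).
    by rewrite subrr mulr0.
  rewrite k andbT !(min_idPl _)//; last exact: le_trans k.
  have [_|] := ltP a (u j.+1); first by rewrite mul1r.
  move=> k2; have -> : u j.+1 = u j by apply/eqP; rewrite eq_le uu (le_trans k2).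
  by rewrite subrr mulr0.
rewrite -(big_mkord xpredT (fun j => psi (u j.+1) - psi (u j))).
rewrite (telescope_sumr (psi \o u))//= /psi.
have u0a : u 0%N <= a by case: ua => i _ <-; exact: grid_homo.
have an : a <= u n by exact: le_trans bn.
rewrite (max_idPl an) (min_idPr bn) (max_idPr u0a).
by rewrite (min_idPl ab).
Qed.

Lemma integral_grid (f : R -> R) n : measurable_fun setT f ->
  (forall s, 0 <= f s) ->
  (forall j s, (j < n)%N -> u j < s -> s <= u j.+1 -> f s = f (u j.+1)) ->
  (\int[lebesgue_measure]_(s in `]u 0%N, u n]) (f s)%:E =
   (\sum_(j < n) f (u j.+1) * (u j.+1 - u j))%:E)%E.
Proof.
move=> mf f0 fu; elim: n fu => [|n IH] fu.
  by rewrite set_itvoc0 integral_set0 big_ord0.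
rewrite (@itv_bndbnd_setU _ _ _ (BRight (u n))) ?bnd_simp ?grid_homo//.
rewrite ge0_integral_setU//=; last 3 first.
- exact/measurable_funTS/measurable_EFinP.
- by move=> s _; rewrite lee_fin.
- apply/disj_setPS => s [/=]; rewrite !in_itv/= => /andP[_ h] /andP[h' _].
  by have := lt_le_trans h' h; rewrite ltxx.
rewrite IH; last by move=> j s jn; apply: fu; exact: ltnW.
rewrite big_ord_recr/= EFinD; congr (_ + _)%E.
transitivity (\int[lebesgue_measure]_(s in `]u n, u n.+1]) (f (u n.+1))%:E)%E.
  apply: eq_integral => s /set_mem/=; rewrite in_itv/= => /andP[h1 h2].
  by rewrite (fu n s).
rewrite integral_cst//= lebesgue_measure_itv/= lte_fin.
have [_|h] := ltP (u n) (u n.+1); first by rewrite EFinM.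
have -> : u n.+1 = u n by apply/eqP; rewrite eq_le h u_nd.
by rewrite mule0 subrr mulr0.
Qed.

End grid.

(** * Simple processes refined to a grid *)

Section simple_process_on_grid.
Context d (T : measurableType d) (R : realType).
Variables (F : R -> set (set T)) (B : R -> T -> R).
Hypothesis hF : filtration F.
Variables (h : @simple_process d T R) (u : nat -> R) (n : nat).
Hypotheses (hh : simple_process_wf F h) (u_nd : forall i, u i <= u i.+1).
Local Notation tau := (sp_time h).
Hypothesis tau_u : forall i, (i <= sp_size h)%N ->
  range u (Num.min (tau i) (u n)).

Let tau_lt i j s : (i <= sp_size h)%N -> (j < n)%N -> u j < s -> s <= u j.+1 ->
  (tau i < s) = (tau i < u j.+1).
Proof.
move=> ih jn us su; have := grid_lt u_nd (tau_u ih) us su.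
have un : u j.+1 <= u n by exact: grid_homo.
by rewrite !gt_min (le_gtF un) (le_gtF (le_trans su un)) !orbF.
Qed.

Let indic_grid i j s : (i < sp_size h)%N -> (j < n)%N -> u j < s -> s <= u j.+1 ->
  \1_(`]tau i, tau i.+1]) s = \1_(`]tau i, tau i.+1]) (u j.+1) :> R.
Proof.
move=> ih jn us su; rewrite !indic_oc_itv.
by rewrite (tau_lt (ltnW ih) jn us su) !leNgt (tau_lt ih jn us su).
Qed.

Lemma sp_eval_grid j s w : (j < n)%N -> u j < s -> s <= u j.+1 ->
  sp_eval h s w = sp_eval h (u j.+1) w.
Proof.
by move=> jn us su; apply: eq_bigr => i _; rewrite (indic_grid (ltn_ord i) jn us su).
Qed.

(** Refining the partition does not change the integral: the increment of [B] over an interval of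
    [h] is the telescoping sum of its increments over the cells inside. *)
Lemma sp_integral_grid w : sp_integral B h (u n) w =
  \sum_(j < n) sp_eval h (u j.+1) w * (B (u j.+1) w - B (u j) w).
Proof.
have [tau0 tau_nd _] := hh.
under [RHS]eq_bigr do rewrite mulr_suml.
rewrite exchange_big/=; apply: eq_bigr => i _.
rewrite -(@grid_telescope _ _ u_nd (B ^~ w) _ _ n); last 4 first.
- by rewrite le_min2.
- exact/tau_u/ltnW.
- exact: tau_u.
- by rewrite ge_min lexx orbT.
rewrite mulr_sumr; apply: eq_bigr => j _; rewrite mulrA; congr (_ * _ * _).
have un : u j.+1 <= u n by apply: grid_homo.
by rewrite !indic_oc_itv gt_min (le_gtF un) orbF le_min un andbT.
Qed.

(** An interval of [h] that starts before [u j.+1] starts at or before [u j], because its start is a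
    grid point; its coefficient is therefore known at [u j]. *)
Lemma sp_eval_measurable_wrt j : (j < n)%N ->
  measurable_wrt (F (u j)) (sp_eval h (u j.+1)).
Proof.
move=> jn; have [tau0 tau_nd coefP] := hh.
have tau_ge0 i : 0 <= tau i by elim: i => // i /le_trans; apply.
apply: (@measurable_sum _ (g_sigma_algebraType (F (u j))) _ _ _ _
  (fun (i : 'I_(sp_size h)) w =>
     sp_coef h i w * \1_(`]tau i, tau i.+1]) (u j.+1))) => i.
have [lt|ge] := ltP (tau i) (u j.+1); last first.
  rewrite (_ : (fun _ => _) = cst 0); first exact: measurable_cst.
  by apply/funext => w; rewrite indic_oc_itv ltNge ge mulr0.
apply: measurable_funM; last exact: measurable_cst.
have un : u j.+1 <= u n by apply: grid_homo.
have tn : tau i <= u n by exact: le_trans (ltW lt) un.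
have tj : tau i <= u j.
  have := tau_u (ltnW (ltn_ord i)); rewrite (min_idPl tn) => /(grid_adjacent u_nd j).
  by case=> //; rewrite leNgt lt.
apply: (filtration_measurableW hF _ tj) => //.
by have [] := coefP i (ltn_ord i).
Qed.

End simple_process_on_grid.

Lemma sp_eval_bounded d (T : measurableType d) (R : realType)
    (F : R -> set (set T)) (h : @simple_process d T R) :
  simple_process_wf F h -> exists M, forall s w, `|sp_eval h s w| <= M.
Proof.
move=> [_ _ hc]; rewrite /sp_eval.
elim: (sp_size h) hc => [|n IH] hc.
  by exists 0 => s w; rewrite big_ord0 normr0.
have [M hM] := IH (fun i ni => hc i (ltnW ni)).
have [_ [M' hM']] := hc n (ltnSn n).
exists (M + M') => s w; rewrite big_ord_recr/= (le_trans (ler_normD _ _))//.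
rewrite lerD// normrM indic_oc_itv.
case: (_ && _); rewrite ?normr1 ?mulr1// normr0 mulr0.
exact: le_trans (hM' w).
Qed.

Lemma sp_eval_measurable d (T : measurableType d) (R : realType)
  (h : @simple_process d T R) w : measurable_fun setT (sp_eval h ^~ w).
Proof.
by apply: measurable_sum => i; apply: measurable_funM.
Qed.

(** * Path properties of continuous processes *)

Section continuous_paths.
Context (R : realType).
Implicit Types (f : R -> R) (t x y : R).

(** Projection onto [0, t]. Composing with it turns a path that is only constrained at nonnegative
    times into a continuous function on the whole line. *)
Definition clamp t x := Num.max 0 (Num.min t x).

Lemma clamp_itv t x : 0 <= t -> 0 <= clamp t x <= t.
Proof. by move=> t0; rewrite /clamp le_max lexx/= ge_max t0 ge_min lexx. Qed.

Lemma clamp_id t x : 0 <= x -> x <= t -> clamp t x = x.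
Proof. by move=> x0 xt; rewrite /clamp (min_idPr xt) (max_idPr x0). Qed.

Lemma clamp_dist t x y : `|clamp t x - clamp t y| <= `|x - y|.
Proof.
rewrite /clamp ler_norml.
have /andP[h1 h2] : - `|x - y| <= x - y <= `|x - y|.
  by rewrite -ler_norml.
have h3 := normr_ge0 (x - y).
have [] := leP t x; have [] := leP t y; have [] := leP 0 x; have [] := leP 0 y;
have [] := leP 0 t; lra.
Qed.

Lemma continuous_clamp f t : 0 <= t ->
  {within `[0, +oo[, continuous f} -> continuous (f \o clamp t).
Proof.
move=> t0 /subspace_continuousP cf x; apply/cvgrPdist_le => e e0.
have /andP[c0 _] := clamp_itv x t0.
have /cvgrPdist_le/(_ _ e0) : f @ within `[0, +oo[ (nbhs (clamp t x)) --> f (clamp t x).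
  by apply: cf; rewrite /= in_itv/= c0.
move=> /nbhs_ballP[r /= r0 h].
apply/nbhs_ballP; exists r => //= y xy; apply: h.
  by rewrite /ball/= (le_lt_trans (clamp_dist t x y)).
by rewrite /= in_itv/=; have /andP[-> _] := clamp_itv y t0.
Qed.

(** Heine's theorem from compactness in its covering form. Only x is confined to the segment; y may
    lie outside. *)
Lemma uniform_continuity_segment f (a b e : R) : continuous f -> 0 < e ->
  exists n, forall x y, a <= x -> x <= b -> `|x - y| <= n.+1%:R^-1 ->
    `|f x - f y| <= e.
Proof.
move=> cf e0.
have e20 : 0 < e / 2 by rewrite divr_gt0.
have /compact_near_coveringP := @segment_compact R a b.
move=> /(_ nat \oo (fun n x =>
  forall y, `|x - y| <= n.+1%:R^-1 -> `|f x - f y| <= e) _).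
case=> [x _|n _ hn]; last first.
  exists n => x y ax xb; apply: hn => //=.
  by rewrite in_itv/= ax xb.
have /cvgrPdist_le/(_ _ e20)/nbhs_ballP[r /= r0 hr] := cf x.
have r20 : 0 < r / 2 by rewrite divr_gt0.
near=> z n => y zy.
have xz : `|x - z| < r / 2.
  by near: z; apply: nbhsx_ballx.
have nr : n.+1%:R^-1 < r / 2.
  by near: n; exact: near_infty_natSinv_lt (PosNum r20).
have xy : `|x - y| < r.
  rewrite (_ : x - y = (x - z) + (z - y)); last by ring.
  rewrite (le_lt_trans (ler_normD _ _))// [ltRHS]splitr ltrD//.
  exact: le_lt_trans nr.
have h1 := hr _ xy.
have h2 : `|f x - f z| <= e / 2.
  by apply: hr; apply: (lt_le_trans xz); rewrite ler_pdivrMr// ler_peMr ?(ltW r0)// ler1n.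
rewrite (_ : f z - f y = - (f x - f z) + (f x - f y)); last by ring.
by rewrite (le_trans (ler_normD _ _))// normrN [leRHS]splitr lerD.
Unshelve. all: by end_near. Qed.

(** A dense sequence of [0, t]: the rationals, decoded from integers (with default 0 where nothing
    is encoded), then projected. *)
Definition rational_time t n : R :=
  clamp t (ratr (odflt 0%R (unpickle n : option rat))).

Lemma rational_time_dense f t x (e : R) :
  {within `[0, +oo[, continuous f} -> 0 <= x -> x <= t -> 0 < e ->
  exists n, `|x - rational_time t n| <= e /\ `|f x - f (rational_time t n)| <= e.
Proof.
move=> cf x0 xt e0; have t0 := le_trans x0 xt.
have cc : continuous (f \o clamp t) by exact: continuous_clamp.
have /cvgrPdist_le/(_ _ e0)/nbhs_ballP[r /= r0 hr] := cc x.
(* The rational is taken to the right of x and may exceed t; clamping brings it back without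
   increasing its distance to x. *)
have xr : x < x + Num.min r e by rewrite ltrDl lt_min r0.
have [q] := rat_in_itvoo xr; rewrite in_itv/= => /andP[q1 q2].
have : `|x - ratr q| < Num.min r e.
  by rewrite ltr0_norm ?subr_lt0// opprB ltrBlDl.
rewrite lt_min => /andP[xqr xqe].
exists (pickle q); rewrite /rational_time pickleK/= -{1}(clamp_id x0 xt).
split; first exact: (le_trans (clamp_dist _ _ _)) (ltW xqe).
by have := hr _ xqr; rewrite /= (clamp_id x0 xt).
Qed.

End continuous_paths.

(** * Measurable events described by whole paths *)

Section process_events.
Context d (T : measurableType d) (R : realType) (P : probability T R).
Variables (F : R -> set (set T)) (Y : R -> T -> R).
Hypotheses (hF : filtration F) (aY : adapted F Y) (cY : continuous_paths Y).

(* Rational times reduce uncountable conditions on a path to countable ones,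
   which makes the corresponding events measurable. *)
Lemma path_sup_le (t K : R) w : 0 <= t ->
  (forall n, `|Y (rational_time t n) w| <= K) ->
  forall s, 0 <= s -> s <= t -> `|Y s w| <= K.
Proof.
move=> t0 h s s0 st; apply/ler_addgt0Pr => e e0.
have [n [_ hn]] := rational_time_dense (@cY w) s0 st e0.
rewrite (_ : Y s w = Y (rational_time t n) w + (Y s w - Y (rational_time t n) w));
  last by ring.
by rewrite (le_trans (ler_normD _ _))// lerD.
Qed.

Lemma path_sup_measurable (t K : R) : 0 <= t ->
  (F t).-sigma.-measurable
    [set w | forall s, 0 <= s -> s <= t -> `|Y s w| <= K].
Proof.
move=> t0.
rewrite (_ : [set _ | _] =
    \bigcap_n [set w | `|Y (rational_time t n) w| <= K]); last first.
  apply/seteqP; split => [w h n _ /=|w h /=].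
    by have /andP[? ?] := clamp_itv (ratr (odflt 0%R (unpickle n : option rat))) t0; exact: h.
  by apply: path_sup_le => // n; exact: h.
apply: bigcapT_measurable => n.
apply: (@measurable_ge_level _ (g_sigma_algebraType (F t)) _
  (fun w => `|Y (rational_time t n) w|) K).
apply: measurableT_comp => //.
have /andP[h0 ht] := clamp_itv (ratr (odflt 0%R (unpickle n : option rat))) t0.
by apply: (filtration_measurableW hF h0 ht); exact: aY.
Qed.

(** Every path is uniformly continuous on [0, t], so the events [V n], on which scale 1 / (n + 1)
    works at rational times, increase to the whole space; continuity of [P] along them gives a
    single scale for most paths. *)
Lemma path_modulus (t e eta : R) : 0 <= t -> 0 < e -> 0 < eta ->
  exists n, exists W : set T, [/\ measurable W, fine (P (~` W)) <= eta &
    forall w, W w -> forall s s', 0 <= s -> s <= t -> 0 <= s' -> s' <= t ->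
      `|s - s'| <= n.+1%:R^-1 -> `|Y s w - Y s' w| <= e].
Proof.
move=> t0 e0 eta0.
pose q := rational_time t.
have q_itv k : 0 <= q k <= t by exact: clamp_itv.
pose V n := \bigcap_k \bigcap_l
  [set w | `|q k - q l| <= n.+1%:R^-1 -> `|Y (q k) w - Y (q l) w| <= e / 2].
have mY k : measurable_fun setT (Y (q k)).
  by have /andP[? _] := q_itv k; exact: (adapted_measurable hF).
have mV n : measurable (V n).
  apply: bigcapT_measurable => k; apply: bigcapT_measurable => l.
  have [h|h] := boolP (`|q k - q l| <= n.+1%:R^-1).
    rewrite (_ : [set _ | _] = [set w | `|Y (q k) w - Y (q l) w| <= e / 2]).
      apply: measurable_ge_level; apply: measurableT_comp => //.
      exact: measurable_funB.
    by apply/seteqP; split => w /=; [apply|].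
  by rewrite (_ : [set _ | _] = setT)//; apply/seteqP; split.
have ndV : nondecreasing_seq V.
  move=> n m nm; apply/subsetPset => w Vn k _ l _ /= kl; apply: Vn => //.
  by rewrite (le_trans kl)// lef_pV2 ?posrE// ler_nat ltnS.
have e20 : 0 < e / 2 by rewrite divr_gt0.
have UV : \bigcup_n V n = setT.
  apply/seteqP; split => // w _.
  have [n hn] := uniform_continuity_segment 0 t (continuous_clamp t0 (@cY w)) e20.
  exists n => // k _ l _ /= kl.
  have /andP[k0 kt] := q_itv k; have /andP[l0 lt] := q_itv l.
  by have := hn _ _ k0 kt kl; rewrite /= !clamp_id.
have : P (V n) @[n --> \oo] --> 1%E.
  rewrite -(@probability_setT _ _ _ P) -UV.
  by apply: nondecreasing_cvg_mu => //; rewrite UV.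
move=> /fine_cvgP[_ /cvgrPdist_le/(_ _ eta0)[n _ /(_ n (leqnn n))/= hn]].
(* The next scale is strictly smaller, and the slack 1 / (n + 1) - 1 / (n + 2) pays for replacing
   real times by rational ones. *)
exists n.+1, (V n); split => //.
  rewrite probability_setC// fineB ?fin_num_measure//=.
  exact: le_trans (ler_norm _) hn.
move=> w Vw s s' s0 st s'0 s't ss'; apply/ler_addgt0Pr => r r0.
have nn : n.+2%:R^-1 < n.+1%:R^-1 :> R.
  by rewrite ltf_pV2 ?posrE// ltr_nat.
have [eps [eps0 er en]] : exists eps : R, [/\ 0 < eps, eps <= r / 2 &
    2 * eps <= n.+1%:R^-1 - n.+2%:R^-1].
  exists (Num.min (r / 2) ((n.+1%:R^-1 - n.+2%:R^-1) / 2)); split.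
  - by rewrite lt_min !divr_gt0//= subr_gt0.
  - by rewrite ge_min lexx.
  - by rewrite mulrC -ler_pdivlMr// ge_min lexx orbT.
have [k [k1 k2]] := rational_time_dense (@cY w) s0 st eps0; rewrite -/(q k) in k1 k2.
have [l [l1 l2]] := rational_time_dense (@cY w) s'0 s't eps0; rewrite -/(q l) in l1 l2.
have : `|Y (q k) w - Y (q l) w| <= e / 2.
  apply: (Vw k I l I) => /=.
  rewrite (_ : q k - q l = - (s - q k) + (s - s') + (s' - q l)); last by ring.
  rewrite (le_trans (ler_normD _ _))// (le_trans (lerD (ler_normD _ _) (lexx _)))//.
  by rewrite normrN; move: (n.+2%:R^-1) (n.+1%:R^-1) en ss' => a b en ss'; lra.
move=> h; rewrite (_ : Y s w - Y s' w = (Y s w - Y (q k) w) +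
  (Y (q k) w - Y (q l) w) - (Y s' w - Y (q l) w)); last by ring.
rewrite (le_trans (ler_normB _ _))// (le_trans (lerD (ler_normD _ _) (lexx _)))//.
lra.
Qed.

End process_events.

(** * Riemann sums converge to the Ito integral *)

Section merged_grid.
Context (R : realType).

(** The points are sorted together with 0, and the default value of [nth] continues the list by t
    forever. Repetitions are kept. *)
Lemma merged_grid (l : seq R) (t : R) : 0 <= t ->
  (forall x, x \in l -> 0 <= x <= t) ->
  exists (u : nat -> R) n, [/\ u 0%N = 0, u n = t, forall i, u i <= u i.+1 &
    forall x, x \in l -> range u x].
Proof.
move=> t0 lt; pose s := sort <=%R (0 :: l).
have s_itv x : x \in s -> 0 <= x <= t.
  rewrite mem_sort inE => /predU1P[->|]; last exact: lt.
  by rewrite lexx.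
have ss : sorted <=%R s by apply: sort_sorted; exact: le_total.
exists (nth t s), (size s); split.
- have : 0 \in s by rewrite mem_sort inE eqxx.
  move: s_itv ss; case: s => [|x s] //= s_itv ss.
  rewrite inE => /predU1P[//|s0]; apply/eqP; rewrite eq_le.
  have /andP[-> _] := s_itv x (mem_head _ _); rewrite andbT.
  by have /allP := order_path_min le_trans ss; apply.
- by rewrite nth_default.
- move=> i; have [h|h] := leqP (size s) i.+1; last first.
    by have := sorted_leq_nth le_trans lexx t ss i i.+1; rewrite !inE; apply => //; exact: ltnW.
  rewrite [X in _ <= X]nth_default//; have [h'|h'] := leqP (size s) i.
    by rewrite nth_default.
  by have /andP[] := s_itv _ (mem_nth t h').
- move=> x xl; exists (index x s) => //; apply: nth_index.
  by rewrite mem_sort inE xl orbT.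
Qed.

Variable u : nat -> R.
Hypothesis u_nd : forall i, u i <= u i.+1.

Lemma grid_cell n s : u 0%N < s -> s <= u n ->
  exists2 j, (j < n)%N & u j < s /\ s <= u j.+1.
Proof.
move=> u0s; elim: n => [|n IH] sn.
  by have := lt_le_trans u0s sn; rewrite ltxx.
have [h|h] := leP s (u n); last by exists n.
by have [j jn ?] := IH h; exists j => //; exact: ltnW.
Qed.

Lemma sum_indic_cell (c : nat -> R) n j s : (j < n)%N -> u j < s -> s <= u j.+1 ->
  \sum_(i < n) c i * \1_(`]u i, u i.+1]) s = c j.
Proof.
move=> jn us su; rewrite (bigD1 (Ordinal jn))//= indic_oc_itv us su mulr1.
rewrite big1 ?addr0// => i ij; rewrite indic_oc_itv.
have : (i < j)%N || (j < i)%N.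
  by rewrite -neq_ltn; apply: contra ij => /eqP ij; apply/eqP/val_inj.
case/orP => h.
  by rewrite [s <= _]leNgt (le_lt_trans (grid_homo u_nd h) us) andbF mulr0.
by rewrite [_ < s]ltNge (le_trans su (grid_homo u_nd h)) mulr0.
Qed.

End merged_grid.

(** * Comparison of two simple processes *)

Section compare_simple_processes.
Context d (T : measurableType d) (R : realType) (P : probability T R).
Variables (F : R -> set (set T)) (B : R -> T -> R).
Hypotheses (hF : filtration F) (hB : brownian_motion P F B).
Variables (h h' : @simple_process d T R) (t : R).
Hypotheses (hh : simple_process_wf F h) (hh' : simple_process_wf F h').
Hypothesis t0 : 0 <= t.

Let Q w := (\int[lebesgue_measure]_(s in `]0%R, t])
  ((sp_eval h s w - sp_eval h' s w) ^+ 2)%:E)%E.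

(** On a grid containing the times of both processes the difference of the integrals is one discrete
    integral with quadratic sum [Q], to which [discrete_integral_tail] applies. *)
Lemma sp_integral_tail (dl e : R) : 0 < dl -> 0 < e ->
  measurable [set w | (dl%:E <= Q w)%E] /\
  fine (P [set w | e <= `|sp_integral B h t w - sp_integral B h' t w|]) <=
  fine (P [set w | (dl%:E <= Q w)%E]) + dl / e ^+ 2.
Proof.
move=> dl0 e0.
have itv (k : @simple_process d T R) i : simple_process_wf F k ->
    0 <= Num.min (sp_time k i) t <= t.
  move=> [k0 kS _]; rewrite le_min t0 andbT ge_min lexx orbT andbT.
  by elim: i => // i /le_trans; apply.
(* The [sp_size] intervals of a process involve the times of index 0 to [sp_size], hence lists of
   length [(sp_size _).+1]. *)
have [|u [n [u0 un u_nd ul]]] := @merged_grid _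
  ([seq Num.min (sp_time h i) t | i <- iota 0 (sp_size h).+1] ++
   [seq Num.min (sp_time h' i) t | i <- iota 0 (sp_size h').+1]) _ t0.
  by move=> x; rewrite mem_cat => /orP[] /mapP[i _ ->]; exact: itv.
have uh i : (i <= sp_size h)%N -> range u (Num.min (sp_time h i) (u n)).
  move=> ih; rewrite un; apply: ul; rewrite mem_cat; apply/orP; left.
  by apply/mapP; exists i => //; rewrite mem_iota.
have uh' i : (i <= sp_size h')%N -> range u (Num.min (sp_time h' i) (u n)).
  move=> ih; rewrite un; apply: ul; rewrite mem_cat; apply/orP; right.
  by apply/mapP; exists i => //; rewrite mem_iota.
pose g j w := sp_eval h (u j.+1) w - sp_eval h' (u j.+1) w.
have mg j : (j < n)%N -> measurable_wrt (F (u j)) (g j).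
  move=> jn; apply: measurable_funB.
    exact: (sp_eval_measurable_wrt hF hh u_nd uh).
  exact: (sp_eval_measurable_wrt hF hh' u_nd uh').
have [M hM] := sp_eval_bounded hh; have [M' hM'] := sp_eval_bounded hh'.
have gM j w : (j < n)%N -> `|g j w| <= M + M'.
  by move=> _; rewrite (le_trans (ler_normB _ _))// lerD.
have QE w : Q w = (\sum_(j < n) g j w ^+ 2 * (u j.+1 - u j))%:E.
  have := @integral_grid _ _ u_nd
    (fun s => (sp_eval h s w - sp_eval h' s w) ^+ 2) n.
  rewrite u0 un; apply.
  - by apply: measurable_funX; apply: measurable_funB; exact: sp_eval_measurable.
  - by move=> s; exact: sqr_ge0.
  - move=> j s jn us su; rewrite (sp_eval_grid u_nd uh w jn us su).
    by rewrite (sp_eval_grid u_nd uh' w jn us su).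
have -> : [set w | (dl%:E <= Q w)%E] =
    [set w | dl <= \sum_(j < n) g j w ^+ 2 * (u j.+1 - u j)].
  by apply/seteqP; split => w /=; rewrite QE lee_fin.
have SE w : sp_integral B h t w - sp_integral B h' t w =
    discrete_integral B u g n w.
  rewrite -un (sp_integral_grid B hh u_nd uh).
  rewrite (sp_integral_grid B hh' u_nd uh') -sumrB.
  by apply: eq_bigr => j _; rewrite mulrBl.
have -> : [set w | e <= `|sp_integral B h t w - sp_integral B h' t w|] =
    [set w | e <= `|discrete_integral B u g n w|].
  by apply/seteqP; split => w /=; rewrite SE.
have u0' : 0 <= u 0%N by rewrite u0.
have u_ge0 i : 0 <= u i by elim: i => // i /le_trans; apply.
split; last exact: (discrete_integral_tail hF hB u0' u_nd mg gM).
apply: measurable_le_level; apply: measurable_sum => j.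
apply: measurable_funM => //; apply: measurable_funX.
exact: (filtration_measurable hF (u_ge0 j) (mg _ (ltn_ord j))).
Qed.

End compare_simple_processes.

Lemma sp_integral_measurable d (T : measurableType d) (R : realType)
    (P : probability T R) (F : R -> set (set T)) (B : R -> T -> R)
    (h : @simple_process d T R) t :
  filtration F -> brownian_motion P F B -> simple_process_wf F h -> 0 <= t ->
  measurable_fun setT (sp_integral B h t).
Proof.
move=> hF hB [tau0 tau_nd hc] t0.
have tau_ge0 i : 0 <= sp_time h i by elim: i => // i /le_trans; apply.
apply: measurable_sum => i; have [mc _] := hc i (ltn_ord i).
apply: measurable_funM; first exact: filtration_measurable mc.
by apply: measurable_funB; apply: (bm_measurable hF hB); rewrite le_min t0 tau_ge0.
Qed.

Section riemann_sums.
Context d (T : measurableType d) (R : realType) (P : probability T R).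
Variables (F : R -> set (set T)) (B : R -> T -> R).
Hypotheses (hF : filtration F) (hB : brownian_motion P F B).
Variables (H : R -> T -> R) (C : R).
Hypotheses (aH : adapted F H) (cH : continuous_paths H).
Hypothesis HC : forall s w, `|H s w| <= C.
Variables (a : R) (N : nat) (I : T -> R).
Hypothesis a0 : 0 < a.
Local Notation t := (N%:R * a).
Hypothesis hI : ito_integral P F B H t I.

(** The coarse step [a] is cut into [n.+1] cells, so every coarse time [k%:R * a] is the grid point
    of index [k * n.+1], and one family of sums serves all horizons. *)
Definition riemann_grid n j : R := j%:R * (a / n.+1%:R).

Definition riemann_sum n k : T -> R :=
  discrete_integral B (riemann_grid n) (fun j => H (riemann_grid n j)) k.

Lemma riemann_grid_ge0 n j : 0 <= riemann_grid n j.
Proof. by rewrite /riemann_grid mulr_ge0// divr_ge0// ltW. Qed.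

Lemma riemann_gridS n j : riemann_grid n j.+1 = riemann_grid n j + a / n.+1%:R.
Proof. by rewrite /riemann_grid -addn1 natrD mulrDl mul1r. Qed.

Lemma riemann_grid_nd n j : riemann_grid n j <= riemann_grid n j.+1.
Proof. by rewrite riemann_gridS lerDl divr_ge0// ltW. Qed.

Lemma riemann_gridM n k : riemann_grid n (k * n.+1) = k%:R * a.
Proof.
by rewrite /riemann_grid natrM -mulrA; congr (_ * _); rewrite mulrC divfK.
Qed.

Let rho n := @SimpleProcess d T R (N * n.+1) (riemann_grid n)
  (fun j => H (riemann_grid n j)).

Let rho_wf n : simple_process_wf F (rho n).
Proof.
split => [|i|i _] /=; [exact: riemann_grid_ge0|exact: riemann_grid_nd|].
by split; [apply: aH; exact: riemann_grid_ge0|exists C].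
Qed.

Let rho_integral n : sp_integral B (rho n) t = riemann_sum n (N * n.+1).
Proof.
apply/funext => w; apply: eq_bigr => i _ /=; rewrite -(riemann_gridM n N).
have h j : (j <= N * n.+1)%N -> riemann_grid n j <= riemann_grid n (N * n.+1).
  by move=> jN; apply: (grid_homo (riemann_grid_nd n)).
by rewrite !(min_idPl _)//; apply: h => //; exact: ltnW.
Qed.

Let rho_close n w (r : R) :
  (forall s s', 0 <= s -> s <= t -> 0 <= s' -> s' <= t ->
     `|s - s'| <= a / n.+1%:R -> `|H s w - H s' w| <= r) ->
  forall s, 0 < s -> s <= t -> `|H s w - sp_eval (rho n) s w| <= r.
Proof.
move=> hr s s0 st.
have s0' : riemann_grid n 0 < s by rewrite /riemann_grid mul0r.
have st' : s <= riemann_grid n (N * n.+1) by rewrite riemann_gridM.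
have [j jn [us su]] := grid_cell s0' st'.
rewrite /sp_eval (sum_indic_cell (riemann_grid_nd n)
  (fun j => H (riemann_grid n j) w) jn us su).
apply: hr => //; first exact: ltW.
- exact: riemann_grid_ge0.
- by rewrite (le_trans (ltW us)).
- rewrite ger0_norm; last by rewrite subr_ge0 ltW.
  by rewrite lerBlDl -riemann_gridS.
Qed.

Let D (h : @simple_process d T R) w :=
  (\int[lebesgue_measure]_(s in `[0%R, t]) ((sp_eval h s w - H s w) ^+ 2)%:E)%E.

(** Tonelli's theorem, with the integrand set to zero outside the time strip on which [H] is known
    to be jointly measurable. *)
Let D_measurable h : simple_process_wf F h -> measurable_fun setT (D h).
Proof.
move=> hh; have [[mH _ _] _ _] := hI.
pose f (p : measurableTypeR R * T) : \bar R :=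
  ((fun p => ((sp_eval h p.1 p.2 - H p.1 p.2) ^+ 2)%:E) \_ (`[0, t] `*` setT)) p.
have mf : measurable_fun setT f.
  apply/(measurable_restrictT _ _).1.
    by apply: measurableX.
  apply/measurable_EFinP; apply: measurable_funX; apply: measurable_funB => //.
  apply: measurable_funTS; apply: measurable_sum => i.
  have [tau0 tau_nd hc] := hh; have [mc _] := hc i (ltn_ord i).
  apply: measurable_funM.
    apply: (measurableT_comp _ measurable_snd).
    apply: (filtration_measurable hF _ mc).
    by elim: (nat_of_ord i) => // k /le_trans; apply.
  by apply: (measurableT_comp _ measurable_fst); exact: measurable_indic.
have f0 p : (0 <= f p)%E.
  by rewrite /f patchE; case: ifP => // _; rewrite lee_fin sqr_ge0.
have := @measurable_fun_fubini_tonelli_G _ _ (measurableTypeR R) T R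
  lebesgue_measure f mf f0.
congr (measurable_fun _ _); apply/funext => w.
rewrite /D integral_mkcond; apply: eq_integral => s _.
rewrite /f !patchE; case: ifPn => hs; case: ifPn => hs' //.
  by case/negP: hs'; move/set_mem: hs => [hs _]; exact/mem_set.
by case/negP: hs; move/set_mem: hs' => hs'; exact/mem_set.
Qed.

Let t0 : 0 <= t. Proof. by rewrite mulr_ge0// ltW. Qed.

Let Q h n w := (\int[lebesgue_measure]_(s in `]0%R, t])
  ((sp_eval (rho n) s w - sp_eval h s w) ^+ 2)%:E)%E.

Let path_measurable (A : set R) w : A `<=` `[0, +oo[ ->
  measurable_fun A (H ^~ w).
Proof.
move=> A0; apply: (measurable_funS _ A0) => //.
by apply: subspace_continuous_measurable_fun => //; exact: cH.
Qed.

(** The difference of the two processes passes through [H], within r of the Riemann process along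
    this path; (u + v)^2 <= 2 u^2 + 2 v^2 does the rest. *)
Let Q_le_D h n w (r : R) : 0 <= r ->
  (forall s s', 0 <= s -> s <= t -> 0 <= s' -> s' <= t ->
     `|s - s'| <= a / n.+1%:R -> `|H s w - H s' w| <= r) ->
  (Q h n w <= 2%:E * D h w + (2 * r ^+ 2 * t)%:E)%E.
Proof.
move=> r0 hr.
have mH : measurable_fun `]0, t] (H ^~ w).
  by apply: path_measurable => s; rewrite /= !in_itv/= => /andP[/ltW-> _].
have mD : measurable_fun `]0, t] (fun s => (sp_eval h s w - H s w) ^+ 2).
  apply: measurable_funX; apply: measurable_funB => //.
  by apply: measurable_funTS; exact: sp_eval_measurable.
apply: (@le_trans _ _ (\int[lebesgue_measure]_(s in `]0%R, t])
    (2 * (sp_eval h s w - H s w) ^+ 2 + 2 * r ^+ 2)%:E)%E).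
  apply: ge0_le_integral => //.
  - by move=> s _; rewrite lee_fin sqr_ge0.
  - apply/measurable_EFinP/measurable_funTS; apply: measurable_funX.
    by apply: measurable_funB; exact: sp_eval_measurable.
  - apply/measurable_EFinP; apply: measurable_funD => //.
    exact: measurable_funM.
  - move=> s; rewrite /= in_itv/= => /andP[s0 st]; rewrite lee_fin.
    have := rho_close hr s0 st; rewrite ler_norml => /andP[].
    move: (sp_eval h s w) (H s w) (sp_eval (rho n) s w) => x y z h1 h2.
    have : (y - z) ^+ 2 <= r ^+ 2 by nra.
    by have := sqr_ge0 (x - y + (z - y)); nra.
under eq_integral do rewrite EFinD.
rewrite ge0_integralD//; last 3 first.
- by move=> s _; rewrite lee_fin mulr_ge0// sqr_ge0.
- by apply/measurable_EFinP; exact: measurable_funM.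
- by move=> s _; rewrite lee_fin mulr_ge0// sqr_ge0.
apply: leeD; last first.
  rewrite integral_cst//= lebesgue_measure_itv/= lte_fin.
  have [_|h0] := ltP 0 t; first by rewrite -EFinM subr0.
  by rewrite mule0 lee_fin mulr_ge0// mulr_ge0// sqr_ge0.
under eq_integral do rewrite EFinM.
rewrite ge0_integralZl//; last 2 first.
- exact/measurable_EFinP.
- by move=> s _; rewrite lee_fin sqr_ge0.
(* Grid cells are left-open, whereas the definition of the integral uses the closed interval. *)
rewrite lee_pmul2l// /D; apply: ge0_subset_integral => //.
- apply/measurable_EFinP; apply: measurable_funX; apply: measurable_funB.
    by apply: measurable_funTS; exact: sp_eval_measurable.
  by apply: path_measurable => s; rewrite /= !in_itv/= => /andP[-> _].
- by move=> s _; rewrite lee_fin sqr_ge0.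
- by apply: subset_itv; rewrite bnd_simp.
Qed.

(** An index m is fixed with [h m] close to [H] and its integral close to [I]; only then does n
    grow, which brings the Riemann process close to [H] along the paths of [W]. The four quarters of
    l pay for the integral of [h m], the tail bound, the complement of [W] and the distance from
    [h m] to [H]. *)
Lemma riemann_sum_cvg :
  vanishes_in_probability P (fun n w => riemann_sum n (N * n.+1) w - I w).
Proof.
move=> e l e0 l0; have [[_ _ _] mI [h [hwf hL2 hlim]]] := hI.
have e2 : 0 < e / 2 by rewrite divr_gt0.
have l4 : 0 < l / 4 by rewrite divr_gt0.
have [dl [dl0 dlE]] : exists dl : R, 0 < dl /\ dl / (e / 2) ^+ 2 = l / 4.
  exists (l / 4 * (e / 2) ^+ 2); split; first by rewrite mulr_gt0// exprn_gt0.
  by rewrite mulfK// expf_neq0// gt_eqF.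
have to_real (A : nat -> set T) : P (A n) @[n --> \oo] --> 0%E ->
    exists n0, forall n, (n0 <= n)%N -> fine (P (A n)) <= l / 4.
  move=> /fine_cvgP[_ /cvgrPdist_le/(_ _ l4)[n0 _ hn0]]; exists n0 => n /hn0 /=.
  by rewrite sub0r normrN => /(le_trans (ler_norm _)).
have dl4 : 0 < dl / 4 by rewrite divr_gt0.
have [m1 hm1] := to_real _ (hL2 _ dl4).
have [m2 hm2] := to_real _ (hlim _ e2).
pose m := maxn m1 m2.
have {hm1}Pm1 := hm1 m (leq_maxl _ _); have {hm2}Pm2 := hm2 m (leq_maxr _ _).
(* In [Q_le_D] the term in r takes at most half of [dl], and 2 D less than the other half when D is
   below dl / 4. The denominator uses t + 1 because t may be 0. *)
have [r [r0 rt]] : exists r : R, 0 < r /\ 2 * r ^+ 2 * t <= dl / 2.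
  have q0 : 0 < dl / (4 * (t + 1)) by rewrite divr_gt0// mulr_gt0// ltr_wpDl.
  exists (Num.min 1 (dl / (4 * (t + 1)))); split; first by rewrite lt_min ltr01.
  have q1 : Num.min 1 (dl / (4 * (t + 1))) <= 1 by rewrite ge_min lexx.
  have qq : Num.min 1 (dl / (4 * (t + 1))) * (4 * (t + 1)) <= dl.
    by rewrite -ler_pdivlMr ?mulr_gt0 ?ltr_wpDl// ge_min lexx orbT.
  have : 0 <= Num.min 1 (dl / (4 * (t + 1))) by rewrite le_min ler01 ltW.
  move: (Num.min _ _) q1 qq => q q1 qq q00.
  have : q ^+ 2 <= q by rewrite expr2 ler_piMr.
  by have := t0; nra.
have [n1 [W [mW PW hW]]] := path_modulus P hF aH cH t0 r0 l4.
have [n0 hn0] : exists n0 : nat, a * n1.+1%:R <= n0%:R.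
  exists (Num.bound (a * n1.+1%:R)); apply/ltW/archi_boundP.
  by rewrite mulr_ge0// ltW.
exists n0 => n nn0.
have an : a / n.+1%:R <= n1.+1%:R^-1.
  rewrite ler_pdivrMr// mulrC ler_pdivlMr// (le_trans hn0)// ler_nat.
  exact: leqW.
have [mQ tail] := sp_integral_tail hF hB (rho_wf n) (hwf m) t0 dl0 e2.
rewrite dlE in tail.
have mS : measurable_fun setT (sp_integral B (h m) t).
  exact: (sp_integral_measurable hF hB (hwf m) t0).
have mr : measurable_fun setT (sp_integral B (rho n) t).
  exact: (sp_integral_measurable hF hB (rho_wf n) t0).
have mE1 : measurable
    [set w | e / 2 <= `|sp_integral B (rho n) t w - sp_integral B (h m) t w|].
  apply: measurable_le_level; apply: measurableT_comp => //.
  exact: measurable_funB.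
have mE2 : measurable [set w | e / 2 <= `|sp_integral B (h m) t w - I w|].
  apply: measurable_le_level; apply: measurableT_comp => //.
  exact: measurable_funB.
have mDm : measurable [set w | ((dl / 4)%:E <= D (h m) w)%E].
  rewrite -[X in measurable X]setTI.
  exact: emeasurable_fun_c_infty (D_measurable (hwf m)) _.
rewrite -rho_integral.
apply: (@le_trans _ _ (fine (P
  ([set w | e / 2 <= `|sp_integral B (rho n) t w - sp_integral B (h m) t w|] `|`
   [set w | e / 2 <= `|sp_integral B (h m) t w - I w|])))).
  apply: le_Pr; [|exact: measurableU|].
    by apply: measurable_le_level; apply: measurableT_comp => //; exact: measurable_funB.
  move=> w /= ew; have [|h1] := leP (e / 2)
    `|sp_integral B (rho n) t w - sp_integral B (h m) t w|; [by left|right].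
  rewrite leNgt; apply/negP => h2; move: ew; apply/negP; rewrite -ltNge.
  rewrite (_ : sp_integral B (rho n) t w - I w =
    (sp_integral B (rho n) t w - sp_integral B (h m) t w) +
    (sp_integral B (h m) t w - I w)); last by ring.
  by rewrite (le_lt_trans (ler_normD _ _))// [ltRHS]splitr ltrD.
apply: (le_trans (PrU P mE1 mE2)).
have hE2 : fine (P [set w | e / 2 <= `|sp_integral B (h m) t w - I w|]) <= l / 4.
  by move: Pm2; under eq_set do rewrite lee_fin.
have hQ : fine (P [set w | (dl%:E <= Q (h m) n w)%E]) <= l / 4 + l / 4.
  apply: (@le_trans _ _ (fine (P (~` W `|` [set w | ((dl / 4)%:E <= D (h m) w)%E])))).
    apply: le_Pr => //; first by apply: measurableU => //; exact: measurableC.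
    move=> w /= dQ; have [Ww|] := pselect (W w); [right|by left].
    have := Q_le_D (h m) (ltW r0) (fun s s' s0 st s'0 s't ss =>
      hW w Ww s s' s0 st s'0 s't (le_trans ss an)).
    move=> /(le_trans dQ).
    have : (0 <= D (h m) w)%E by apply: integral_ge0 => s _; rewrite lee_fin sqr_ge0.
    case: (D (h m) w) => [x| |]//; last by move=> *; exact: leey.
    rewrite -EFinM -EFinD !lee_fin => _; lra.
  by apply: (le_trans (PrU P (measurableC mW) mDm)); rewrite lerD.
have := le_trans tail (lerD hQ (lexx _)).
by move: hE2; rewrite -/(Q _ _); lra.
Qed.

End riemann_sums.

(** * Increments of the Ito integral *)

Section ito_increments.
Context d (T : measurableType d) (R : realType) (P : probability T R).
Variables (F : R -> set (set T)) (B : R -> T -> R).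
Hypotheses (hF : filtration F) (hB : brownian_motion P F B).
Variables (H : R -> T -> R) (C : R).
Hypotheses (aH : adapted F H) (cH : continuous_paths H).
Hypothesis HC : forall s w, `|H s w| <= C.
Variables (a : R) (I : nat -> T -> R).
Hypothesis a0 : 0 < a.
Hypothesis hI : forall k, ito_integral P F B H (k%:R * a) (I k).

Lemma vanishesB (Y Y' : nat -> T -> R) :
  (forall n, measurable_fun setT (Y n)) -> (forall n, measurable_fun setT (Y' n)) ->
  vanishes_in_probability P Y -> vanishes_in_probability P Y' ->
  vanishes_in_probability P (fun n w => Y n w - Y' n w).
Proof.
move=> mY mY' vY vY' e l e0 l0.
have e2 : 0 < e / 2 by rewrite divr_gt0.
have l2 : 0 < l / 2 by rewrite divr_gt0.
have [n1 h1] := vY _ _ e2 l2; have [n2 h2] := vY' _ _ e2 l2.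
exists (maxn n1 n2) => n; rewrite geq_max => /andP[/h1 {}h1 /h2 {}h2].
have m1 : measurable [set w | e / 2 <= `|Y n w|].
  by apply: measurable_le_level; exact: measurableT_comp.
have m2 : measurable [set w | e / 2 <= `|Y' n w|].
  by apply: measurable_le_level; exact: measurableT_comp.
rewrite [leRHS]splitr; apply: (le_trans _ (lerD h1 h2)).
apply: (le_trans _ (PrU P m1 m2)); apply: le_Pr; [|exact: measurableU|].
  apply: measurable_le_level; apply: measurableT_comp => //.
  exact: measurable_funB.
move=> w /= ew; have [|h] := leP (e / 2) `|Y n w|; [by left|right].
rewrite leNgt; apply/negP => h'; move: ew; apply/negP; rewrite -ltNge.
by rewrite (le_lt_trans (ler_normB _ _))// [ltRHS]splitr ltrD.
Qed.

Variables (k : nat) (theta : T -> R) (kappa : R).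
Local Notation s := (k%:R * a).
Local Notation s' := (k.+1%:R * a).
Hypotheses (mtheta : measurable_wrt (F s) theta).
Hypothesis thetaC : forall w, `|theta w| <= C.
Hypothesis kappaP : forall r, s <= r -> r <= s' ->
  \int[P]_w ((H r w - theta w) ^+ 2) <= kappa.

(** The Ito integral of [H - theta] over [s, s']. It is used with [theta] zero, to centre the
    increment of the integral itself, and with [theta] equal to [H] at time s, to measure how far
    that increment is from [theta] times the Brownian one. *)
Let Z w := I k.+1 w - I k w - theta w * (B s' w - B s w).

Let s0 : 0 <= s. Proof. by rewrite mulr_ge0// ltW. Qed.

Let u n j := riemann_grid a n (k * n.+1 + j).
Let g n j w := H (u n j) w - theta w.

Let u0 n : u n 0 = s.
Proof. by rewrite /u addn0 riemann_gridM. Qed.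

Let un n : u n n.+1 = s'.
Proof. by rewrite /u -mulSnr riemann_gridM. Qed.

Let u_nd n j : u n j <= u n j.+1.
Proof. by rewrite /u addnS; exact: riemann_grid_nd. Qed.

Let u_ge0 n j : 0 <= u n j.
Proof. exact: riemann_grid_ge0. Qed.

Let mg n j : (j < n.+1)%N -> measurable_wrt (F (u n j)) (g n j).
Proof.
move=> _; apply: measurable_funB; first by apply: aH.
apply: (filtration_measurableW hF s0 _ mtheta).
by rewrite -(u0 n); exact: grid_homo.
Qed.

Let gC n j w : (j < n.+1)%N -> `|g n j w| <= C + C.
Proof. by move=> _; rewrite (le_trans (ler_normB _ _))// lerD. Qed.

Let Y n := discrete_integral B (u n) (g n) n.+1.

Let YE n w : Y n w = riemann_sum B H a n (k.+1 * n.+1) w -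
  riemann_sum B H a n (k * n.+1) w - theta w * (B s' w - B s w).
Proof.
have -> : riemann_sum B H a n (k.+1 * n.+1) w - riemann_sum B H a n (k * n.+1) w =
    \sum_(j < n.+1) H (u n j) w * (B (u n j.+1) w - B (u n j) w).
  rewrite /riemann_sum /discrete_integral mulSnr.
  rewrite -!(big_mkord xpredT (fun j => H (riemann_grid a n j) w *
    (B (riemann_grid a n j.+1) w - B (riemann_grid a n j) w))).
  rewrite (big_cat_nat (n := k * n.+1)) ?leq_addr//= [X in X - _]addrC addrK.
  rewrite -{1}[(k * n.+1)%N]add0n big_addn addnC addnK big_mkord.
  by apply: eq_bigr => j _; rewrite /u addnS addnC.
have -> : B s' w - B s w = \sum_(j < n.+1) (B (u n j.+1) w - B (u n j) w).
  rewrite -(big_mkord xpredT (fun j => B (u n j.+1) w - B (u n j) w)).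
  by rewrite (telescope_sumr (fun j => B (u n j) w))// u0 un.
rewrite mulr_sumr -sumrB; apply: eq_bigr => j _.
by rewrite -mulrBl.
Qed.

Let mI j : measurable_fun setT (I j).
Proof. by case: (hI j). Qed.

Let mRS n j : measurable_fun setT (riemann_sum B H a n j).
Proof.
apply: (filtration_measurable hF (riemann_grid_ge0 a0 n j)).
apply: (discrete_integral_measurable_wrt hF hB _ (riemann_grid_nd a0 n)) => //.
  exact: riemann_grid_ge0.
by move=> i _; apply: aH; exact: riemann_grid_ge0.
Qed.

Let mD : measurable_fun setT (fun w => theta w * (B s' w - B s w)).
Proof.
apply: measurable_funM; first exact: (filtration_measurable hF s0 mtheta).
apply: measurable_funB; apply: (bm_measurable hF hB) => //.
by rewrite mulr_ge0// ltW.
Qed.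

Let mZ : measurable_fun setT Z.
Proof. by apply: measurable_funB => //; exact: measurable_funB. Qed.

Let YZ : vanishes_in_probability P (fun n w => Y n w - Z w).
Proof.
have v j := riemann_sum_cvg hF hB aH cH HC a0 (hI j).
have mv j n : measurable_fun setT (fun w => riemann_sum B H a n (j * n.+1) w - I j w).
  exact: measurable_funB.
have := vanishesB (mv k.+1) (mv k) (v k.+1) (v k).
congr (vanishes_in_probability P _); apply/funext => n; apply/funext => w.
by rewrite YE /Z; ring.
Qed.

(** The coarse step consists of [n.+1] cells of length a / (n + 1), each with a coefficient of
    second moment at most [kappa]. *)
Let isometry n : L1 P (fun w => Y n w ^+ 2) /\
  \int[P]_w (Y n w ^+ 2) <= a * kappa.
Proof.
have u00 : 0 <= u n 0 by [].
have [iY ->] := discrete_integral_isometry hF hB u00 (u_nd n)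
  (@mg n) (@gC n) (leqnn n.+1).
split=> //; apply: (@le_trans _ _ (\sum_(j < n.+1) kappa * (a / n.+1%:R))).
  apply: ler_sum => j _.
  have -> : u n j.+1 = u n j + a / n.+1%:R by rewrite /u addnS riemann_gridS.
  rewrite [X in _ * X]addrC addKr.
  rewrite ler_wpM2r ?divr_ge0 ?(ltW a0)//; apply: kappaP.
    by rewrite -(u0 n); exact: grid_homo.
  by rewrite -(un n); apply: grid_homo => //; exact: ltnW.
rewrite sumr_const card_ord -[leLHS]mulr_natr -mulrA divfK ?pnatr_eq0//.
by rewrite mulrC.
Qed.

(** The L^2 bound on the Riemann sums of [H - theta] passes to the limit by [sqr_L1_limit], which
    costs the factor 2. *)
Lemma ito_increment_sqr :
  L1 P (fun w => Z w ^+ 2) /\ \int[P]_w (Z w ^+ 2) <= 2 * (a * kappa).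
Proof.
apply: (sqr_L1_limit _ mZ YZ) => n; [|by case: (isometry n)..].
apply: (filtration_measurable hF (u_ge0 n n.+1)).
exact: (discrete_integral_measurable_wrt hF hB (u_ge0 n 0) (u_nd n)
  (@mg n) (leqnn _)).
Qed.

(** Each Riemann sum over [s, s'] is orthogonal to bounded variables known at s, and [Exp_mul_limit]
    carries this to the limit. *)
Lemma Exp_mul_ito_increment (xi : T -> R) (M : R) : measurable_wrt (F s) xi ->
  (forall w, `|xi w| <= M) -> \int[P]_w (xi w * Z w) = 0.
Proof.
move=> mxi xiM.
apply: (Exp_mul_limit (c := a * kappa) _ mZ YZ _ _ _ xiM) => [n|n|n||n].
- apply: (filtration_measurable hF (u_ge0 n n.+1)).
  exact: (discrete_integral_measurable_wrt hF hB (u_ge0 n 0) (u_nd n)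
    (@mg n) (leqnn _)).
- by case: (isometry n).
- by case: (isometry n).
- exact: (filtration_measurable hF s0 mxi).
- apply: (Exp_mul_discrete_integral hF hB (u_ge0 n 0) (u_nd n)
    (@mg n) (@gC n) _ xiM).
  by rewrite u0.
Qed.

End ito_increments.

(** * The potential *)

Section real_functions.
Context (R : realType).
Implicit Types f g df : R -> R.

Lemma locally_lipschitz_continuous f : locally_lipschitz f -> continuous f.
Proof.
move=> lf x; have [U Ux lU] := lf x.
have [M M0 hM] : exists2 M, 0 < M &
    forall y z, U y -> U z -> `|f y - f z| <= M * `|y - z|.
  near (pinfty_nbhs R) => M; exists M.
    by near: M; apply: nbhs_pinfty_gt; exact: num_real.
  have lM : M.-lipschitz_on f (globally (U `*` U)) by near: M; exact: lU.
  by move=> y z Uy Uz; exact: (lM (y, z) (conj Uy Uz)).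
apply/cvgrPdist_le => e e0; near=> y.
apply: (le_trans (hM _ _ (nbhs_singleton Ux) _)); first by near: y.
rewrite -ler_pdivlMl// mulrC; near: y.
have r0 : 0 < e / M by rewrite divr_gt0.
apply/nbhs_ballP; exists (e / M) => //= y; rewrite /ball/= => /ltW.
by rewrite mulrC.
Unshelve. all: by end_near. Qed.

Lemma continuous_segment_bounded f (a b : R) : a <= b -> continuous f ->
  exists2 M, 0 <= M & forall x, a <= x -> x <= b -> `|f x| <= M.
Proof.
move=> ab cf; have cn : {within `[a, b], continuous (fun x => `|f x|)}.
  apply: continuous_subspaceT => x.
  by apply: (continuous_comp (cf x)); exact: norm_continuous.
have [c _ hc] := EVT_max ab cn.
by exists `|f c| => // x ax xb; apply: hc; rewrite in_itv/= ax xb.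
Qed.

(** Covers increments y of either sign. The inequality on (c - x) y records that c lies on the same
    side of x as x + y, which later decides the sign of a derivative. *)
Lemma MVT_between f df (x y : R) :
  (forall z, `|z - x| <= `|y| -> is_derive z 1 f (df z)) ->
  exists c, [/\ `|c - x| <= `|y|, 0 <= (c - x) * y &
    f (x + y) - f x = df c * y].
Proof.
move=> fd.
have fc (a b : R) : (forall z, a <= z -> z <= b -> `|z - x| <= `|y|) ->
    {within `[a, b], continuous f}.
  move=> h; apply: derivable_within_continuous => z; rewrite in_itv/= => /andP[az zb].
  by have [] := fd _ (h _ az zb).
have [y0|y0] := leP 0 y.
  have h z : x <= z -> z <= x + y -> `|z - x| <= `|y|.
    by move=> h1 h2; rewrite !ger0_norm ?subr_ge0//; lra.
  have [|||c] := @MVT_segment _ f df x (x + y); first by lra.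
  - move=> z; rewrite in_itv/= => /andP[h1 h2]; apply: fd.
    by apply: h; exact: ltW.
  - exact: fc.
  - rewrite in_itv/= => /andP[h1 h2] e; exists c; split; first exact: h.
      by rewrite mulr_ge0// subr_ge0.
    by rewrite e; congr (_ * _); ring.
have h z : x + y <= z -> z <= x -> `|z - x| <= `|y|.
  by move=> h1 h2; rewrite (ltr0_norm y0) ler0_norm ?subr_le0//; lra.
have [|||c] := @MVT_segment _ f df (x + y) x; first by lra.
- move=> z; rewrite in_itv/= => /andP[h1 h2]; apply: fd.
  by apply: h; exact: ltW.
- exact: fc.
- rewrite in_itv/= => /andP[h1 h2] e; exists c; split; first exact: h.
    by rewrite mulr_le0 ?subr_le0// ltW.
  by rewrite -opprB e; ring.
Qed.

(** Integrating from - L avoids oriented integrals at negative x; subtracting a constant normalizes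
    at 0. *)
Lemma antiderivative f (L : R) : 0 < L -> continuous f ->
  exists2 G : R -> R, G 0 = 0 & forall x, `|x| < L -> is_derive x (1 : R) G (f x).
Proof.
move=> L0 cf.
pose G0 x := \int[lebesgue_measure]_(t in `[- L, x]) f t.
have fi : lebesgue_measure.-integrable `[- L, L] (EFin \o f).
  apply: continuous_compact_integrable; first exact: segment_compact.
  exact: continuous_subspaceT.
have dG0 x : `|x| < L -> is_derive x (1 : R) G0 (f x).
  rewrite ltr_norml => /andP[Lx xL].
  have [d1 d2] := continuous_FTC1_closed xL fi Lx (cf x).
  by apply: DeriveDef; [exact: d1|rewrite -derive1E; exact: d2].
exists (fun x => G0 x - G0 0); first by rewrite subrr.
move=> x xL; have := dG0 _ xL => h.
have -> : (fun x => G0 x - G0 0) = G0 - cst (G0 0) by [].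
by apply: is_derive_eq; rewrite subr0.
Qed.

(* Second-order Taylor formula around [x], with the increment split as
   [y + r]: only [y] enters the quadratic term, and the error is quadratic in
   [r]. The function is arbitrary but bounded at distance more than 1. *)
Lemma taylor_truncated (f g g' : R -> R) (K Mf e : R) : 0 < K -> 0 < e ->
  (forall x, `|f x| <= Mf) -> continuous g -> continuous g' ->
  (forall x, `|x| < K + 1 -> is_derive x (1 : R) f (g x)) ->
  (forall x, is_derive x (1 : R) g (g' x)) ->
  exists2 C, 0 <= C & forall x y r, `|x| <= K ->
    f (x + (y + r)) - f x <= g x * (y + r) + g' x / 2 * y ^+ 2 +
      e * y ^+ 2 + C * (y ^+ 4 + r ^+ 2).
Proof.
move=> K0 e0 fM cg cg' df dg.
have K10 : - (K + 1) <= K + 1 by lra.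
have [Mg Mg0 hMg] := continuous_segment_bounded K10 cg.
have [M M0 hM] := continuous_segment_bounded K10 cg'.
have Mf0 : 0 <= Mf by exact: le_trans (fM 0).
pose Rem x y := f (x + y) - f x - g x * y - g' x / 2 * y ^+ 2.
have remainder x y m : `|x| <= K -> `|y| < 1 -> 0 <= m ->
    (forall z, `|z - x| <= `|y| -> `|g' z - g' x| <= m) ->
    `|Rem x y| <= m * y ^+ 2.
  move=> xK y1 m0 hm.
  (* Its derivative g(x + z) - g(x) - g'(x) z is an increment of g minus its linear part, so a
     second mean value theorem leaves only the oscillation of g'. *)
  pose psi z := f (x + z) - (g x * z + g' x / 2 * z ^+ 2).
  have [z|c [cy _ psiE]] := @MVT_between psi (fun z => g (x + z) - (g x + g' x * z)) 0 y.
    rewrite subr0 => zy.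
    have xz : `|x + z| < K + 1.
      by rewrite (le_lt_trans (ler_normD _ _))// ler_ltD// (le_lt_trans zy).
    have h1 : is_derive z (1 : R) (fun z => f (x + z)) (g (x + z)).
      have := df _ xz => h.
      have h2 : is_derive z (1 : R) (fun z => x + z) 1.
        have -> : (fun z => x + z) = cst x + id by [].
        by apply: is_derive_eq; rewrite add0r.
      by have := @is_derive1_comp _ f (fun z => x + z) z _ _ h h2; rewrite mulr1.
    have h2 : is_derive z (1 : R) (fun z => g x * z + g' x / 2 * z ^+ 2)
        (g x + g' x * z).
      have -> : (fun z => g x * z + g' x / 2 * z ^+ 2) =
        g x \*: id + g' x / 2 \*: (fun z : R => z ^+ 2) by [].
      apply: is_derive_eq; rewrite /GRing.scale/= mulr1; congr (_ + _).
      by field.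
    exact: is_deriveB h1 h2.
  rewrite subr0 in cy.
  have [xi [xic _ gE]] := @MVT_between g g' x c (fun z _ => dg z).
  have -> : Rem x y = (g' xi - g' x) * c * y.
    have -> : Rem x y = psi (0 + y) - psi 0.
      by rewrite /psi /Rem !add0r mulr0 addr0 expr0n/= mulr0 addr0 subr0; ring.
    rewrite psiE; congr (_ * _); rewrite mulrBl -gE; ring.
  rewrite !normrM -mulrA -(real_normK (num_real y)) expr2.
  apply: ler_pM => //; first by apply: hm; exact: le_trans cy.
  exact: ler_pM.
(* Increments of size at least 1, where [f] may be truncated, only use the bounds and 1 <= y^2; the
   part 2 M also covers |y| < 1. *)
pose C2 := 2 * Mf + Mg + 2 * M.
have C20 : 0 <= C2 by rewrite /C2; lra.
have near_K x y : `|x| <= K -> `|y| <= 1 -> `|g' (x + y)| <= M.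
  move=> xK y1; have : `|x + y| <= K + 1.
    by rewrite (le_trans (ler_normD _ _))// lerD.
  by rewrite ler_norml => /andP[]; exact: hM.
have g'x x : `|x| <= K -> `|g' x| <= M.
  by move=> xK; rewrite -[x]addr0 near_K// normr0.
have rem_quadratic x y : `|x| <= K -> `|Rem x y| <= C2 * y ^+ 2.
  move=> xK; have [y1|y1] := ltP `|y| 1.
    apply: (@le_trans _ _ (2 * M * y ^+ 2)).
      apply: remainder => //; first by rewrite mulr_ge0.
      move=> z zy; rewrite (le_trans (ler_normB _ _))// mulr2n mulrDl mul1r.
      apply: lerD; last exact: g'x.
      have <- : x + (z - x) = z by ring.
      by apply: near_K => //; exact: le_trans zy (ltW y1).
    by rewrite ler_wpM2r ?sqr_ge0// /C2; lra.
  have y2 : `|y| <= y ^+ 2.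
    by rewrite -(real_normK (num_real y)) expr2 ler_peMr.
  have y21 : 1 <= y ^+ 2 by exact: le_trans y2.
  have h1 : `|g x| <= Mg.
    by move: xK; rewrite ler_norml => /andP[? ?]; apply: hMg; lra.
  have h2 : `|g x * y| <= Mg * y ^+ 2 by rewrite normrM; exact: ler_pM.
  have h3 : `|g' x / 2 * y ^+ 2| <= M * y ^+ 2.
    rewrite normrM (ger0_norm (sqr_ge0 y)) ler_wpM2r ?sqr_ge0//.
    rewrite normrM (ger0_norm (_ : 0 <= 2^-1)) ?invr_ge0//.
    by rewrite ler_pdivrMr// (le_trans (g'x _ xK))// ler_peMr// ler1n.
  have h4 : `|f (x + y)| + `|f x| <= 2 * Mf * y ^+ 2.
    rewrite (le_trans (lerD (fM _) (fM _)))//.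
    by have := ler_wpM2l Mf0 y21; lra.
  rewrite /Rem (le_trans (ler_normB _ _))//.
  rewrite (le_trans (lerD (ler_normB _ _) (lexx _)))//.
  rewrite (le_trans (lerD (lerD (ler_normB _ _) (lexx _)) (lexx _)))//.
  rewrite (le_trans (lerD (lerD h4 h2) h3))// -!mulrDl.
  by rewrite ler_wpM2r ?sqr_ge0// /C2; lra.
(* Two errors are multiples of [e1 * y ^+ 2]: 4 from the remainder at y + r and M / 2 from the cross
   term. *)
have [e1 e10 e1e] : exists2 e1, 0 < e1 & (4 + M / 2) * e1 = e.
  have h : 0 < 4 + M / 2 by lra.
  by exists (e / (4 + M / 2)); [rewrite divr_gt0|rewrite mulrC divfK// gt_eqF].
have [n hn] := uniform_continuity_segment (- K) K cg' e10.
pose q : R := n.+1%:R^-1; have q0 : 0 < q by rewrite invr_gt0.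
have q1 : q <= 1 by rewrite invf_le1// ler1n.
(* For |y| >= q one has y^2 <= y^4 / q^2, which makes the crude quadratic bound quartic. *)
pose D := C2 / q ^+ 2.
have D0 : 0 <= D by rewrite divr_ge0// sqr_ge0.
have rem_small x y : `|x| <= K -> `|Rem x y| <= e1 * y ^+ 2 + D * y ^+ 4.
  move=> xK; have y40 : 0 <= y ^+ 4 by rewrite exprn_even_ge0.
  have [yq|yq] := ltP `|y| q.
    apply: (@le_trans _ _ (e1 * y ^+ 2)); last by rewrite lerDl mulr_ge0.
    apply: remainder => //; [exact: lt_le_trans q1|exact: ltW|].
    move=> z zy; rewrite distrC; move: (xK); rewrite ler_norml => /andP[h1 h2].
    by apply: hn => //; rewrite distrC (le_trans zy)// ltW.
  rewrite (le_trans (rem_quadratic _ _ xK))//.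
  apply: (@le_trans _ _ (D * y ^+ 4)); last first.
    by rewrite lerDr mulr_ge0 ?sqr_ge0// ltW.
  rewrite /D mulrAC ler_pdivlMr ?exprn_gt0// -mulrA ler_wpM2l//.
  rewrite (exprD y 2 2) ler_wpM2l ?sqr_ge0// -[leRHS]real_normK ?num_real//.
  by rewrite lerXn2r// nnegrE// ltW.
exists (16 * D + 4 * C2 + M / 2 + M / 2 / e1).
  have : 0 <= M / 2 / e1 by rewrite divr_ge0 ?divr_ge0// ltW.
  by move: (M / 2 / e1) => m; lra.
move=> x y r xK.
have y40 : 0 <= y ^+ 4 by rewrite exprn_even_ge0.
have y20 := sqr_ge0 y; have r20 := sqr_ge0 r.
have bound_u : `|Rem x (y + r)| <= 4 * e1 * y ^+ 2 + 16 * D * y ^+ 4 + 4 * C2 * r ^+ 2.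
  have C2r : 0 <= 4 * C2 * r ^+ 2 by apply: mulr_ge0 => //; exact: mulr_ge0.
  have Dy : 0 <= 16 * D * y ^+ 4 by apply: mulr_ge0 => //; exact: mulr_ge0.
  have ey : 0 <= 4 * e1 * y ^+ 2.
    by apply: mulr_ge0 => //; apply: mulr_ge0 => //; exact: ltW.
  have [ry|yr] := leP `|r| `|y|.
    have u2 : (y + r) ^+ 2 <= 4 * y ^+ 2.
      have : r ^+ 2 <= y ^+ 2.
        by rewrite -(real_normK (num_real r)) -(real_normK (num_real y)) lerXn2r.
      by have := sqr_ge0 (y - r); nra.
    have u4 : (y + r) ^+ 4 <= 16 * y ^+ 4.
      rewrite (exprM _ 2 2) (exprM y 2 2) (_ : 16 * _ = (4 * y ^+ 2) ^+ 2); last by ring.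
      by rewrite lerXn2r// nnegrE ?sqr_ge0// mulr_ge0.
    apply: (le_trans (rem_small x (y + r) xK)).
    have := ler_wpM2l (ltW e10) u2; have := ler_wpM2l D0 u4; lra.
  have u2 : (y + r) ^+ 2 <= 4 * r ^+ 2.
    have : y ^+ 2 <= r ^+ 2.
      by rewrite -(real_normK (num_real r)) -(real_normK (num_real y)) lerXn2r// ltW.
    by have := sqr_ge0 (y - r); nra.
  apply: (le_trans (rem_quadratic x (y + r) xK)).
  have := ler_wpM2l C20 u2; lra.
(* Replacing the square of y + r by that of y leaves 2 y r + r^2, split by Young's inequality with
   weight [e1]. *)
have cross : g' x / 2 * (2 * (y * r) + r ^+ 2) <=
    M / 2 * (e1 * y ^+ 2 + r ^+ 2 / e1 + r ^+ 2).
  apply: (le_trans (ler_norm _)); rewrite normrM.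
  apply: ler_pM => //.
    rewrite normrM (ger0_norm (_ : 0 <= 2^-1)) ?invr_ge0// ler_wpM2r ?invr_ge0//.
    exact: g'x.
  rewrite (le_trans (ler_normD _ _))// (ger0_norm r20) lerD2r.
  have ee : e1 * (e1 * y ^+ 2 + r ^+ 2 / e1) = e1 ^+ 2 * y ^+ 2 + r ^+ 2.
    by field; rewrite gt_eqF.
  have := sqr_ge0 (e1 * y - r); have := sqr_ge0 (e1 * y + r) => h1 h2.
  rewrite -(ler_pM2l e10) ee -[X in X * _](ger0_norm (ltW e10)) -normrM ler_norml.
  by apply/andP; split; nra.
have -> : f (x + (y + r)) - f x = Rem x (y + r) + g x * (y + r) +
    g' x / 2 * y ^+ 2 + g' x / 2 * (2 * (y * r) + r ^+ 2).
  by rewrite /Rem; field.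
have := le_trans (ler_norm _) bound_u; move: cross.
rewrite -e1e; have : 0 <= M / 2 / e1 * y ^+ 4.
  by apply: mulr_ge0 => //; rewrite divr_ge0 ?divr_ge0// ltW.
have : 0 <= M / 2 * y ^+ 4 by apply: mulr_ge0 => //; exact: divr_ge0.
have : 0 <= D * r ^+ 2 by rewrite mulr_ge0.
have : 0 <= C2 * y ^+ 4 by rewrite mulr_ge0.
rewrite (_ : M / 2 * (e1 * y ^+ 2 + r ^+ 2 / e1 + r ^+ 2) =
  M / 2 * e1 * y ^+ 2 + M / 2 / e1 * r ^+ 2 + M / 2 * r ^+ 2); last by ring.
move: (M / 2 / e1) => m; lra.
Qed.

End real_functions.

(** * The truncated potential of the diffusion *)

Section potential.
Context (R : realType) (sigma : R -> R) (sigma0 : R).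
Hypothesis sigma_gt0 : forall x : R, 0 < sigma x.
Hypothesis sigma_derivable : forall x : R, derivable sigma x 1.
Hypothesis sigma'_lipschitz : locally_lipschitz (sigma^`())%classic.
Hypothesis sigma_bounded : forall x : R, sigma x <= sigma0.
Local Notation sigma' := ((sigma^`())%classic).

Let sigma_neq0 x : sigma x != 0.
Proof. by rewrite gt_eqF. Qed.

Lemma sigma_continuous : continuous sigma.
Proof.
by move=> x; apply/differentiable_continuous; rewrite -derivable1_diffP.
Qed.

Lemma sigma'_continuous : continuous sigma'.
Proof. exact: locally_lipschitz_continuous. Qed.

Let g x := 2 * x / sigma x ^+ 2.
Let g' x := 2 / sigma x ^+ 2 - 4 * x * sigma' x / sigma x ^+ 3.

Let sigmaX_continuous n : continuous (fun x => (sigma x ^+ n)^-1).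
Proof.
move=> x; apply: cvgV; first by rewrite expf_neq0.
have h : continuous ((fun y : R => y ^+ n) \o sigma).
  move=> y; apply: continuous_comp; first exact: sigma_continuous.
  exact: exprn_continuous.
exact: h.
Qed.

Let g_continuous : continuous g.
Proof.
move=> x; apply: cvgM; last exact: sigmaX_continuous.
by apply: cvgM; [exact: cvg_cst|exact: cvg_id].
Qed.

Let g'_continuous : continuous g'.
Proof.
move=> x; apply: cvgB; first by apply: cvgM; [exact: cvg_cst|exact: sigmaX_continuous].
apply: cvgM; last exact: sigmaX_continuous.
apply: cvgM; last exact: sigma'_continuous.
by apply: cvgM; [exact: cvg_cst|exact: cvg_id].
Qed.

Let g_derive x : is_derive x (1 : R) g (g' x).
Proof.
have ds : is_derive x (1 : R) sigma (sigma' x).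
  by rewrite derive1E; exact/derivableP.
have dv : is_derive x (1 : R) (fun y => (sigma y)^-1) (- (sigma x) ^- 2 * sigma' x).
  apply: DeriveDef; first exact: derivableV.
  rewrite (deriveV (sigma_neq0 x) (@sigma_derivable x)) derive1E.
  by rewrite /GRing.scale/=.
have -> : g = (2 \*: (id : R -> R)) * ((fun y => (sigma y)^-1) ^+ 2).
  by apply/funext => y; rewrite /g -exprVn.
apply: is_derive_eq; rewrite /g' /GRing.scale/=.
change (2 * x * (2 * (sigma x)^-1 ^+ 1 * (- sigma x ^- 2 * sigma' x)) +
  (sigma x)^-1 ^+ 2 * (2 * 1) = 2 / sigma x ^+ 2 - 4 * x * sigma' x / sigma x ^+ 3).
by field.
Qed.

(* [f] is [x |-> \int_0^x 2 y / sigma y ^ 2 dy] on [[- K - 1, K + 1]]; its image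
   under the generator of the diffusion is the constant [1]. *)
Lemma truncated_potential (K : R) : 0 < K ->
  exists f : R -> R, exists g g' : R -> R, exists Mf : R,
  [/\ measurable_fun setT f, f 0 = 0 & forall x, 0 <= f x <= Mf] /\
  [/\ forall x, `|x| <= K -> x ^+ 2 <= sigma0 ^+ 2 * f x,
      continuous g, continuous g',
      forall x, g x * (sigma x * sigma' x) + g' x / 2 * sigma x ^+ 2 = 1 &
      forall e, 0 < e -> exists2 C, 0 <= C & forall x y r, `|x| <= K ->
        f (x + (y + r)) - f x <= g x * (y + r) + g' x / 2 * y ^+ 2 +
          e * y ^+ 2 + C * (y ^+ 4 + r ^+ 2)].
Proof.
move=> K0.
(* The margin beyond K + 1 makes [G] differentiable up to the ends of the truncation interval. *)
have [G G0 dG] : exists2 G : R -> R, G 0 = 0 &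
    forall x, `|x| < K + 2 -> is_derive x (1 : R) G (g x).
  by apply: antiderivative => //; lra.
have dG' x : - (K + 1) <= x -> x <= K + 1 -> is_derive x (1 : R) G (g x).
  by move=> h1 h2; apply: dG; rewrite ltr_norml; apply/andP; split; lra.
have cG : {within `[- (K + 1), K + 1], continuous G}.
  apply: derivable_within_continuous => x; rewrite in_itv/= => /andP[h1 h2].
  by have [] := dG' _ h1 h2.
have s0 : 0 < sigma0 by exact: lt_le_trans (sigma_bounded 0).
have G_ge x : - (K + 1) <= x -> x <= K + 1 -> x ^+ 2 <= sigma0 ^+ 2 * G x.
  move=> h1 h2.
  (* Its derivative 2 z (sigma0^2 / sigma(z)^2 - 1) is z times a nonnegative factor, and the
     intermediate point is on the same side of 0 as x. *)
  pose psi z := sigma0 ^+ 2 * G z - z ^+ 2.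
  have [z|c [_ ]] := @MVT_between _ psi (fun z => sigma0 ^+ 2 * g z - 2 * z) 0 x.
    rewrite subr0 => zx.
    have : `|z| <= K + 1 by rewrite (le_trans zx)// ler_norml h1.
    rewrite ler_norml => /andP[z1 z2]; have dGz := dG' _ z1 z2.
    have -> : psi = (sigma0 ^+ 2 \*: G) - (fun z : R => z ^+ 2) by [].
    apply: is_derive_eq; congr (_ - _).
    by rewrite /GRing.scale/= mulr1 -mulr2n mulr_natl.
  rewrite subr0 add0r /psi G0 mulr0 expr0n/= !subr0 => cx e.
  rewrite -subr_ge0 e (_ : _ * x = 2 * (c * x) * (sigma0 ^+ 2 / sigma c ^+ 2 - 1)); last first.
    by rewrite /g; field.
  apply: mulr_ge0; first exact: mulr_ge0.
  rewrite subr_ge0 ler_pdivlMr ?exprn_gt0// mul1r.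
  by rewrite lerXn2r// nnegrE ltW.
(* Extension by zero keeps [f] bounded, measurable and nonnegative. The possible jumps are at
   distance 1 from [- K, K], where the expansion only needs bounds. *)
pose f := G \_ `[- (K + 1), K + 1].
have fE x : - (K + 1) <= x -> x <= K + 1 -> f x = G x.
  by move=> h1 h2; rewrite /f patchE mem_set//= in_itv/= h1 h2.
have f0 x : f x = 0 \/ [/\ - (K + 1) <= x, x <= K + 1 & f x = G x].
  rewrite /f patchE; case: ifPn; last by left.
  by move=> /set_mem/=; rewrite in_itv/= => /andP[h1 h2]; right.
have K11 : - (K + 1) <= K + 1 by lra.
have [c _ hc] := EVT_max K11 cG.
have f_itv x : 0 <= f x <= `|G c|.
  have [->|[h1 h2 ->]] := f0 x; first by rewrite lexx normr_ge0.
  apply/andP; split.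
    rewrite -(pmulr_rge0 _ (exprn_gt0 2 s0)).
    exact: le_trans (sqr_ge0 x) (G_ge _ h1 h2).
  by rewrite (le_trans _ (ler_norm _))// hc// in_itv/= h1 h2.
exists f, g, g', `|G c|; split; first split => //.
- apply/(measurable_restrictT _ _).1 => //.
  exact: subspace_continuous_measurable_fun.
- by rewrite fE//; lra.
split => //.
- move=> x; rewrite ler_norml => /andP[h1 h2].
  by rewrite fE; [apply: G_ge|..]; lra.
- by move=> x; rewrite /g /g'; field.
- move=> e e0; apply: (@taylor_truncated _ f g g' K `|G c|) => //.
    by move=> x; have /andP[h1 h2] := f_itv x; rewrite ger0_norm.
  move=> x xK; have xK' : `|x| < K + 2 by rewrite (lt_trans xK)// ltrD2l ltr1n.
  apply: (near_eq_is_derive _ (dG _ xK')).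
  have xI : x \in `](- (K + 1)), (K + 1)[ by rewrite in_itv/= -ltr_norml.
  apply: filterS (near_in_itvoo xI) => z; rewrite in_itv/= => /andP[z1 z2].
  by rewrite fE// ltW.
Qed.

End potential.

(** * The discrete Ito formula *)

Section one_step.
Context d (T : measurableType d) (R : realType) (P : probability T R).
Variables (F : R -> set (set T)) (B : R -> T -> R).
Hypotheses (hF : filtration F) (hB : brownian_motion P F B).
Variables (sigma b f g g' : R -> R) (sigma0 Mf K M l C : R).
Hypotheses (msigma : measurable_fun setT sigma) (mb : measurable_fun setT b).
Hypotheses (mf : measurable_fun setT f) (mg : measurable_fun setT g).
Hypothesis mg' : measurable_fun setT g'.
Hypothesis sigma_itv : forall x, 0 <= sigma x <= sigma0.
Hypothesis f_itv : forall x, 0 <= f x <= Mf.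
Hypotheses (gM : forall x, `|x| <= K -> `|g x| <= M)
  (g'M : forall x, `|x| <= K -> `|g' x| <= M)
  (bM : forall x, `|x| <= K -> `|b x| <= M).
Hypothesis generator : forall x, g x * b x + g' x / 2 * sigma x ^+ 2 = 1.
Hypotheses (M0 : 0 <= M) (l0 : 0 <= l) (C0 : 0 <= C).
Hypothesis taylor : forall x y r, `|x| <= K ->
  f (x + (y + r)) - f x <= g x * (y + r) + g' x / 2 * y ^+ 2 +
    l * y ^+ 2 + C * (y ^+ 4 + r ^+ 2).

Variables (s s' kap : R) (A A' W : set T) (x i be : T -> R).
Hypotheses (s0 : 0 <= s) (ss' : s <= s').
Local Notation h := (s' - s).
Let D w := B s' w - B s w.
Let Z w := i w - sigma (x w) * D w.
Hypotheses (mA : (F s).-sigma.-measurable A) (mA' : measurable A').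
Hypotheses (A'A : A' `<=` A) (mW : measurable W).
Hypotheses (mx : measurable_wrt (F s) x) (xK : forall w, A w -> `|x w| <= K).
Hypotheses (mi : measurable_fun setT i) (ii : L1 P (fun w => i w ^+ 2)).
Hypothesis i0 : forall (xi : T -> R) (N : R), measurable_wrt (F s) xi ->
  (forall w, `|xi w| <= N) -> \int[P]_w (xi w * i w) = 0.
Hypotheses (iZ : L1 P (fun w => Z w ^+ 2)) (EZ : \int[P]_w (Z w ^+ 2) <= kap).
Hypotheses (mbe : measurable_fun setT be) (beM : forall w, `|be w| <= M * h).
Hypothesis be_close : {ae P, forall w, A w ->
  `|be w - b (x w) * h| <= l * h + 2 * M * h * (\1_(~` W) w + (\1_A w - \1_A' w))}.

(** [A] and [A'] stand for confinement up to s and s'; [x], [i] and [be] for X at s, the Ito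
    increment and the clipped drift. The expansion is used with y = sigma(x) D and r = Z + be. The
    term g(x) i is centred, while g'(x) sigma(x)^2 D^2 / 2 and g(x) b(x) h contribute at most h in
    mean by [generator]. The rest is error: y^4, r^2, and the drift error, which is crude where [W]
    fails or confinement ends. P(A) - P(A') is kept because it telescopes over the steps. *)
Lemma one_step :
  \int[P]_w (\1_A w * (f (x w + (i w + be w)) - f (x w))) <=
  h * (1 + l * sigma0 ^+ 2) +
  M * (l * h + 2 * M * h * (fine (P (~` W)) + (fine (P A) - fine (P A')))) +
  2 * C * M ^+ 2 * h ^+ 2 +
  C * sigma0 ^+ 4 * (48 * expR (1 / 2) * h ^+ 2) + 2 * C * kap.
Proof.
have h0 : 0 <= h by rewrite subr_ge0.
have mA0 : measurable A.
  have [_ FT _] := hF.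
  by have := measurable_fun_sub_id (FT _ s0) measurableT mA; rewrite setTI.
have mx0 := filtration_measurable hF s0 mx.
have mD : measurable_fun setT D.
  by apply: measurable_funB; apply: (bm_measurable hF hB) => //; exact: le_trans ss'.
have m1A : measurable_wrt (F s) (\1_A : T -> R) by exact: measurable_indic.
have iA : L1 P (\1_A : T -> R) by exact: L1_indic.
have iA' : L1 P (\1_A' : T -> R) by exact: L1_indic.
have iW : L1 P (\1_(~` W) : T -> R) by apply: L1_indic; exact: measurableC.
have in1 (S : set T) w : S w -> \1_S w = 1 :> R by move=> Sw; rewrite indicE mem_set.
have in0 (S : set T) w : ~ S w -> \1_S w = 0 :> R by move=> Sw; rewrite indicE memNset.
have ge1 (S : set T) w : 0 <= \1_S w :> R by rewrite indicE.
pose xi w := \1_A w * g (x w).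
pose ze w := \1_A w * (g' (x w) / 2 * sigma (x w) ^+ 2 + l * sigma (x w) ^+ 2).
pose xb w := \1_A w * (g (x w) * b (x w)).
pose E1 w := l * h + 2 * M * h * (\1_(~` W) w + (\1_A w - \1_A' w)).
have mcomp (p : R -> R) : measurable_fun setT p -> measurable_wrt (F s) (p \o x).
  by move=> mp; exact: measurableT_comp mp mx.
have mxi : measurable_wrt (F s) xi by apply: measurable_funM => //; exact: mcomp.
have mze : measurable_wrt (F s) ze.
  apply: measurable_funM => //; apply: measurable_funD.
    apply: measurable_funM; last by apply: measurable_funX; exact: mcomp.
    by apply: measurable_funM; [exact: mcomp|exact: measurable_cst].
  apply: measurable_funM; first exact: measurable_cst.
  by apply: measurable_funX; exact: mcomp.
have mxb : measurable_wrt (F s) xb.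
  by apply: measurable_funM => //; apply: measurable_funM; exact: mcomp.
have sig2 y : sigma y ^+ 2 <= sigma0 ^+ 2.
  have /andP[s1 s2] := sigma_itv y.
  by rewrite lerXn2r// nnegrE// (le_trans s1).
have xiM w : `|xi w| <= M.
  rewrite /xi; have [Aw|Aw] := pselect (A w).
    by rewrite in1// mul1r; apply: gM; exact: xK.
  by rewrite in0// mul0r normr0.
have zeM w : `|ze w| <= M * sigma0 ^+ 2 + l * sigma0 ^+ 2.
  have Ml : 0 <= M * sigma0 ^+ 2 + l * sigma0 ^+ 2.
    by rewrite addr_ge0// mulr_ge0// sqr_ge0.
  rewrite /ze; have [Aw|Aw] := pselect (A w); last by rewrite in0// mul0r normr0.
  rewrite in1// mul1r (le_trans (ler_normD _ _))// lerD//.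
    rewrite normrM (ger0_norm (sqr_ge0 (sigma _))).
    apply: ler_pM => //; first exact: sqr_ge0.
    rewrite normrM (ger0_norm (_ : 0 <= 2^-1)) ?invr_ge0// ler_pdivrMr//.
    by rewrite (le_trans (g'M (xK Aw)))// ler_peMr// ler1n.
  rewrite ger0_norm; last by rewrite mulr_ge0// sqr_ge0.
  exact: ler_wpM2l.
have xbM w : `|xb w| <= M * M.
  rewrite /xb; have [Aw|Aw] := pselect (A w).
    by rewrite in1// mul1r normrM; apply: ler_pM => //; [apply: gM|apply: bM]; exact: xK.
  by rewrite in0// mul0r normr0 mulr_ge0.
have ixi : L1 P xi by apply: L1_bounded xiM; exact: filtration_measurable mxi.
have ize : L1 P ze by apply: L1_bounded zeM; exact: filtration_measurable mze.
have ixb : L1 P xb by apply: L1_bounded xbM; exact: filtration_measurable mxb.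
have ii1 : L1 P i.
  apply: (@le_L1 _ _ _ _ _ (fun w => 1 + i w ^+ 2)) => //.
    by apply: L1D => //; exact: L1_cst.
  by move=> w; rewrite ler_norml; apply/andP; split; nra.
have j1 : L1 P (fun w => xi w * i w).
  by apply: L1Ml xiM _ => //; exact: filtration_measurable mxi.
have j2 : L1 P (fun w => ze w * D w ^+ 2).
  exact: (L1M_increment_sqr hF hB s0 ss' mze ize).
have j3 : L1 P (fun w => h * xb w) by exact: L1Z.
have iE1 : L1 P E1.
  apply: L1D; first exact: L1_cst.
  by apply: L1Z; apply: L1D => //; exact: L1B.
have j4 : L1 P (fun w => M * E1 w) by exact: L1Z.
have j5 : L1 P (fun w => C * sigma0 ^+ 4 * D w ^+ 4).
  by apply: L1Z; exact: (bm_increment_expr4_L1 hF hB).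
have j6 : L1 P (fun w => 2 * C * Z w ^+ 2) by exact: L1Z.
have j12 := L1D j1 j2; have j123 := L1D j12 j3; have j1234 := L1D j123 j4.
have jc : L1 P (fun w => 2 * C * M ^+ 2 * h ^+ 2) by exact: L1_cst.
have j12345 := L1D (L1D j1234 jc) j5; have j := L1D j12345 j6.
apply: (@le_trans _ _ (\int[P]_w (xi w * i w + ze w * D w ^+ 2 + h * xb w +
    M * E1 w + 2 * C * M ^+ 2 * h ^+ 2 + C * sigma0 ^+ 4 * D w ^+ 4 +
    2 * C * Z w ^+ 2))).
  apply: ae_le_Exp => //.
    apply: (@L1_bounded _ _ _ _ _ (Mf + Mf)) => [|w].
      apply: measurable_funM; first exact: measurable_indic.
      apply: measurable_funB; last exact: measurableT_comp.
      by apply: measurableT_comp => //; apply: measurable_funD => //; exact: measurable_funD.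
    rewrite normrM -[leRHS]mul1r; apply: ler_pM => //.
      by rewrite indicE; case: (_ \in _); rewrite ?normr1 ?normr0.
    rewrite (le_trans (ler_normB _ _))//.
    have fn y : `|f y| <= Mf by have /andP[f0 fM] := f_itv y; rewrite ger0_norm.
    exact: lerD.
  apply: filterS be_close => w hbe.
  have Z0 : 0 <= 2 * C * Z w ^+ 2 by apply: mulr_ge0; [exact: mulr_ge0|exact: sqr_ge0].
  have D40 : 0 <= D w ^+ 4 by rewrite exprn_even_ge0.
  have s40 : 0 <= sigma0 ^+ 4 by rewrite exprn_even_ge0.
  have C40 : 0 <= C * sigma0 ^+ 4 * D w ^+ 4 by rewrite mulr_ge0// mulr_ge0.
  have CM0 : 0 <= 2 * C * M ^+ 2 * h ^+ 2.
    by apply: mulr_ge0; [apply: mulr_ge0; [exact: mulr_ge0|]|]; exact: sqr_ge0.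
  have A'1 : \1_A' w <= \1_A w :> R.
    have [/[dup] A'w /A'A Aw|A'w] := pselect (A' w); first by rewrite !in1.
    by rewrite in0.
  have E10 : 0 <= E1 w.
    rewrite /E1 addr_ge0//; first exact: mulr_ge0.
    apply: mulr_ge0; first by apply: mulr_ge0 => //; exact: mulr_ge0.
    by rewrite addr_ge0// subr_ge0.
  (* Outside [A] the left side vanishes and only nonnegative error terms remain on the right. *)
  have [Aw|Aw] := pselect (A w); last first.
    rewrite /xi /ze /xb in0// !mul0r mulr0 !add0r.
    by rewrite !addr_ge0// mulr_ge0.
  have {hbe} := hbe Aw; rewrite -/(E1 w) => hbe.
  have xKw := xK Aw.
  have t1 := taylor (sigma (x w) * D w) (Z w + be w) xKw.
  have yr : sigma (x w) * D w + (Z w + be w) = i w + be w by rewrite /Z; ring.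
  rewrite yr in t1.
  rewrite /xi /ze /xb in1// !mul1r.
  have y4 : (sigma (x w) * D w) ^+ 4 <= sigma0 ^+ 4 * D w ^+ 4.
    rewrite exprMn ler_wpM2r//; have /andP[s1 s2] := sigma_itv (x w).
    by rewrite lerXn2r// nnegrE// (le_trans s1).
  have be2 : be w ^+ 2 <= M ^+ 2 * h ^+ 2.
    rewrite -exprMn -[leLHS]real_normK ?num_real// lerXn2r// nnegrE//.
    exact: mulr_ge0.
  have r2 : (Z w + be w) ^+ 2 <= 2 * Z w ^+ 2 + 2 * (M ^+ 2 * h ^+ 2).
    by have := sqr_ge0 (Z w - be w); nra.
  have gb : g (x w) * (be w - b (x w) * h) <= M * E1 w.
    rewrite (le_trans (ler_norm _))// normrM; apply: ler_pM => //.
    exact: gM.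
  have q1 := ler_wpM2l C0 (lerD y4 r2).
  apply: (le_trans t1).
  rewrite exprMn in t1 *.
  set G := g (x w) in gb *; set S := sigma (x w) ^+ 2.
  move: q1 gb; rewrite exprMn.
  set D2 := D w ^+ 2; set D4 := D w ^+ 4; set S4 := sigma (x w) ^+ 4.
  set r := (Z w + be w) ^+ 2; set Z2 := Z w ^+ 2.
  set MM := M ^+ 2; set HH := h ^+ 2; set s4 := sigma0 ^+ 4; nra.
rewrite (ExpD j12345 j6) (ExpD (L1D j1234 jc) j5) (ExpD j1234 jc) (ExpD j123 j4).
rewrite (ExpD j12 j3) (ExpD j1 j2) (i0 mxi xiM) add0r.
rewrite (ExpM_increment_sqr hF hB s0 ss' mze ize) (ExpZ _ ixb) Exp_cst.
rewrite (ExpZ _ iE1) (ExpZ _ iZ) (ExpZ _ (bm_increment_expr4_L1 hF hB s0 ss')).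
have EE1 : \int[P]_w E1 w =
    l * h + 2 * M * h * (fine (P (~` W)) + (fine (P A) - fine (P A'))).
  rewrite ExpD; [|exact: L1_cst|]; last by apply: L1Z; apply: L1D => //; exact: L1B.
  rewrite Exp_cst ExpZ; last by apply: L1D => //; exact: L1B.
  rewrite ExpD//; last exact: L1B.
  by rewrite ExpB// !Exp_indic//; exact: measurableC.
rewrite EE1.
have Ezx : \int[P]_w ze w + \int[P]_w xb w <= 1 + l * sigma0 ^+ 2.
  rewrite -ExpD// -[leRHS](Exp_cst P); apply: le_Exp => //.
  - exact: L1D.
  - exact: L1_cst.
  - move=> w; rewrite /ze /xb -mulrDr.
    have c0 : 0 <= 1 + l * sigma0 ^+ 2 by rewrite addr_ge0// mulr_ge0// sqr_ge0.
    have [Aw|Aw] := pselect (A w); last by rewrite in0// mul0r.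
    rewrite in1// mul1r addrAC [X in X + _]addrC generator lerD2l.
    by rewrite ler_wpM2l.
have q1 : \int[P]_w ze w * h + h * \int[P]_w xb w <= h * (1 + l * sigma0 ^+ 2).
  by rewrite (mulrC _ h) -mulrDr ler_wpM2l.
have q2 := bm_increment_Exp_expr4 hF hB s0 ss'.
have q3 : C * sigma0 ^+ 4 * \int[P]_w (D w ^+ 4) <=
    C * sigma0 ^+ 4 * (48 * expR (1 / 2) * h ^+ 2).
  by rewrite ler_wpM2l// mulr_ge0// exprn_even_ge0.
have q4 : 2 * C * \int[P]_w (Z w ^+ 2) <= 2 * C * kap.
  by rewrite ler_wpM2l// mulr_ge0.
lra.
Qed.

End one_step.

(** Used with c = 0, to see that the clipping of the drift is inactive, and with c the drift at the
    left endpoint, to compare the drift with its Euler approximation. *)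
Lemma path_integral_increment (R : realType) (phi : R -> R) (s s' c kap : R) :
  {within `[0, +oo[, continuous phi} -> 0 <= s -> s <= s' ->
  (forall r, s <= r -> r <= s' -> `|phi r - c| <= kap) ->
  `|\int[lebesgue_measure]_(r in `[0, s']) phi r -
    \int[lebesgue_measure]_(r in `[0, s]) phi r - c * (s' - s)| <=
  kap * (s' - s).
Proof.
move=> cphi s0 ss' hphi.
have int0s' (psi : R -> R) : {within `[0, +oo[, continuous psi} ->
    lebesgue_measure.-integrable `[0, s'] (EFin \o psi).
  move=> cpsi; apply: continuous_compact_integrable; first exact: segment_compact.
  by apply: continuous_subspaceW cpsi => r; rewrite /= !in_itv/= => /andP[->].
have intss' (psi : R -> R) : {within `[0, +oo[, continuous psi} ->
    lebesgue_measure.-integrable `]s, s'] (EFin \o psi).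
  move=> /int0s'; apply: integrableS => // r; rewrite /= !in_itv/= => /andP[sr ->].
  by rewrite (le_trans s0 (ltW sr)).
have iphi := int0s' _ cphi; have iphi' := intss' _ cphi.
have icst k : lebesgue_measure.-integrable `]s, s'] (EFin \o cst k).
  by apply: intss'; apply: continuous_subspaceT => r; exact: cvg_cst.
rewrite Rintegral_itvB ?bnd_simp//.
have mu_ss' : fine (lebesgue_measure `]s, s']) = s' - s.
  rewrite lebesgue_measure_itv/= lte_fin; have [//|h] := ltP s s'.
  by apply/eqP; rewrite eq_sym subr_eq0 eq_le h ss'.
have -> : c * (s' - s) = \int[lebesgue_measure]_(r in `]s, s']) c.
  by rewrite Rintegral_cst// mu_ss'.
rewrite -RintegralB//; last exact: icst.
have iB : lebesgue_measure.-integrable `]s, s'] (EFin \o (fun r => phi r - c)).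
  by apply: intss' => r; apply: cvgB; [exact: cphi|exact: cvg_cst].
apply: (le_trans (le_normr_Rintegral _ iB)) => //.
have -> : kap * (s' - s) = \int[lebesgue_measure]_(r in `]s, s']) kap.
  by rewrite Rintegral_cst// mu_ss'.
apply: le_Rintegral => //; [exact: integrable_norm|exact: icst|].
by move=> r; rewrite /= in_itv/= => /andP[/ltW sr rs']; exact: hphi.
Qed.

Section composition_with_process.
Context d (T : measurableType d) (R : realType).
Variables (F : R -> set (set T)) (X : R -> T -> R) (p : R -> R).
Hypothesis cp : continuous p.

Lemma adapted_comp : adapted F X -> adapted F (fun s w => p (X s w)).
Proof.
move=> aX s s0; have mp : measurable_fun setT p by exact: continuous_measurable_fun.
exact: measurableT_comp mp (aX s s0).
Qed.

Lemma continuous_paths_comp :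
  continuous_paths X -> continuous_paths (fun s w => p (X s w)).
Proof.
move=> cX w x; apply: continuous_comp; first exact: cX.
exact: cp.
Qed.

End composition_with_process.

(** * The localized bound along an Euler mesh *)

Section euler_scheme.
Context d (T : measurableType d) (R : realType) (P : probability T R).
Variables (F : R -> set (set T)) (B : R -> T -> R).
Hypotheses (hF : filtration F) (hB : brownian_motion P F B).
Variables (sigma : R -> R) (sigma0 : R).
Hypothesis sigma_gt0 : forall x : R, 0 < sigma x.
Hypothesis sigma_derivable : forall x : R, derivable sigma x 1.
Hypothesis sigma'_lipschitz : locally_lipschitz (sigma^`())%classic.
Hypothesis sigma_bounded : forall x : R, sigma x <= sigma0.
Local Notation b := (fun x => sigma x * (sigma^`())%classic x).
Variable X : R -> T -> R.
Hypothesis hX : sde_solution P F B sigma b 0 X.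

Let aX : adapted F X. Proof. by case: hX. Qed.
Let cX : continuous_paths X. Proof. by case: hX. Qed.

Let csigma : continuous sigma. Proof. exact: sigma_continuous. Qed.

Let cb : continuous b.
Proof.
by move=> x; apply: cvgM; [exact: csigma|exact: sigma'_continuous].
Qed.

Let H s w := sigma (X s w).
Let bX s w := b (X s w).
Let aH : adapted F H. Proof. exact: adapted_comp. Qed.
Let cH : continuous_paths H. Proof. exact: continuous_paths_comp. Qed.
Let abX : adapted F bX. Proof. exact: adapted_comp. Qed.
Let cbX : continuous_paths bX. Proof. exact: continuous_paths_comp. Qed.

Let HC s w : `|H s w| <= sigma0.
Proof. by rewrite /H gtr0_norm. Qed.

Let sigma00 : 0 < sigma0.
Proof. exact: lt_le_trans (sigma_bounded 0). Qed.

Let mX s : 0 <= s -> measurable_fun setT (X s).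
Proof. exact: (adapted_measurable hF aX). Qed.

Variables (t K : R).
Hypotheses (t0 : 0 < t) (K0 : 0 < K).

(** Replaces a stopping time: the event belongs to the past of s and decreases as s grows. *)
Definition confined s := [set w | forall r, 0 <= r -> r <= s -> `|X r w| <= K].

Let confined_wrt s : 0 <= s -> (F s).-sigma.-measurable (confined s).
Proof. exact: (path_sup_measurable hF aX cX). Qed.

Let mconfined s : 0 <= s -> measurable (confined s).
Proof.
move=> s0; have [_ FT _] := hF.
by have := measurable_fun_sub_id (FT _ s0) measurableT (confined_wrt s0); rewrite setTI.
Qed.

Let confinedS s s' : s <= s' -> confined s' `<=` confined s.
Proof. by move=> ss' w h r r0 rs; apply: h => //; exact: le_trans ss'. Qed.

Section fixed_mesh.
Variables (f g g' : R -> R) (Mf M l C q : R) (m n1 n2 : nat) (W1 W2 : set T).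
Hypotheses (mf : measurable_fun setT f) (f00 : f 0 = 0).
Hypothesis f_itv : forall x, 0 <= f x <= Mf.
Hypotheses (cg : continuous g) (cg' : continuous g').
Hypotheses (gM : forall x, `|x| <= K -> `|g x| <= M)
  (g'M : forall x, `|x| <= K -> `|g' x| <= M)
  (bM : forall x, `|x| <= K -> `|b x| <= M).
Hypothesis generator : forall x, g x * b x + g' x / 2 * sigma x ^+ 2 = 1.
Hypotheses (M0 : 0 <= M) (l0 : 0 < l) (C0 : 0 <= C) (q0 : 0 < q).
Hypothesis taylor : forall x y r, `|x| <= K ->
  f (x + (y + r)) - f x <= g x * (y + r) + g' x / 2 * y ^+ 2 +
    l * y ^+ 2 + C * (y ^+ 4 + r ^+ 2).
Local Notation h := (t / m.+1%:R).
Hypotheses (mW1 : measurable W1) (PW1 : fine (P (~` W1)) <= l).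
Hypotheses (mW2 : measurable W2) (PW2 : fine (P (~` W2)) <= q).
Hypothesis W1P : forall w, W1 w -> forall s s', 0 <= s -> s <= t ->
  0 <= s' -> s' <= t -> `|s - s'| <= n1.+1%:R^-1 -> `|bX s w - bX s' w| <= l.
Hypothesis W2P : forall w, W2 w -> forall s s', 0 <= s -> s <= t ->
  0 <= s' -> s' <= t -> `|s - s'| <= n2.+1%:R^-1 -> `|H s w - H s' w| <= q.
Hypotheses (hn1 : h <= n1.+1%:R^-1) (hn2 : h <= n2.+1%:R^-1).
Hypotheses (q1 : q <= 1) (Cq : C * (q * (1 + 4 * sigma0 ^+ 2)) <= l).
Hypotheses (hl : h <= l) (Chl : C * h <= l).

Let h0 : 0 < h. Proof. by rewrite divr_gt0. Qed.

Let time_ge0 k : 0 <= k%:R * h.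
Proof. by rewrite mulr_ge0// ltW. Qed.

Let timeS k : k.+1%:R * h - k%:R * h = h.
Proof. by rewrite -mulrBl -natrB// subSnn mul1r. Qed.

Let time_le k : k%:R * h <= k.+1%:R * h.
Proof. by rewrite ler_pM2r// ler_nat. Qed.

Let time_max : m.+1%:R * h = t.
Proof. by rewrite mulrC divfK. Qed.

Let time_let k : (k <= m.+1)%N -> k%:R * h <= t.
Proof. by move=> km; rewrite -{2}time_max ler_pM2r// ler_nat. Qed.

Variable I : nat -> T -> R.
Hypothesis hI : forall k, ito_integral P F B H (k%:R * h) (I k).
Hypothesis XI : forall k, {ae P, forall w, X (k%:R * h) w = X 0 w + I k w +
  \int[lebesgue_measure]_(s in `[0, k%:R * h]) bX s w}.

Let x k := X (k%:R * h).
Let A k := confined (k%:R * h).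
Let i k w := I k.+1 w - I k w.
(* The drift part of the increment, clipped so as to be bounded for every [w];
   the clipping has no effect as long as [X] stays in [[- K, K]]. *)
Let be k w := Num.max (- (M * h)) (Num.min (x k.+1 w - x k w - i k w) (M * h)).

Let Mh0 : 0 <= M * h. Proof. by rewrite mulr_ge0// ltW. Qed.

Let beM k w : `|be k w| <= M * h.
Proof.
rewrite /be ler_norml le_max lexx/= ge_max ge_min lexx orbT andbT.
by rewrite -subr_ge0 opprK addr_ge0.
Qed.

Let be_id k w : `|x k.+1 w - x k w - i k w| <= M * h ->
  be k w = x k.+1 w - x k w - i k w.
Proof. by rewrite ler_norml /be => /andP[h1 /min_idPl ->]; apply/max_idPr. Qed.

Let drift : {ae P, forall w, forall k, x k.+1 w - x k w - i k w =
  \int[lebesgue_measure]_(s in `[0, k.+1%:R * h]) bX s w -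
  \int[lebesgue_measure]_(s in `[0, k%:R * h]) bX s w}.
Proof.
have : {ae P, forall w, forall k, X (k%:R * h) w = X 0 w + I k w +
    \int[lebesgue_measure]_(s in `[0, k%:R * h]) bX s w}.
  exact/ae_foralln.
apply: filterS => w hw k; rewrite /x /i (hw k.+1) (hw k); ring.
Qed.

Let confined_drift k w : A k.+1 w ->
  x k.+1 w - x k w - i k w =
  \int[lebesgue_measure]_(s in `[0, k.+1%:R * h]) bX s w -
  \int[lebesgue_measure]_(s in `[0, k%:R * h]) bX s w ->
  be k w = x k.+1 w - x k w - i k w.
Proof.
move=> Aw e; apply: be_id; rewrite e.
have := @path_integral_increment _ (bX ^~ w) (k%:R * h) (k.+1%:R * h) 0 M
  (@cbX w) (time_ge0 k) (time_le k).
rewrite timeS mul0r !subr0; apply => r r1 r2; rewrite subr0.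
by apply: bM; apply: Aw => //; exact: le_trans r1.
Qed.

(* The sum telescopes up to the exit time; the last term may overshoot
   [[- K, K]], but [f >= 0] makes its value irrelevant. *)
Let scheme_lower_bound : {ae P, forall w, \1_(confined t) w * f (X t w) <=
  \sum_(k < m.+1) \1_(A k) w * (f (x k w + (i k w + be k w)) - f (x k w))}.
Proof.
have X0 : {ae P, forall w, X 0 w = 0} by case: hX.
apply: filterS2 X0 drift => w X0w dw.
have in1 (S : set T) : S w -> \1_S w = 1 :> R by move=> Sw; rewrite indicE mem_set.
have in0 (S : set T) : ~ S w -> \1_S w = 0 :> R by move=> Sw; rewrite indicE memNset.
pose S n := \sum_(k < n) \1_(A k) w * (f (x k w + (i k w + be k w)) - f (x k w)).
have fge y : 0 <= f y by have /andP[] := f_itv y.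
suff [h1 h2] : (A m.+1 w -> S m.+1 = f (x m.+1 w)) /\ (~ A m.+1 w -> 0 <= S m.+1).
  rewrite -/(S m.+1) -time_max -/(x m.+1) -/(A m.+1).
  have [Aw|Aw] := pselect (A m.+1 w); first by rewrite in1// mul1r h1.
  by rewrite in0// mul0r h2.
elim: m.+1 => [|n [IH1 IH2]].
  rewrite /S big_ord0; split => // _.
  by rewrite /x mul0r X0w f00.
rewrite /S big_ord_recr/= -/(S n); split => [An1|An1].
  have An : A n w by apply: confinedS An1.
  rewrite IH1// in1// mul1r (confined_drift An1)// addrC subrK; congr f; ring.
have [An|An] := pselect (A n w); last by rewrite in0// mul0r addr0 IH2.
by rewrite IH1// in1// mul1r addrC subrK.
Qed.

Let mI k : measurable_fun setT (I k). Proof. by case: (hI k). Qed.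

Let mi k : measurable_fun setT (i k). Proof. exact: measurable_funB. Qed.

Let mbe k : measurable_fun setT (be k).
Proof.
apply: measurable_maxr => //; apply: measurable_minr => //.
by apply: measurable_funB => //; apply: measurable_funB; exact: mX.
Qed.

(** On confined paths of [W1] the drift varies by at most l during the step. If the path leaves
    [- K, K] in this step or lies outside [W1], each of the two compared terms is at most M h. *)
Let be_close k : (k < m.+1)%N -> {ae P, forall w, A k w ->
  `|be k w - b (x k w) * (k.+1%:R * h - k%:R * h)| <=
  l * (k.+1%:R * h - k%:R * h) + 2 * M * (k.+1%:R * h - k%:R * h) *
    (\1_(~` W1) w + (\1_(A k) w - \1_(A k.+1) w))}.
Proof.
move=> km; rewrite timeS; apply: filterS drift => w dw Aw.
have in1 (S : set T) : S w -> \1_S w = 1 :> R by move=> Sw; rewrite indicE mem_set.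
have in0 (S : set T) : ~ S w -> \1_S w = 0 :> R by move=> Sw; rewrite indicE memNset.
have xK : `|x k w| <= K by apply: Aw.
have crude : `|be k w - b (x k w) * h| <= 2 * M * h.
  rewrite (le_trans (ler_normB _ _))// mulr2n !mulrDl mul1r lerD//.
  by rewrite normrM (gtr0_norm h0) ler_pM2r// bM.
have lh0 : 0 <= l * h by rewrite mulr_ge0// ltW.
rewrite (in1 _ Aw); have [Aw'|Aw'] := pselect (A k.+1 w); last first.
  rewrite (in0 _ Aw') subr0; have [W1w|W1w] := pselect (W1 w).
    by rewrite in0 ?add0r ?mulr1 ?(le_trans crude)// ?lerDr//; apply.
  have Mh : 0 <= 2 * M * h by apply: mulr_ge0; [exact: mulr_ge0|exact: ltW].
  by rewrite in1// (le_trans crude)// mulrDr mulr1 addrA lerDr addr_ge0.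
rewrite (in1 _ Aw') subrr addr0; have [W1w|W1w] := pselect (W1 w); last first.
  by rewrite in1// mulr1 (le_trans crude)// lerDr.
rewrite in0 ?mulr0 ?addr0; last by apply.
rewrite (confined_drift Aw')// dw.
have := @path_integral_increment _ (bX ^~ w) (k%:R * h) (k.+1%:R * h) (b (x k w)) l
  (@cbX w) (time_ge0 k) (time_le k).
rewrite timeS; apply => r r1 r2; apply: W1P => //.
- exact: le_trans r1.
- exact: le_trans (time_let km).
- exact: time_let (ltnW km).
- rewrite ger0_norm ?subr_ge0// (le_trans _ hn1)//.
  by rewrite lerBlDl (le_trans r2)// -lerBlDl timeS.
Qed.

(** The variation of [H] is at most q on [W2] and at most 2 sigma0 elsewhere, which gives q^2 + 4
    sigma0^2 q; then q <= 1. *)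
Let kappaP k : (k < m.+1)%N -> forall r, k%:R * h <= r -> r <= k.+1%:R * h ->
  \int[P]_w ((H r w - H (k%:R * h) w) ^+ 2) <= q * (1 + 4 * sigma0 ^+ 2).
Proof.
move=> km r r1 r2; have r0 : 0 <= r by exact: le_trans r1.
have mHH : measurable_fun setT (fun w => H r w - H (k%:R * h) w).
  by apply: measurable_funB; apply: (adapted_measurable hF aH).
have bnd w : `|H r w - H (k%:R * h) w| <= 2 * sigma0.
  by rewrite (le_trans (ler_normB _ _))// mulr2n mulrDl mul1r lerD.
have sqb w : (H r w - H (k%:R * h) w) ^+ 2 <= 4 * sigma0 ^+ 2.
  rewrite -[leLHS]real_normK ?num_real// (_ : 4 * _ = (2 * sigma0) ^+ 2); last by ring.
  by rewrite lerXn2r// nnegrE// mulr_ge0// ltW.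
have iW : L1 P (\1_(~` W2) : T -> R) by apply: L1_indic; exact: measurableC.
apply: (@le_trans _ _ (\int[P]_w (q ^+ 2 + 4 * sigma0 ^+ 2 * \1_(~` W2) w))).
  apply: le_Exp.
  - apply: (@L1_bounded _ _ _ _ _ (4 * sigma0 ^+ 2)); first exact: measurable_funX.
    by move=> w; rewrite ger0_norm ?sqr_ge0.
  - by apply: L1D; [exact: L1_cst|exact: L1Z].
  - move=> w; rewrite indicE; have [/set_mem W2w|W2w] := boolP (w \in ~` W2).
      by rewrite mulr1 (le_trans (sqb w))// lerDr sqr_ge0.
    rewrite mulr0 addr0 -[leLHS]real_normK ?num_real// lerXn2r// ?nnegrE ?(ltW q0)//.
    have {}W2w : W2 w by apply: contrapT => h'; case/negP: W2w; exact/mem_set.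
    apply: W2P => //.
    + exact: le_trans (time_let km).
    + exact: time_let (ltnW km).
    + rewrite ger0_norm ?subr_ge0// (le_trans _ hn2)//.
      by rewrite lerBlDl (le_trans r2)// -lerBlDl timeS.
rewrite ExpD; [|exact: L1_cst|exact: L1Z].
rewrite Exp_cst ExpZ// Exp_indic; last exact: measurableC.
have qq : q ^+ 2 <= q by rewrite expr2 ler_piMr// ltW.
have s2 : 0 <= 4 * sigma0 ^+ 2 by rewrite mulr_ge0// sqr_ge0.
by have := ler_wpM2l s2 PW2; lra.
Qed.

(** Collects the coefficients of h l in [one_step]: in 4 M^2, one half comes from the complement of
    [W1] and one from C h <= l; the final 4 is 2 from [ito_increment_sqr] times 2 from the square of
    r. *)
Let Q1 := sigma0 ^+ 2 + M + 4 * M ^+ 2 + sigma0 ^+ 4 * (48 * expR (1 / 2)) + 4.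

Let step_bound k : (k < m.+1)%N ->
  \int[P]_w (\1_(A k) w * (f (x k w + (i k w + be k w)) - f (x k w))) <=
  h + h * l * Q1 + 2 * M ^+ 2 * h * (fine (P (A k)) - fine (P (A k.+1))).
Proof.
move=> km.
have mH0 : measurable_wrt (F (k%:R * h)) (H (k%:R * h)) by exact: aH.
(* With [theta] zero, the crude constant sigma0^2 is enough: only integrability and the zero mean
   are extracted. *)
have m0 : measurable_wrt (F (k%:R * h)) (cst 0 : T -> R) by exact: measurable_cst.
have b0 (w : T) : `|(cst 0 : T -> R) w| <= sigma0 by rewrite normr0 ltW.
have k0 r : k%:R * h <= r -> r <= k.+1%:R * h ->
    \int[P]_w ((H r w - (cst 0 : T -> R) w) ^+ 2) <= sigma0 ^+ 2.
  move=> r1 r2; have r0 : 0 <= r by exact: le_trans r1.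
  rewrite -[leRHS](Exp_cst P).
  have sq w : (H r w - (cst 0 : T -> R) w) ^+ 2 <= sigma0 ^+ 2.
    by rewrite subr0 -[leLHS]real_normK ?num_real// lerXn2r// nnegrE// ltW.
  apply: le_Exp => //; last exact: L1_cst.
  apply: (@L1_bounded _ _ _ _ _ (sigma0 ^+ 2)).
    apply: measurable_funX; apply: measurable_funB => //.
    exact: (adapted_measurable hF aH).
  by move=> w; rewrite ger0_norm ?sqr_ge0.
have zE : (fun w => I k.+1 w - I k w - (cst 0 : T -> R) w *
    (B (k.+1%:R * h) w - B (k%:R * h) w)) = i k.
  by apply/funext => w; rewrite /= mul0r subr0.
have [ii _] := ito_increment_sqr hF hB aH cH HC h0 hI m0 b0 k0.
have i0 := @Exp_mul_ito_increment _ _ _ _ _ _ hF hB _ _ aH cH HC _ _ h0 hI k _ _ m0 b0 k0.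
have [iZ EZ] := ito_increment_sqr hF hB aH cH HC h0 hI mH0 (HC _) (kappaP km).
have sig_itv y : 0 <= sigma y <= sigma0 by rewrite ltW/=.
have mp (p : R -> R) : continuous p -> measurable_fun setT p.
  exact: continuous_measurable_fun.
have ii' : L1 P (fun w => i k w ^+ 2).
  move: ii; congr (integrable _ _ _); apply/funext => w /=.
  by rewrite mul0r subr0.
have i0' (xi : T -> R) N : measurable_wrt (F (k%:R * h)) xi ->
    (forall w, `|xi w| <= N) -> \int[P]_w (xi w * i k w) = 0.
  move=> mxi xiN; rewrite -[RHS](i0 _ _ mxi xiN).
  by apply: eq_Rintegral => w _; rewrite /= mul0r subr0.
have beM' w : `|be k w| <= M * (k.+1%:R * h - k%:R * h) by rewrite timeS.
have := one_step hF hB (mp _ csigma) (mp _ cb) mf (mp _ cg) (mp _ cg') sig_itv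
  f_itv gM g'M bM generator M0 (ltW l0) C0 taylor (time_ge0 k) (time_le k)
  (confined_wrt (time_ge0 k)) (mconfined (time_ge0 k.+1)) (confinedS (time_le k))
  mW1 (aX (time_ge0 k)) _ (mi k) ii' i0' iZ EZ (mbe k) beM' (be_close km).
rewrite timeS; move=> /(_ (fun w Aw => Aw _ (time_ge0 k) (lexx _)))/le_trans; apply.
have z1 : 0 <= 2 * M ^+ 2 * h.
  by apply: mulr_ge0; [apply: mulr_ge0 => //; exact: sqr_ge0|exact: ltW].
have z2 : 0 <= sigma0 ^+ 4 * (48 * expR (1 / 2)) * h.
  apply: mulr_ge0; last exact: ltW.
  by rewrite mulr_ge0 ?exprn_even_ge0// mulr_ge0// expR_ge0.
have z3 : 0 <= 4 * h by rewrite mulr_ge0// ltW.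
have := ler_wpM2l z1 PW1; have := ler_wpM2l z1 Chl; have := ler_wpM2l z2 Chl.
have := ler_wpM2l z3 Cq; rewrite /Q1 -/(A k) -/(A k.+1).
move: (fine (P (~` W1))) (fine (P (A k))) (fine (P (A k.+1))) => pW pA pA'.
move: (48 * expR (1 / 2)) (q * (1 + 4 * sigma0 ^+ 2)) => e kap.
move: (t / m.+1%:R) (sigma0 ^+ 4) (sigma0 ^+ 2) => hh s4 s2; nra.
Qed.

(** The m + 1 terms h add up to t, and the exit probabilities telescope to at most 1, so their
    contribution is 2 M^2 h <= 2 M^2 l. *)
Lemma scheme_upper_bound :
  \int[P]_w (\1_(confined t) w * f (X t w)) <=
  t + (t * Q1 + 2 * M ^+ 2) * l.
Proof.
have iterm k : L1 P (fun w =>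
    \1_(A k) w * (f (x k w + (i k w + be k w)) - f (x k w))).
  apply: (@L1_bounded _ _ _ _ _ (Mf + Mf)) => [|w].
    apply: measurable_funM; first by apply: measurable_indic; exact: mconfined.
    apply: measurable_funB; apply: measurableT_comp => //; last exact: mX.
    by apply: measurable_funD; [exact: mX|exact: measurable_funD].
  rewrite normrM -[leRHS]mul1r; apply: ler_pM => //.
    by rewrite indicE; case: (_ \in _); rewrite ?normr1 ?normr0.
  rewrite (le_trans (ler_normB _ _))//.
  have fn y : `|f y| <= Mf by have /andP[fp fM] := f_itv y; rewrite ger0_norm.
  exact: lerD.
apply: (@le_trans _ _ (\int[P]_w \sum_(k < m.+1)
    (\1_(A k) w * (f (x k w + (i k w + be k w)) - f (x k w))))).
  apply: ae_le_Exp scheme_lower_bound; last first.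
    exact: (L1_sum (f := fun k w =>
      \1_(A k) w * (f (x k w + (i k w + be k w)) - f (x k w)))).
  apply: (@L1_bounded _ _ _ _ _ Mf) => [|w].
    apply: measurable_funM; first by apply: measurable_indic; apply: mconfined; exact: ltW.
    by apply: measurableT_comp => //; apply: mX; exact: ltW.
  rewrite normrM -[leRHS]mul1r; apply: ler_pM => //.
    by rewrite indicE; case: (_ \in _); rewrite ?normr1 ?normr0.
  by have /andP[fp fM] := f_itv (X t w); rewrite ger0_norm.
rewrite (Exp_sum (f := fun k w =>
  \1_(A k) w * (f (x k w + (i k w + be k w)) - f (x k w))))//.
apply: (@le_trans _ _ (\sum_(k < m.+1) (h + h * l * Q1 +
    2 * M ^+ 2 * h * (fine (P (A k)) - fine (P (A k.+1)))))).
  by apply: ler_sum => k _; exact: step_bound.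
rewrite big_split/= -mulr_sumr sumr_const card_ord -[X in X + _]mulr_natl.
rewrite -(big_mkord xpredT (fun k => fine (P (A k)) - fine (P (A k.+1)))).
have -> : \sum_(0 <= k < m.+1) (fine (P (A k)) - fine (P (A k.+1))) =
    fine (P (A 0%N)) - fine (P (A m.+1)).
  rewrite -[RHS]opprB -(telescope_sumr (fun k => fine (P (A k))))// -sumrN.
  by apply: eq_bigr => k _; rewrite opprB.
have -> : m.+1%:R * (h + h * l * Q1) = t + t * l * Q1.
  have -> : h + h * l * Q1 = h * (1 + l * Q1) by ring.
  by rewrite mulrA time_max; ring.
have PA0 : fine (P (A 0%N)) <= 1.
  rewrite -lee_fin fineK ?fin_num_measure//; last exact: mconfined.
  by apply: probability_le1; exact: mconfined.
have PAm := Pr_ge0 P (A m.+1).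
have z1 : 0 <= 2 * M ^+ 2 * h.
  by apply: mulr_ge0; [apply: mulr_ge0 => //; exact: sqr_ge0|exact: ltW].
have z2 : 0 <= 2 * M ^+ 2 by apply: mulr_ge0 => //; exact: sqr_ge0.
have w1 : fine (P (A 0%N)) - fine (P (A m.+1)) <= 1 by lra.
have := ler_wpM2l z1 w1; have := ler_wpM2l z2 hl.
move: (fine (P (A 0%N)) - fine (P (A m.+1))) (2 * M ^+ 2) => pp mm.
move: (t / m.+1%:R) Q1 => hh qq; lra.
Qed.

End fixed_mesh.

(** The order of choices avoids circularity: K determines f and M, then l determines C, then q is
    chosen from C and l, then the path moduli, and the mesh comes last. *)
Lemma confined_second_moment :
  \int[P]_w (\1_(confined t) w * X t w ^+ 2) <= sigma0 ^+ 2 * t.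
Proof.
have [f [g [g' [Mf [[mf f00 f_itv] [f_ge cg cg' gen taylor]]]]]] :=
  truncated_potential sigma_gt0 sigma_derivable sigma'_lipschitz sigma_bounded K0.
have KK : - K <= K by rewrite (le_trans _ (ltW K0))// oppr_le0 ltW.
have [M1 M10 hM1] := continuous_segment_bounded KK cg.
have [M2 M20 hM2] := continuous_segment_bounded KK cg'.
have [M3 M30 hM3] := continuous_segment_bounded KK cb.
pose M := M1 + M2 + M3; have M0 : 0 <= M by rewrite /M; lra.
have le_M (p : R -> R) Mp : Mp <= M ->
    (forall y, - K <= y -> y <= K -> `|p y| <= Mp) ->
    forall y, `|y| <= K -> `|p y| <= M.
  move=> MpM hp y; rewrite ler_norml => /andP[y1 y2].
  by rewrite (le_trans _ MpM)// hp.
have gM : forall y, `|y| <= K -> `|g y| <= M by apply: le_M hM1; rewrite /M; lra.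
have g'M : forall y, `|y| <= K -> `|g' y| <= M by apply: le_M hM2; rewrite /M; lra.
have bM : forall y, `|y| <= K -> `|b y| <= M by apply: le_M hM3; rewrite /M; lra.
have tge0 := ltW t0.
have mA := mconfined tge0.
have mXt := mX tge0.
have if_ : L1 P (fun w => \1_(confined t) w * f (X t w)).
  apply: (@L1_bounded _ _ _ _ _ Mf) => [|w].
    apply: measurable_funM; first exact: measurable_indic.
    exact: measurableT_comp.
  rewrite normrM -[leRHS]mul1r; apply: ler_pM => //.
    by rewrite indicE; case: (_ \in _); rewrite ?normr1 ?normr0.
  by have /andP[fp fM] := f_itv (X t w); rewrite ger0_norm.
apply: (@le_trans _ _ (\int[P]_w (sigma0 ^+ 2 * (\1_(confined t) w * f (X t w))))).
  have XK w : confined t w -> `|X t w| <= K by apply.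
  apply: le_Exp; last 2 first.
  - exact: L1Z.
  - move=> w; rewrite indicE; have [/set_mem cw|_] := boolP (w \in confined t).
      by rewrite !mul1r; apply: f_ge; exact: XK.
    by rewrite !mul0r mulr0.
  apply: (@L1_bounded _ _ _ _ _ (K ^+ 2)) => [|w].
    by apply: measurable_funM; [exact: measurable_indic|exact: measurable_funX].
  rewrite indicE; have [/set_mem cw|_] := boolP (w \in confined t).
    rewrite mul1r normrX lerXn2r// ?nnegrE ?(ltW K0)//; exact: XK.
  by rewrite mul0r normr0 sqr_ge0.
rewrite ExpZ// ler_wpM2l ?sqr_ge0//.
pose Q1 := sigma0 ^+ 2 + M + 4 * M ^+ 2 + sigma0 ^+ 4 * (48 * expR (1 / 2)) + 4.
apply: (@le_of_le_addM _ _ _ (t * Q1 + 2 * M ^+ 2)) => l l0 l1.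
have [C C0 hC] := taylor l l0.
have S0 : 0 < 1 + 4 * sigma0 ^+ 2 by have := sqr_ge0 sigma0; lra.
(* C may vanish, so C + 1 is used in denominators. *)
have C1 : 0 < C + 1 by lra.
have [q [q0 q1 Cq]] : exists q : R,
    [/\ 0 < q, q <= 1 & C * (q * (1 + 4 * sigma0 ^+ 2)) <= l].
  have r0 : 0 < l / ((C + 1) * (1 + 4 * sigma0 ^+ 2)) by rewrite divr_gt0// mulr_gt0.
  exists (Num.min 1 (l / ((C + 1) * (1 + 4 * sigma0 ^+ 2)))); split.
  - by rewrite lt_min ltr01.
  - by rewrite ge_min lexx.
  - set r := Num.min _ _; have rr : 0 <= r by rewrite /r le_min ler01 ltW.
    apply: (@le_trans _ _ (r * ((C + 1) * (1 + 4 * sigma0 ^+ 2)))).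
      have := mulr_ge0 rr (ltW S0); move: (1 + 4 * _) => z; lra.
    by rewrite -ler_pdivlMr ?mulr_gt0// /r ge_min lexx orbT.
have [n1 [W1 [mW1 PW1 hW1]]] := path_modulus P hF abX cbX tge0 l0 l0.
have [n2 [W2 [mW2 PW2 hW2]]] := path_modulus P hF aH cH tge0 q0 q0.
have [de [de0 d1 d2 d3 d4]] : exists de : R, [/\ 0 < de, de <= n1.+1%:R^-1,
    de <= n2.+1%:R^-1, de <= l & C * de <= l].
  have lC : 0 < l / (C + 1) by rewrite divr_gt0.
  exists (Num.min (Num.min n1.+1%:R^-1 n2.+1%:R^-1) (l / (C + 1))); split.
  - by rewrite !lt_min !invr_gt0 !ltr0n lC.
  - by rewrite !ge_min lexx.
  - by rewrite !ge_min lexx orbT.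
  - rewrite !ge_min; apply/orP; right; rewrite ler_pdivrMr// ler_peMr ?(ltW l0)//; lra.
  - apply: (@le_trans _ _ (C * (l / (C + 1)))).
      by rewrite ler_wpM2l// ge_min lexx orbT.
    rewrite mulrCA ler_piMr ?(ltW l0)// ler_pdivrMr// mul1r; lra.
have [m hm] : exists m : nat, t / m.+1%:R <= de.
  exists (Num.bound (t / de)).
  rewrite ler_pdivrMr// mulrC -ler_pdivrMr//.
  apply: (@le_trans _ _ (Num.bound (t / de))%:R); last by rewrite ler_nat.
  by apply/ltW/archi_boundP; rewrite divr_ge0// ltW.
have Xsde k : exists I : T -> R, ito_integral P F B H (k%:R * (t / m.+1%:R)) I /\
    {ae P, forall w, X (k%:R * (t / m.+1%:R)) w = X 0 w + I w +
      \int[lebesgue_measure]_(s in `[0, k%:R * (t / m.+1%:R)]) bX s w}.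
  have [_ _ _ hs] := hX.
  have k0 : 0 <= k%:R * (t / m.+1%:R) by rewrite mulr_ge0// divr_ge0.
  by have [_ [J J1 J2]] := hs _ k0; exists J.
have [I hI] := choice Xsde.
apply: (scheme_upper_bound mf f00 f_itv cg cg' gM g'M bM gen M0 l0 C0 q0 hC
  mW1 PW1 mW2 PW2 hW1 hW2 (le_trans hm d1) (le_trans hm d2) q1 Cq (le_trans hm d3)
  _ (fun k => (hI k).1) (fun k => (hI k).2)).
by apply: le_trans d4; rewrite ler_wpM2l.
Qed.

End euler_scheme.

(** * Removal of the localization *)

Local Unset Implicit Arguments.

(** A continuous path is bounded on [0, t], so it is confined at every large enough level, and
    monotone convergence removes the indicator. The expectation is an extended real, so its
    finiteness is part of the conclusion. *)
Theorem proposition0p2 (R : realType) (sigma : R -> R) (sigma0 : R)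
  (sigma_gt0 : forall x : R, 0 < sigma x)
  (sigma_derivable : forall x : R, derivable sigma x 1)
  (sigma'_lipschitz : locally_lipschitz (sigma^`())%classic)
  (sigma_bounded : forall x : R, sigma x <= sigma0)
  (d : measure_display) (T : measurableType d) (P : probability T R)
  (F : R -> set (set T)) (hF : filtration F)
  (B : R -> T -> R) (hB : brownian_motion P F B)
  (X : R -> T -> R)
  (hX : sde_solution P F B sigma (fun x => sigma x * (sigma^`())%classic x) 0 X) :
  forall t : R, 0 < t ->
    ('E_P[(fun w => (X t w ^+ 2)%R)] <= (sigma0 ^+ 2 * t)%:E)%E.
Proof.
move=> t t0; rewrite unlock.
have tge0 := ltW t0.
have [aX cX _ _] := hX.
have mXt : measurable_fun setT (X t) by exact: (adapted_measurable hF aX).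
have mA n : measurable (confined X n.+1%:R t).
  have [_ FT _] := hF.
  have := measurable_fun_sub_id (FT _ tge0) measurableT
    (path_sup_measurable hF aX cX n.+1%:R tge0).
  by rewrite setTI.
(* The levels are [n.+1] because the localized bound requires K > 0. *)
apply: (@monotone_integral_le _ _ _ _
  (fun n w => \1_(confined X n.+1%:R t) w * X t w ^+ 2)).
- move=> n; apply: measurable_funM; first exact: measurable_indic.
  exact: measurable_funX.
- by move=> n w; rewrite mulr_ge0 ?sqr_ge0.
- move=> w n m nm; rewrite ler_wpM2r ?sqr_ge0// indicE.
  have [/set_mem hn|_] := boolP (w \in _); last by rewrite indicE.
  rewrite indicE mem_set// => r r0 rt.
  by rewrite (le_trans (hn r r0 rt))// ler_nat ltnS.
- move=> w.
  have cc : continuous (X ^~ w \o clamp t) by exact: continuous_clamp (@cX w).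
  have [M M0 hM] := continuous_segment_bounded tge0 cc.
  near=> n; rewrite indicE mem_set ?mul1r// => r r0 rt.
  have := hM _ r0 rt; rewrite /= clamp_id// => /le_trans; apply.
  rewrite (@le_trans _ _ n%:R) ?ler_nat//.
  by near: n; exact: nbhs_infty_ger.
- move=> n.
  have iA : L1 P (fun w => \1_(confined X n.+1%:R t) w * X t w ^+ 2).
    apply: (@L1_bounded _ _ _ _ _ (n.+1%:R ^+ 2)) => [|w].
      by apply: measurable_funM; [exact: measurable_indic|exact: measurable_funX].
    rewrite indicE; have [/set_mem cw|_] := boolP (w \in confined X n.+1%:R t).
      by rewrite mul1r normrX lerXn2r// ?nnegrE//; exact: cw.
    by rewrite mul0r normr0 sqr_ge0.
  rewrite EFin_Exp// lee_fin.
  exact: (confined_second_moment hF hB sigma_gt0 sigma_derivable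
    sigma'_lipschitz sigma_bounded hX t0).
Unshelve. all: by end_near. Qed.
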